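(* Let $\phi:M^m\rightarrow N^{m+1}(c)$ be a hypersurface in a space form, with shape operator $A$, mean curvature function $f$, scalar curvature $s$, and biharmonic stress-energy tensor $S_2$. Then \begin{align*} \frac{1}{2}\Delta|S_2|^2=&-|\nabla S_2|^2+4cm^4f^4-4m^3f^3(\operatorname{trace} A^3)-4m^2f^2|A|^2(cm-|A|^2)\\ &+m^4(m-16)f^2|\operatorname{grad} f|^2+4m^2|A|^2|\operatorname{grad} f|^2+2m^2|A|^2\Delta f^2\\ &+4m^2f\langle\operatorname{grad} s,\operatorname{grad} f\rangle-8m^2\operatorname{div}(f\operatorname{Ricci}(\operatorname{grad} f))\\ & +\frac{m^5}{8}\Delta f^4-4cm^2(m-1)\Delta f^2-10m^2f\langle\tau_2^{\top}(\phi),\operatorname{grad} f\rangle\\ &-4m^2f^2\operatorname{div}\left(\tau_2^{\top}(\phi)\right)-2\left|\tau_2^{\top}(\phi)\right|^2+4mf\langle\nabla\tau_2^{\top}(\phi),A\rangle. \end{align*}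
   Context: Manifolds are smooth, connected and without boundary. $N^{m+1}(c)$ is a space form, i.e. an $(m+1)$-dimensional Riemannian manifold of constant sectional curvature $c$. A hypersurface $\phi:M^m\to N^{m+1}(c)$ is an isometric immersion of an $m$-dimensional Riemannian manifold $M$. $\eta$ is a (local) unit normal vector field, $A$ the shape operator in direction $\eta$, viewed as a symmetric $(1,1)$-tensor on $M$ ($\langle AX,Y\rangle$ is the $\eta$-component of the second fundamental form $B(X,Y)$), $f=\frac1m\operatorname{trace}A$ is the mean curvature function and $H=f\eta$ the mean curvature vector field; all expressions are invariant under $\eta\mapsto-\eta$. The tension field is $\tau(\phi)=\operatorname{trace}\nabla d\phi=mH$. The bitension field is $\tau_2(\phi)=-\Delta\tau(\phi)-\operatorname{trace}R^N(d\phi,\tau(\phi))d\phi$, where $R^N(X,Y)Z=[\nabla^N_X,\nabla^N_Y]Z-\nabla^N_{[X,Y]}Z$ and, on sections of $\phi^{-1}(TN)$, $\Delta=-\operatorname{trace}(\nabla^\phi\nabla^\phi-\nabla^\phi_\nabla)$. $\tau_2^\top(\phi)$ is its tangent part; for a hypersurface in a space form, $\tau_2^{\top}(\phi)=-2mA(\operatorname{grad}f)-\frac{m^2}{2}\operatorname{grad}f^2$. The biharmonic stress-energy tensor is $S_2(X,Y)=\frac12|\tau(\phi)|^2\langle X,Y\rangle+\langle d\phi,\nabla\tau(\phi)\rangle\langle X,Y\rangle-\langle d\phi(X),\nabla_Y\tau(\phi)\rangle-\langle d\phi(Y),\nabla_X\tau(\phi)\rangle$; for a hypersurface, as a $(1,1)$-tensor,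 $S_2=-\frac{m^2f^2}{2}I+2mfA$. On functions $\Delta u=-\operatorname{div}\operatorname{grad}u$. $\operatorname{Ricci}$ is the Ricci operator ($(1,1)$-tensor) and $s$ the scalar curvature of $M$. With $\{X_i\}$ a local orthonormal frame, $|A|^2=\operatorname{trace}A^2$, $|\nabla S_2|^2=\sum_{i,j}|(\nabla_{X_i}S_2)X_j|^2$, and $\langle\nabla V,A\rangle=\sum_i\langle\nabla_{X_i}V,AX_i\rangle$ for a vector field $V$. *)

(* Defs.v *)
(* Tangent vectors are handled through their components in a chart, as row
   vectors; a (1,1)-tensor is a square matrix T acting on the right, v |-> v *m T.
   A Riemannian metric in a chart is the map x |-> G x giving its Gram matrix in
   the coordinate frame.  Constant functions [cst v] stand for the coordinate
   vector fields with constant components: these commute, and they serve to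
   extend a tangent vector v wherever a formula is tensorial in that argument. *)
From HB Require Import structures.
From mathcomp Require Import all_boot all_order all_algebra.
From mathcomp Require Import all_classical all_reals all_analysis.

Set Implicit Arguments.
Unset Strict Implicit.
Unset Printing Implicit Defensive.
Import Order.TTheory GRing.Theory Num.Theory.
Import numFieldNormedType.Exports.
Local Open Scope classical_set_scope.
Local Open Scope ring_scope.

(* All iterated directional derivatives exist and are differentiable on U.
   To be used with U open. *)
Definition smooth_on (R : realType) (V W : normedModType R)
    (U : set V) (f : V -> W) : Prop :=
  forall (vs : seq V) (x : V), U x ->
    differentiable (foldr (fun v h => 'D_v h) f vs) x.

Section MetricAlgebra.
Variables (R : realType) (n : nat).
Implicit Types (G : 'M[R]_n) (u v : 'rV[R]_n).

Definition dvec (i : 'I_n) : 'rV[R]_n := delta_mx 0 i.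

Definition inner G u v : R := (u *m G *m v^T) 0 0.

(* Sum of g^{ij} b(d_i, d_j); see [metric_trace_orthonormal]. *)
Definition metric_trace (V : lmodType R) G
    (b : 'rV[R]_n -> 'rV[R]_n -> V) : V :=
  \sum_i \sum_j invmx G i j *: b (dvec i) (dvec j).

Lemma metric_trace_orthonormal (V : lmodType R) G
    (b : 'rV[R]_n -> 'rV[R]_n -> V) (E : 'M[R]_n) :
  (forall v, linear (b ^~ v)) -> (forall u, linear (b u)) ->
  (forall i j, inner G (row i E) (row j E) = (i == j)%:R) ->
  metric_trace G b = \sum_i b (row i E) (row i E).
Proof.
move=> bl br EG.
have EGE : E *m (G *m E^T) = 1%:M.
  apply/matrixP => i j; rewrite mulmxA !mxE -EG /inner -row_mul !mxE.
  by apply: eq_bigr => k _; rewrite !mxE.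
have [Eu GEu] := mulmx1_unit EGE.
have Gu : G \in unitmx.
  by move: GEu; rewrite unitmx_mul => /andP[].
have EE : E^T *m E = invmx G.
  have : G *m E^T *m E = 1%:M by apply: mulmx1C.
  by rewrite -mulmxA => H; rewrite -[LHS](mulKmx Gu) H mulmx1.
pose Bl v := GRing.isLinear.Build R _ _ _ (b ^~ v) (bl v).
pose Br u := GRing.isLinear.Build R _ _ _ (b u) (br u).
pose lf v : {linear 'rV[R]_n -> V} := HB.pack (b ^~ v) (Bl v).
pose rf u : {linear 'rV[R]_n -> V} := HB.pack (b u) (Br u).
have suml (a : 'I_n -> R) v :
    b (\sum_k a k *: dvec k) v = \sum_k a k *: b (dvec k) v.
  by rewrite -[LHS]/(lf v _) linear_sum; apply: eq_bigr => k _; rewrite linearZ.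
have sumr (a : 'I_n -> R) u :
    b u (\sum_k a k *: dvec k) = \sum_k a k *: b u (dvec k).
  by rewrite -[LHS]/(rf u _) linear_sum; apply: eq_bigr => k _; rewrite linearZ.
have expand i : b (row i E) (row i E) =
    \sum_k \sum_l (E i k * E i l) *: b (dvec k) (dvec l).
  rewrite (row_sum_delta (row i E)) suml; apply: eq_bigr => k _.
  rewrite sumr scaler_sumr.
  by apply: eq_bigr => l _; rewrite scalerA !mxE.
rewrite (eq_bigr _ (fun i _ => expand i)) exchange_big /=.
apply: eq_bigr => k _; rewrite exchange_big /=; apply: eq_bigr => l _.
rewrite -scaler_suml -EE !mxE; congr (_ *: _).
by apply: eq_bigr => i _; rewrite !mxE.
Qed.

(* The (1,1)-tensor T with <T u, v> = b(u, v). *)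
Definition endo_of_form G (b : 'rV[R]_n -> 'rV[R]_n -> R) : 'M[R]_n :=
  (\matrix_(i, j) b (dvec i) (dvec j)) *m invmx G.

Definition endo_normsq G (T : 'M[R]_n) : R :=
  metric_trace G (fun u v => inner G (u *m T) (v *m T)).

End MetricAlgebra.
Arguments dvec {R n}.

Section LeviCivita.
Variables (R : realType) (n : nat) (G : 'rV[R]_n -> 'M[R]_n).
Implicit Types (x u v w : 'rV[R]_n) (X : 'rV[R]_n -> 'rV[R]_n).

(* Koszul's formula for the vector nabla_u w, for constant u and w. *)
Definition christoffel x u w : 'rV[R]_n :=
  2^-1 *: (\row_l ('D_u (fun y => inner (G y) w (dvec l)) x
                   + 'D_w (fun y => inner (G y) u (dvec l)) x
                   - 'D_(dvec l) (fun y => inner (G y) u w) x))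
    *m invmx (G x).

Definition covd v X x : 'rV[R]_n := 'D_v X x + christoffel x v (X x).

(* R(u, v) w = [nabla_u, nabla_v] w - nabla_[u, v] w; the bracket of constant
   fields vanishes. *)
Definition curvature x u v w : 'rV[R]_n :=
  covd u (covd v (cst w)) x - covd v (covd u (cst w)) x.

Definition sectional_curvature x u v : R :=
  inner (G x) (curvature x u v v) u
    / (inner (G x) u u * inner (G x) v v - inner (G x) u v ^+ 2).

(* Ricci(u) = trace of (v, w) |-> R(u, v) w. *)
Definition ricci x : 'M[R]_n :=
  lin1_mx (fun u => metric_trace (G x) (curvature x u)).

Definition scalar_curvature x : R := \tr (ricci x).

Definition grad (u : 'rV[R]_n -> R) x : 'rV[R]_n :=
  (\row_i 'D_(dvec i) u x) *m invmx (G x).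

Definition divergence X x : R := \sum_i covd (dvec i) X x 0 i.

Definition laplacian (u : 'rV[R]_n -> R) x : R := - divergence (grad u) x.

(* (nabla_v T) w *)
Definition covd_endo v (T : 'rV[R]_n -> 'M[R]_n) w x : 'rV[R]_n :=
  covd v (fun y => w *m T y) x - covd v (cst w) x *m T x.

(* |nabla T|^2 = sum over i, j of |(nabla_(X_i) T) X_j|^2 *)
Definition covd_endo_normsq (T : 'rV[R]_n -> 'M[R]_n) x : R :=
  metric_trace (G x) (fun u u' => metric_trace (G x) (fun w w' =>
    inner (G x) (covd_endo u T w x) (covd_endo u' T w' x))).

(* <nabla X, T> = sum over i of <nabla_(X_i) X, T X_i> *)
Definition inner_covd_endo X (T : 'rV[R]_n -> 'M[R]_n) x : R :=
  metric_trace (G x) (fun u v => inner (G x) (covd u X x) (v *m T x)).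

End LeviCivita.

(* F is a map between coordinate domains carrying the metrics g and h.  Fields
   along F are given by their components in the target coordinates. *)
Section MapGeometry.
Variables (R : realType) (m k : nat).
Variables (g : 'rV[R]_m -> 'M[R]_m) (h : 'rV[R]_k -> 'M[R]_k).
Variable F : 'rV[R]_m -> 'rV[R]_k.
Implicit Types (x u v : 'rV[R]_m) (V eta : 'rV[R]_m -> 'rV[R]_k).

(* The connection of the pull-back bundle. *)
Definition covd_along v V x : 'rV[R]_k :=
  'D_v V x + christoffel h (F x) ('D_v F x) (V x).

(* nabla dF, which is the second fundamental form when F is isometric. *)
Definition second_form x u v : 'rV[R]_k :=
  covd_along u ('D_v F) x - 'D_(covd g u (cst v) x) F x.

Definition tension x : 'rV[R]_k := metric_trace (g x) (second_form x).

Definition rough_laplacian V x : 'rV[R]_k :=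
  - metric_trace (g x) (fun u v =>
      covd_along u (covd_along v V) x - covd_along (covd g u (cst v) x) V x).

Definition bitension x : 'rV[R]_k :=
  - rough_laplacian tension x
  - metric_trace (g x) (fun u v =>
      curvature h (F x) ('D_u F x) (tension x) ('D_v F x)).

(* The tangent vector t with <dF t, dF u> = <V, dF u> for all u, for F
   isometric. *)
Definition tangent_part V x : 'rV[R]_m :=
  (\row_i inner (h (F x)) (V x) ('D_(dvec i) F x)) *m invmx (g x).

Definition stress_energy_form x u v : R :=
  2^-1 * inner (h (F x)) (tension x) (tension x) * inner (g x) u v
  + metric_trace (g x) (fun w z =>
      inner (h (F x)) ('D_w F x) (covd_along z tension x)) * inner (g x) u v
  - inner (h (F x)) ('D_u F x) (covd_along v tension x)
  - inner (h (F x)) ('D_v F x) (covd_along u tension x).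

Definition stress_energy x : 'M[R]_m :=
  endo_of_form (g x) (stress_energy_form x).

Definition shape_operator eta x : 'M[R]_m :=
  endo_of_form (g x) (fun u v => inner (h (F x)) (second_form x u v) (eta x)).

Definition mean_curvature eta x : R := m%:R^-1 * \tr (shape_operator eta x).

End MapGeometry.

Record manifold (R : realType) (n : nat) := Manifold {
  points :> topologicalType;
  chart : Type;
  chart_dom : chart -> set points;
  chart_coord : chart -> points -> 'rV[R]_n;
  chart_param : chart -> 'rV[R]_n -> points;
  chart_cover : forall p, exists a, chart_dom a p;
  chart_dom_open : forall a, open (chart_dom a);
  chart_im_open : forall a, open (chart_coord a @` chart_dom a);
  chart_coordK : forall a p, chart_dom a p -> chart_param a (chart_coord a p) = p;
  chart_coord_continuous : forall a p, chart_dom a p ->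
    {for p, continuous (chart_coord a)};
  chart_param_continuous : forall a x, (chart_coord a @` chart_dom a) x ->
    {for x, continuous (chart_param a)};
  transition_smooth : forall a b,
    smooth_on [set x | (chart_coord a @` chart_dom a) x /\ chart_dom b (chart_param a x)]
      (chart_coord b \o chart_param a);
  points_hausdorff : hausdorff_space points;
  points_second_countable : @second_countable points;
  points_connected : connected [set: points] }.

Definition chart_im (R : realType) (n : nat) (M : manifold R n)
  (a : chart M) : set 'rV[R]_n := chart_coord a @` chart_dom a.

Definition local_map (R : realType) (m n : nat)
    (M : manifold R m) (N : manifold R n) (phi : M -> N)
    (a : chart M) (b : chart N) : 'rV[R]_m -> 'rV[R]_n :=
  chart_coord b \o phi \o chart_param a.

Definition local_map_dom (R : realType) (m n : nat)
    (M : manifold R m) (N : manifold R n) (phi : M -> N)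
    (a : chart M) (b : chart N) : set 'rV[R]_m :=
  [set x | chart_im a x /\ chart_dom b (phi (chart_param a x))].

Definition smooth_map (R : realType) (m n : nat)
    (M : manifold R m) (N : manifold R n) (phi : M -> N) : Prop :=
  continuous phi /\
  forall a b, smooth_on (local_map_dom phi a b) (local_map phi a b).

Record riemannian_manifold (R : realType) (n : nat) := RiemannianManifold {
  underlying :> manifold R n;
  gram : chart underlying -> 'rV[R]_n -> 'M[R]_n;
  gram_smooth : forall a, smooth_on (chart_im a) (gram a);
  gram_sym : forall a x, chart_im a x -> (gram a x)^T = gram a x;
  gram_pos : forall a x u, chart_im a x -> u != 0 -> 0 < inner (gram a x) u u;
  gram_transition : forall a b x, local_map_dom id a b x ->
    forall u v, inner (gram a x) u v =
      inner (gram b (local_map id a b x))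
        ('D_u (local_map id a b) x) ('D_v (local_map id a b) x) }.

(* The metric being positive definite, such a map is an immersion. *)
Definition isometric_immersion (R : realType) (m n : nat)
    (M : riemannian_manifold R m) (N : riemannian_manifold R n)
    (phi : M -> N) : Prop :=
  smooth_map phi /\
  forall a b x, local_map_dom phi a b x ->
    forall u v, inner (gram a x) u v =
      inner (gram b (local_map phi a b x))
        ('D_u (local_map phi a b) x) ('D_v (local_map phi a b) x).

Definition constant_curvature (R : realType) (n : nat)
    (N : riemannian_manifold R n) (c : R) : Prop :=
  forall (b : chart N) y u v, chart_im b y -> row_free (col_mx u v) ->
    sectional_curvature (gram b) y u v = c.

(* eta gives, in the coordinates of the charts a and b, a smooth unit normal
   field along phi over the open set U. *)
Definition local_unit_normal (R : realType) (m : nat)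
    (M : riemannian_manifold R m) (N : riemannian_manifold R m.+1)
    (phi : M -> N) (a : chart M) (b : chart N) (U : set M)
    (eta : 'rV[R]_m -> 'rV[R]_m.+1) : Prop :=
  [/\ open U, U `<=` chart_dom a, phi @` U `<=` chart_dom b,
      smooth_on (chart_coord a @` U) eta &
      forall x, (chart_coord a @` U) x ->
        let hx := gram b (local_map phi a b x) in
        inner hx (eta x) (eta x) = 1 /\
        forall u, inner hx (eta x) ('D_u (local_map phi a b) x) = 0].

(* Main.v *)
(* In a chart, the functions smooth on the domain form a commutative ring with
   commuting derivations, and every tensor becomes a matrix over that ring, so the
   identity is a statement of differential algebra; evaluating at a point gives
   it for the quantities of the statement.
   There, constant sectional curvature determines the full curvature tensor of N
   by polarization, whence the equations of Gauss and Codazzi, and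
     Ric = c(m-1)I + tA - A^2,  S_2 = -t^2/2 I + 2tA,
     tau_2^T = -2A(grad t) - t grad t,  where t = tr A = mf.
   Hence |S_2|^2 = m t^4/4 - 2t^4 + 4t^2|A|^2, and Simons' formula for
   Delta|A|^2 reduces the claim to an identity between polynomials in t, |A|^2,
   tr A^3, |grad t|^2, <A grad t, grad t>, |A grad t|^2, <grad t, grad |A|^2>,
   div(grad t), div(A^2 grad t), <nabla grad t, A> and |nabla A|^2. *)
Require Import Defs.
From HB Require Import structures.
From mathcomp Require Import all_boot all_order all_algebra.
From mathcomp Require Import all_classical all_reals all_analysis.
From mathcomp Require Import ring lra.
Import Order.TTheory GRing.Theory Num.Theory.
Import numFieldNormedType.Exports.
Local Open Scope classical_set_scope.
Local Open Scope ring_scope.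

Set Implicit Arguments.
Unset Strict Implicit.
Unset Printing Implicit Defensive.

(** As stated, the identity contains derivatives of [phi] up to order five, and ['D_v] is meaningful
    only where a function is differentiable: argued pointwise, each Leibniz step would carry a
    differentiability condition and each exchange of derivatives an appeal to Schwarz's theorem.
    Over a ring of smooth functions this is paid once; what remains of analysis is Leibniz's rule,
    commutation of the partial derivatives, and the chain rule along the pull-back morphism between
    the rings of the two charts. The price is that the ring is not a field and the frame is the
    coordinate frame. The inverse metric is a matrix [gi] given with its equation; traces are
    contractions with [gi], without orthonormal frames or normal coordinates, so second covariant
    derivatives carry Christoffel corrections. The core identity is stated without division, for t
    instead of f and 2 S_2 instead of S_2; the factors 1/2 and 1/m are restored afterwards as
    constant functions. *)

Section MatrixEntries.
Variable K : comNzRingType.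

Lemma addmxE p q (X Y : 'M[K]_(p, q)) i j : (X + Y) i j = X i j + Y i j.
Proof. by rewrite mxE. Qed.

Lemma oppmxE p q (X : 'M[K]_(p, q)) i j : (- X) i j = - X i j.
Proof. by rewrite mxE. Qed.

Lemma scalemxE p q a (X : 'M[K]_(p, q)) i j : (a *: X) i j = a * X i j.
Proof. by rewrite mxE. Qed.

Lemma zeromxE p q i j : (0 : 'M[K]_(p, q)) i j = 0.
Proof. by rewrite mxE. Qed.

(** The Gauss equation writes the curvature as a sum of such rank-one products; factoring their
    entries is what lets Simons' formula be contracted. *)
Lemma mul_outerE m n p q r s (X : 'M[K]_(m, n)) (Y : 'M[K]_(n, p))
    (Z : 'M[K]_(q, r)) (W : 'M[K]_(r, s)) k i a b :
  (X *m (col k Y *m row i Z) *m W) a b = (X *m Y) a k * (Z *m W) i b.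
Proof.
rewrite mulmxA -[_ *m _ *m W]mulmxA -row_mul !mxE big_ord1 !mxE.
by congr (_ * _); apply: eq_bigr => l _; rewrite !mxE.
Qed.

Lemma sum_mul_tr m n (X Y : 'M[K]_(m, n)) :
  \sum_i \sum_j X i j * Y i j = \tr (X *m Y^T).
Proof. by apply: eq_bigr => i _; rewrite mxE; apply: eq_bigr => j _; rewrite mxE. Qed.

Lemma trmxD p q (X Y : 'M[K]_(p, q)) : (X + Y)^T = X^T + Y^T.
Proof. exact: linearD. Qed.

Lemma trmxN p q (X : 'M[K]_(p, q)) : (- X)^T = - X^T.
Proof. exact: linearN. Qed.

Lemma trmxZ p q a (X : 'M[K]_(p, q)) : (a *: X)^T = a *: X^T.
Proof. exact: linearZ. Qed.

Lemma trmx_sum I (r : seq I) p q (X : I -> 'M[K]_(p, q)) :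
  (\sum_(i <- r) X i)^T = \sum_(i <- r) (X i)^T.
Proof. exact: (raddf_sum (@trmx K p q)). Qed.

Lemma row_sum I (r : seq I) p q k (X : I -> 'M[K]_(p, q)) :
  row k (\sum_(i <- r) X i) = \sum_(i <- r) row k (X i).
Proof. exact: (raddf_sum (row k)). Qed.

Lemma mulmxZl p q r a (X : 'M[K]_(p, q)) (Y : 'M[K]_(q, r)) :
  (a *: X) *m Y = a *: (X *m Y).
Proof. by rewrite scalemxAl. Qed.

Lemma mulmxZr p q r a (X : 'M[K]_(p, q)) (Y : 'M[K]_(q, r)) :
  X *m (a *: Y) = a *: (X *m Y).
Proof. by rewrite scalemxAr. Qed.

Lemma rowM p q r i (X : 'M[K]_(p, q)) (Y : 'M[K]_(q, r)) :
  row i (X *m Y) = row i X *m Y.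
Proof. exact: row_mul. Qed.

Lemma rowD p q i (X Y : 'M[K]_(p, q)) : row i (X + Y) = row i X + row i Y.
Proof. exact: linearD. Qed.

Lemma rowN p q i (X : 'M[K]_(p, q)) : row i (- X) = - row i X.
Proof. exact: linearN. Qed.

End MatrixEntries.

Lemma mul_row_tr (K : comNzRingType) p q (X : 'rV[K]_q) (Y : 'M[K]_(p, q)) l :
  (X *m (row l Y)^T) 0 0 = (X *m Y^T) 0 l.
Proof. by rewrite !mxE; apply: eq_bigr => a _; rewrite !mxE. Qed.

Lemma row_bilinear (K : comNzRingType) p q r (X : 'M[K]_(p, q)) (H : 'M[K]_(q, r))
    p' (Y : 'M[K]_(p', r)) k l :
  (row k X *m H *m (row l Y)^T) 0 0 = (X *m H *m Y^T) k l.
Proof. by rewrite mul_row_tr -!rowM mxE. Qed.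

Ltac mxexpand :=
  rewrite ?(mulmxDl, mulmxDr, mulmxBl, mulmxBr, mulNmx, mulmxN, mulmxA,
            trmxD, trmxN, trmxZ, trmx_mul, trmxK, scalerDr, scalerBr, scalerN,
            mulmxZl, mulmxZr, scalerA).
Ltac mxlin :=
  let i := fresh "i" in let j := fresh "j" in
  apply/matrixP => i j; rewrite ?(addmxE, oppmxE, scalemxE, zeromxE); ring.

(** * Connections and curvature over a ring with commuting derivations *)

Record derivations (K : comNzRingType) (m : nat) := Derivations {
  der :> 'I_m -> {additive K -> K};
  derM : forall i a b, der i (a * b) = der i a * b + a * der i b;
  derC : forall i j a, der i (der j a) = der j (der i a) }.

Section Derivations.
Variables (K : comNzRingType) (m : nat) (D : derivations K m).

Definition dmx p q i (X : 'M[K]_(p, q)) : 'M[K]_(p, q) := map_mx (D i) X.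

Lemma dmxD p q i (X Y : 'M[K]_(p, q)) : dmx i (X + Y) = dmx i X + dmx i Y.
Proof. exact: map_mxD. Qed.

Lemma dmxN p q i (X : 'M[K]_(p, q)) : dmx i (- X) = - dmx i X.
Proof. exact: map_mxN. Qed.

Lemma dmxB p q i (X Y : 'M[K]_(p, q)) : dmx i (X - Y) = dmx i X - dmx i Y.
Proof. exact: map_mxB. Qed.

Lemma dmx0 p q i : dmx i (0 : 'M[K]_(p, q)) = 0.
Proof. exact: map_mx0. Qed.

Lemma dmxM p q r i (X : 'M[K]_(p, q)) (Y : 'M[K]_(q, r)) :
  dmx i (X *m Y) = dmx i X *m Y + X *m dmx i Y.
Proof.
apply/matrixP => a b; rewrite !mxE raddf_sum -big_split /=.
by apply: eq_bigr => k _; rewrite derM !mxE.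
Qed.

Lemma dmxZ p q i a (X : 'M[K]_(p, q)) :
  dmx i (a *: X) = D i a *: X + a *: dmx i X.
Proof. by apply/matrixP => k l; rewrite !mxE derM. Qed.

Lemma dmx_tr p q i (X : 'M[K]_(p, q)) : dmx i X^T = (dmx i X)^T.
Proof. by apply/matrixP => a b; rewrite !mxE. Qed.

Lemma dmxC p q i j (X : 'M[K]_(p, q)) : dmx i (dmx j X) = dmx j (dmx i X).
Proof. by apply/matrixP => a b; rewrite !mxE derC. Qed.

Lemma dmx_row p q i k (X : 'M[K]_(p, q)) : dmx i (row k X) = row k (dmx i X).
Proof. by apply/matrixP => a b; rewrite !mxE. Qed.

Lemma dmx_trace n i (X : 'M[K]_n) : D i (\tr X) = \tr (dmx i X).
Proof. by rewrite raddf_sum; apply: eq_bigr => k _; rewrite mxE. Qed.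

Lemma der1 i : D i 1 = 0.
Proof. by apply: (addrI (D i 1)); rewrite addr0 -{3}[1]mulr1 derM mulr1 mul1r. Qed.

Lemma dern i n : D i n%:R = 0.
Proof. by rewrite raddfMn /= der1 mul0rn. Qed.

Lemma dmx_scalar n i a : dmx i (a%:M : 'M[K]_n) = (D i a)%:M.
Proof. by apply/matrixP => k l; rewrite !mxE raddfMn. Qed.

Lemma dmx1 n i : dmx i (1%:M : 'M[K]_n) = 0.
Proof. by rewrite dmx_scalar der1 raddf0. Qed.

Section Connection.
Variables (n : nat) (Gam : 'I_m -> 'M[K]_n).

(* The rows of V are sections; Gam i holds the Christoffel symbols of nabla_i,
   acting on the right. *)
Definition cov p i (V : 'M[K]_(p, n)) : 'M[K]_(p, n) := dmx i V + V *m Gam i.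

(** Row vectors make composition read from left to right, hence the reversed quadratic terms: this
    is the matrix of [nabla_i, nabla_j], as [covC] shows. Coordinate fields commute, so no bracket
    term occurs. *)
Definition curvmx i j : 'M[K]_n :=
  dmx i (Gam j) - dmx j (Gam i) + Gam j *m Gam i - Gam i *m Gam j.

Definition covend i (T : 'M[K]_n) : 'M[K]_n := dmx i T + T *m Gam i - Gam i *m T.

Definition metric_connection (H : 'M[K]_n) :=
  forall i, dmx i H = Gam i *m H + H *m (Gam i)^T.

Lemma covM p q i (X : 'M[K]_(p, q)) (V : 'M[K]_(q, n)) :
  cov i (X *m V) = dmx i X *m V + X *m cov i V.
Proof. by rewrite /cov dmxM; mxexpand; mxlin. Qed.

Lemma covZ p i a (V : 'M[K]_(p, n)) : cov i (a *: V) = D i a *: V + a *: cov i V.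
Proof. by rewrite /cov dmxZ; mxexpand; mxlin. Qed.

Lemma covD p i (V W : 'M[K]_(p, n)) : cov i (V + W) = cov i V + cov i W.
Proof. by rewrite /cov dmxD; mxexpand; mxlin. Qed.

Lemma covN p i (V : 'M[K]_(p, n)) : cov i (- V) = - cov i V.
Proof. by rewrite /cov dmxN; mxexpand; mxlin. Qed.

Lemma cov_sum p i I (r : seq I) (V : I -> 'M[K]_(p, n)) :
  cov i (\sum_(k <- r) V k) = \sum_(k <- r) cov i (V k).
Proof.
elim: r => [|k r IH]; last by rewrite !big_cons covD IH.
by rewrite !big_nil /cov dmx0 mul0mx addr0.
Qed.

Lemma covMend p i (V : 'M[K]_(p, n)) T :
  cov i (V *m T) = cov i V *m T + V *m covend i T.
Proof. by rewrite /cov /covend dmxM; mxexpand; mxlin. Qed.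

Lemma cov_row p i k (V : 'M[K]_(p, n)) : cov i (row k V) = row k (cov i V).
Proof. by rewrite /cov dmx_row rowD rowM. Qed.

Lemma curvmx_anti i j : curvmx i j = - curvmx j i.
Proof. by rewrite /curvmx; mxlin. Qed.

Lemma covC p i j (V : 'M[K]_(p, n)) :
  cov i (cov j V) - cov j (cov i V) = V *m curvmx i j.
Proof. by rewrite /cov /curvmx !dmxD !dmxM (dmxC i j V); mxexpand; mxlin. Qed.

Lemma covendM i T S : covend i (T *m S) = covend i T *m S + T *m covend i S.
Proof. by rewrite /covend dmxM; mxexpand; mxlin. Qed.

Lemma covendD i T S : covend i (T + S) = covend i T + covend i S.
Proof. by rewrite /covend dmxD; mxexpand; mxlin. Qed.

Lemma covendZ i a T : covend i (a *: T) = D i a *: T + a *: covend i T.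
Proof. by rewrite /covend dmxZ; mxexpand; mxlin. Qed.

Lemma covend_scalar i a : covend i a%:M = (D i a)%:M.
Proof. by rewrite /covend dmx_scalar scalar_mxC addrK. Qed.

Lemma covend_trace i T : D i (\tr T) = \tr (covend i T).
Proof.
rewrite dmx_trace /covend raddfB raddfD /= [\tr (T *m _)]mxtrace_mulC.
by rewrite addrK.
Qed.

Lemma covendC i j T :
  covend i (covend j T) - covend j (covend i T) = T *m curvmx i j - curvmx i j *m T.
Proof.
rewrite /covend /curvmx !(dmxD, dmxB, dmxN, dmxM) (dmxC i j T).
by mxexpand; mxlin.
Qed.

Lemma cov_inner (H : 'M[K]_n) p q i (V : 'M[K]_(p, n)) (W : 'M[K]_(q, n)) :
  metric_connection H ->
  dmx i (V *m H *m W^T) = cov i V *m H *m W^T + V *m H *m (cov i W)^T.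
Proof.
by move=> HH; rewrite !dmxM HH dmx_tr /cov; mxexpand; mxlin.
Qed.

(** Apply D_i D_j - D_j D_i to [H] and expand by compatibility: the mixed terms cancel and the
    curvature appears on either side of [H]. *)
Lemma curvmx_skew (H : 'M[K]_n) i j : metric_connection H ->
  curvmx i j *m H = - (H *m (curvmx i j)^T).
Proof.
move=> HH; have := dmxC i j H.
rewrite !HH !(dmxD, dmxM) !HH !dmx_tr => /eqP; rewrite -subr_eq0 => /eqP E.
apply/eqP; rewrite -addr_eq0 -E /curvmx; apply/eqP.
by mxexpand; mxlin.
Qed.

End Connection.

(** [tor] exchanges a row index with a derivation index; after that the derivative terms and the
    quadratic terms of the cyclic sum cancel in pairs. *)
Lemma curvmx_bianchi (Gam : 'I_m -> 'M[K]_m) i j k :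
  (forall i j, row i (Gam j) = row j (Gam i)) ->
  row k (curvmx Gam i j) + row i (curvmx Gam j k) + row j (curvmx Gam k i) = 0.
Proof.
move=> tor; rewrite /curvmx !(rowD, rowN) -!dmx_row.
rewrite !rowM (tor k j) (tor k i) (tor j i).
by mxlin.
Qed.

End Derivations.

(** * Gradient, divergence, Laplacian and metric contractions *)

Section Riemannian.
Variables (K : comNzRingType) (m : nat) (D : derivations K m).
Variables (g gi : 'M[K]_m) (Gam : 'I_m -> 'M[K]_m).
Hypotheses (ggi : g *m gi = 1%:M) (gT : g^T = g).
Hypothesis met : metric_connection D Gam g.
Hypothesis tor : forall i j, row i (Gam j) = row j (Gam i).

Definition divg (V : 'rV[K]_m) : K := \sum_i cov D Gam i V 0 i.
Definition diffr (u : K) : 'rV[K]_m := \row_i D i u.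
Definition gradr (u : K) : 'rV[K]_m := diffr u *m gi.
Definition hessr i j (u : K) : K := D i (D j u) - \sum_k Gam i j k * D k u.
Definition lapl (u : K) : K := - divg (gradr u).
Definition innr (V W : 'rV[K]_m) : K := (V *m g *m W^T) 0 0.

Lemma gig : gi *m g = 1%:M.
Proof. exact: mulmx1C. Qed.

Lemma giT : gi^T = gi.
Proof.
by rewrite -[gi^T]mulmx1 -ggi mulmxA -{1}gT -trmx_mul ggi trmx1 mul1mx.
Qed.

Lemma giC i j : gi i j = gi j i.
Proof. by rewrite -{1}giT mxE. Qed.

(** With the index lowered, metric compatibility leaves only the dual connection; Hessians are
    computed in this form, without differentiating [gi]. *)
Lemma cov_lower i p (V : 'M[K]_(p, m)) :
  cov D Gam i V *m g = dmx D i (V *m g) - V *m g *m (Gam i)^T.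
Proof. by rewrite /cov dmxM met; mxexpand; mxlin. Qed.

Lemma diffrM u v : diffr (u * v) = u *: diffr v + v *: diffr u.
Proof. by apply/rowP => i; rewrite !mxE derM addrC (mulrC _ v). Qed.

Lemma gradrM u v : gradr (u * v) = u *: gradr v + v *: gradr u.
Proof. by rewrite /gradr diffrM; mxexpand. Qed.

Lemma gradrD u v : gradr (u + v) = gradr u + gradr v.
Proof. by rewrite /gradr -mulmxDl; congr (_ *m _); apply/rowP => i; rewrite !mxE raddfD. Qed.

Lemma gradr0 u : (forall i, D i u = 0) -> gradr u = 0.
Proof.
move=> u0; rewrite /gradr; suff -> : diffr u = 0 by rewrite mul0mx.
by apply/rowP => i; rewrite !mxE u0.
Qed.

Lemma gradr_cst u v : (forall i, D i u = 0) -> gradr (u * v) = u *: gradr v.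
Proof. by move=> u0; rewrite gradrM (gradr0 u0) scaler0 addr0. Qed.

Lemma innrC V W : innr V W = innr W V.
Proof.
rewrite /innr -[LHS]/((V *m g *m W^T) 0 0) -[V *m g *m W^T]trmxK mxE.
by rewrite !trmx_mul trmxK gT mulmxA.
Qed.

Lemma innrDl V V' W : innr (V + V') W = innr V W + innr V' W.
Proof. by rewrite /innr !mulmxDl addmxE. Qed.

Lemma innrZl a V W : innr (a *: V) W = a * innr V W.
Proof. by rewrite /innr !mulmxZl scalemxE. Qed.

Lemma innrDr V W W' : innr V (W + W') = innr V W + innr V W'.
Proof. by rewrite innrC innrDl !(innrC V). Qed.

Lemma innrZr a V W : innr V (a *: W) = a * innr V W.
Proof. by rewrite innrC innrZl innrC. Qed.

Lemma innr_grad u V : innr (gradr u) V = \sum_i D i u * V 0 i.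
Proof.
rewrite /innr /gradr -(mulmxA _ gi) gig mulmx1 mxE.
by apply: eq_bigr => i _; rewrite !mxE.
Qed.

Lemma divgZ u V : divg (u *: V) = innr (gradr u) V + u * divg V.
Proof.
rewrite innr_grad /divg mulr_sumr -big_split /=.
by apply: eq_bigr => i _; rewrite covZ !mxE.
Qed.

Lemma divgZcst u V : (forall i, D i u = 0) -> divg (u *: V) = u * divg V.
Proof.
move=> u0; rewrite divgZ innr_grad big1 ?add0r // => i _.
by rewrite u0 mul0r.
Qed.

Lemma divgD V W : divg (V + W) = divg V + divg W.
Proof. by rewrite /divg -big_split /=; apply: eq_bigr => i _; rewrite covD mxE. Qed.

Lemma laplD u v : lapl (u + v) = lapl u + lapl v.
Proof. by rewrite /lapl gradrD divgD opprD. Qed.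

Lemma laplM u v :
  lapl (u * v) = u * lapl v + v * lapl u - 2 * innr (gradr u) (gradr v).
Proof.
rewrite /lapl gradrM divgD !divgZ (innrC (gradr v)); ring.
Qed.

Lemma lapl_cst u v : (forall i, D i u = 0) -> lapl (u * v) = u * lapl v.
Proof.
by move=> u0; rewrite /lapl gradr_cst // divgZcst // mulrN.
Qed.

Lemma cov_grad_lower i u :
  cov D Gam i (gradr u) *m g = \row_j hessr i j u.
Proof.
rewrite cov_lower /gradr -mulmxA gig mulmx1; apply/rowP => j; rewrite !mxE.
by congr (_ - _); apply: eq_bigr => k _; rewrite !mxE mulrC.
Qed.

Lemma lapl_hess u : lapl u = - \sum_i \sum_j gi i j * hessr i j u.
Proof.
rewrite /lapl /divg; congr (- _); apply: eq_bigr => i _.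
rewrite -[cov _ _ _ _]mulmx1 -ggi mulmxA cov_grad_lower mxE.
by apply: eq_bigr => j _; rewrite mxE mulrC giC.
Qed.

Lemma innr_grad2 u v :
  innr (gradr u) (gradr v) = \sum_i \sum_j gi i j * (D i u * D j v).
Proof.
rewrite innr_grad; apply: eq_bigr => i _; rewrite mxE mulr_sumr.
by apply: eq_bigr => j _; rewrite mxE giC; ring.
Qed.

Lemma covend_lower i T :
  covend D Gam i T *m g =
  dmx D i (T *m g) - Gam i *m (T *m g) - T *m g *m (Gam i)^T.
Proof. by rewrite /covend dmxM met; mxexpand; mxlin. Qed.

Lemma covend_sym i T : (T *m g)^T = T *m g ->
  (covend D Gam i T *m g)^T = covend D Gam i T *m g.
Proof.
move=> Ts; rewrite covend_lower !trmxD !trmxN -dmx_tr Ts trmx_mul Ts.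
by rewrite (trmx_mul (_ *m g)) Ts trmxK; mxlin.
Qed.

Lemma sym_trmx T : (T *m g)^T = T *m g -> g *m T^T = T *m g.
Proof. by rewrite trmx_mul gT. Qed.

Lemma sum_gi_mul (X : 'M[K]_m) : \sum_i \sum_j gi i j * X j i = \tr (gi *m X).
Proof. by apply: eq_bigr => i _; rewrite mxE. Qed.

(** Self-adjointness of each [T i] and the exchange property make <T_i e_j, e_l> symmetric in all
    three indices, so the trace over i, j may be replaced by the trace over the last two. *)
Lemma contract_codazzi (T : 'I_m -> 'M[K]_m) :
  (forall i, (T i *m g)^T = T i *m g) ->
  (forall i j, row j (T i) = row i (T j)) ->
  \sum_i \sum_j gi i j *: row j (T i) = (\row_l \tr (T l)) *m gi.
Proof.
move=> Ts Tc; rewrite -[LHS]mulmx1 -ggi mulmxA; congr (_ *m _).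
have sw i j l : (T i *m g) j l = (T j *m g) i l.
  have /rowP/(_ l) : row j (T i *m g) = row i (T j *m g) by rewrite !rowM Tc.
  by rewrite !mxE.
have sy i j l : (T i *m g) j l = (T i *m g) l j by rewrite -{1}Ts mxE.
apply/rowP => l; rewrite [RHS]mxE -[T l]mulmx1 -ggi mulmxA mxtrace_mulC -sum_gi_mul.
rewrite mulmx_suml summxE; apply: eq_bigr => i _.
rewrite mulmx_suml summxE; apply: eq_bigr => j _.
rewrite mulmxZl scalemxE -rowM [row _ _ _ _]mxE; congr (_ * _).
by rewrite sw sy sw.
Qed.

Lemma contract_outer (P Q : 'M[K]_m) :
  \sum_i \sum_j gi i j * \sum_k P j k * Q i k = \tr (gi *m P *m Q^T).
Proof.
rewrite -mulmxA -sum_gi_mul; apply: eq_bigr => i _; apply: eq_bigr => j _.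
by congr (_ * _); rewrite mxE; apply: eq_bigr => k _; rewrite mxE.
Qed.

Lemma contract_tensor (P Q : 'M[K]_m) :
  \sum_i \sum_j gi i j * \sum_k P j i * Q k k = \tr (gi *m P) * \tr Q.
Proof.
rewrite -sum_gi_mul mulr_suml; apply: eq_bigr => i _; rewrite mulr_suml.
by apply: eq_bigr => j _; rewrite -mulr_sumr mulrA.
Qed.

Lemma trace_conj (X : 'M[K]_m) : \tr (gi *m (X *m g)) = \tr X.
Proof. by rewrite mxtrace_mulC -mulmxA ggi mulmx1. Qed.

(** The contraction is the trace of X times the adjoint of Y, and a self-adjoint [Y] is its own
    adjoint. Norms of tensors thereby become traces in which the metric no longer occurs. *)
Lemma contract_inner (X Y : 'M[K]_m) : (Y *m g)^T = Y *m g ->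
  \sum_i \sum_j gi i j * (X *m g *m Y^T) i j = \tr (X *m Y).
Proof.
move=> Ys; rewrite sum_mul_tr -mulmxA sym_trmx // trmx_mul Ys -mxtrace_tr.
rewrite trmx_mul trmx_mul Ys trmxK giT mulmxA.
by rewrite -!mulmxA ggi mulmx1.
Qed.

Lemma contract_lower (V : 'I_m -> 'rV[K]_m) (Y : 'M[K]_m) : (Y *m g)^T = Y *m g ->
  \sum_i \sum_j gi i j * (V i *m g *m Y^T) 0 j = \sum_i (V i *m Y) 0 i.
Proof.
move=> Ys; apply: eq_bigr => i _; rewrite -mulmxA sym_trmx // mulmxA.
rewrite -[in RHS](mulmx1 (_ *m Y)) -ggi mulmxA [in RHS]mxE.
by apply: eq_bigr => j _; rewrite mulrC giC.
Qed.

(** This and the next three lemmas pull constants out of the operators; they serve to pass from t to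
    f = t / m and from [stress2] to the stress-energy tensor itself. *)
Lemma lapl_exp_cst u v k : (forall i, D i u = 0) ->
  lapl ((u * v) ^+ k) = u ^+ k * lapl (v ^+ k).
Proof.
move=> u0; rewrite exprMn lapl_cst // => i; elim: k => [|k IH].
  by rewrite expr0 der1.
by rewrite exprS derM u0 IH mulr0 mul0r addr0.
Qed.

Lemma lapl_normsq_cst a (X : 'M[K]_m) : (forall i, D i a = 0) ->
  lapl (\tr ((a *: X) *m (a *: X))) = a * a * lapl (\tr (X *m X)).
Proof.
move=> a0; rewrite mulmxZl mulmxZr scalerA mxtraceZ lapl_cst // => i.
by rewrite derM a0 mulr0 mul0r addr0.
Qed.

Lemma divg_gradr_cst u v (X : 'M[K]_m) : (forall i, D i u = 0) ->
  divg ((u * v) *: (gradr (u * v) *m X)) = u ^+ 2 * divg (v *: (gradr v *m X)).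
Proof.
move=> u0; rewrite gradr_cst // mulmxZl scalerA mulrAC -expr2 -scalerA divgZcst //.
by move=> i; rewrite expr2 derM u0 mulr0 mul0r addr0.
Qed.

Lemma contract_covend_cst a (X : 'M[K]_m) : (forall i, D i a = 0) ->
  \sum_i \sum_j gi i j * \tr (covend D Gam i (a *: X) *m covend D Gam j (a *: X)) =
  a * a * \sum_i \sum_j gi i j * \tr (covend D Gam i X *m covend D Gam j X).
Proof.
move=> a0; rewrite mulr_sumr; apply: eq_bigr => i _; rewrite mulr_sumr.
apply: eq_bigr => j _; rewrite !covendZ !a0 !scale0r !add0r mulmxZl mulmxZr.
by rewrite !mxtraceZ; ring.
Qed.

(** * Self-adjoint Codazzi tensors satisfying the Gauss equation: Ricci, Simons, and the core
    identity *)

Section CodazziTensor.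
Variables (A : 'M[K]_m) (c : K).
Hypothesis A_sym : (A *m g)^T = A *m g.
Let t := \tr A.
Let nA i := covend D Gam i A.
Hypothesis codazzi : forall i j, row j (nA i) = row i (nA j).
(** Row k is R(e_i, e_j) e_k: the first bracket encodes <e_j, e_k> e_i - <e_i, e_k> e_j, the second
    the same with A e_i, A e_j and the form <A ., .>. *)
Hypothesis gauss : forall i j, curvmx D Gam i j =
  c *: (col j g *m row i 1%:M - col i g *m row j 1%:M)
  + (col j (A *m g) *m row i A - col i (A *m g) *m row j A).

(** Equal to <nabla V, A> because [A] is self-adjoint; see [contract_lower]. *)
Definition inner_cov (V : 'rV[K]_m) : K := \sum_i (cov D Gam i V *m A) 0 i.

(** Leibniz leaves a contraction of nabla A; Codazzi moves the contracted index so that it becomes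
    tr(nabla_a A) = D_a t. In short, div A = grad t. *)
Lemma divg_mul V : divg (V *m A) = inner_cov V + innr (gradr t) V.
Proof.
rewrite innr_grad /divg /inner_cov.
under eq_bigr => i _ do rewrite covMend mxE.
rewrite big_split /=; congr (_ + _).
under eq_bigr => i _ do rewrite mxE.
rewrite exchange_big /=; apply: eq_bigr => a _.
rewrite /t (covend_trace D Gam) mulr_suml; apply: eq_bigr => i _.
have /rowP/(_ i) := codazzi i a; rewrite !mxE => ->.
by rewrite mulrC.
Qed.

Lemma contract_nA : \sum_i \sum_j gi i j *: row j (nA i) = gradr t.
Proof.
rewrite (contract_codazzi _ codazzi); last by move=> i; apply: covend_sym.
by rewrite /gradr; congr (_ *m _); apply/rowP => l; rewrite !mxE (covend_trace D Gam).
Qed.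

Definition ricmx : 'M[K]_m :=
  \matrix_(i, l) (\sum_j \sum_k gi j k *: row k (curvmx D Gam i j)) 0 l.

Lemma ricmxE : ricmx = (c * (m%:R - 1))%:M + t *: A - A *m A.
Proof.
(* Both parts of the Gauss equation have this form with a symmetric Y: (Y, Z) is (g, 1) or (A g,
   A). *)
have outer (Y Z : 'M[K]_m) i l : Y^T = Y ->
    (\sum_j \sum_k gi j k *: row k (col j Y *m row i Z - col i Y *m row j Z)) 0 l =
    \tr (gi *m Y) * Z i l - (Y *m gi *m Z) i l.
  move=> YT.
  have yc a b : Y a b = Y b a by rewrite -{1}YT mxE.
  rewrite -sum_gi_mul mulr_suml summxE -mulmxA mxE.
  under [X in _ - X]eq_bigr => k _ do rewrite mxE mulr_sumr.
  rewrite [X in _ - X]exchange_big /= -sumrB; apply: eq_bigr => j _.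
  rewrite summxE mulr_suml -sumrB; apply: eq_bigr => k _.
  rewrite !mxE !big_ord1 !mxE (yc i k) (giC k j); ring.
apply/matrixP => i l; rewrite mxE.
under eq_bigr => j _ do under eq_bigr => k _ do
  rewrite gauss rowD linearZ /= scalerDr !scalerA (mulrC _ c) -scalerA.
under eq_bigr => j _ do rewrite big_split /= -scaler_sumr.
rewrite big_split /= -scaler_sumr addmxE scalemxE !outer //.
rewrite -[g]mul1mx trace_conj mul1mx ggi mulmx1 trace_conj mxtrace1.
by rewrite -(mulmxA A g) ggi mulmx1 !mxE -mulr_natr; ring.
Qed.

(** The second covariant derivative of A in the directions e_i, e_j: the sum removes the derivative
    along nabla_{e_i} e_j, which need not vanish in a coordinate frame. *)
Let n2 i j := covend D Gam i (nA j) - \sum_k Gam i j k *: nA k.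

Lemma n2_sym i j : (n2 i j *m g)^T = n2 i j *m g.
Proof.
rewrite /n2 mulmxBl mulmx_suml trmxD trmxN covend_sym; last exact: covend_sym.
congr (_ - _); rewrite trmx_sum; apply: eq_bigr => k _.
by rewrite mulmxZl /= trmxZ covend_sym.
Qed.

(** Covariant differentiation of the Codazzi equation. In the form [E] the first two summands are
    symmetric in j', k' by [codazzi], and the two Christoffel sums are exchanged. *)
Lemma n2_codazzi i j k : row k (n2 i j) = row j (n2 i k).
Proof.
have E j' k' : row k' (n2 i j') = dmx D i (row k' (nA j')) + row k' (nA j') *m Gam i
   - row j' (\sum_l Gam i k' l *: nA l) - row k' (\sum_l Gam i j' l *: nA l).
  rewrite /n2 rowD rowN; congr (_ - _).
  rewrite -[covend D Gam i (nA j')]/(dmx D i (nA j') + nA j' *m Gam i - Gam i *m nA j').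
  rewrite 2!rowD rowN -dmx_row !rowM; congr (_ - _).
  rewrite mulmx_sum_row row_sum; apply: eq_bigr => l _.
  by rewrite linearZ /= mxE codazzi.
by rewrite !E (codazzi j k) addrAC.
Qed.

(** The Ricci identity: symmetry of the Christoffel symbols makes the two correction sums equal, so
    only the commutator [covendC] remains. *)
Lemma n2_comm i j : n2 i j = n2 j i + (A *m curvmx D Gam i j - curvmx D Gam i j *m A).
Proof.
rewrite -(covendC D Gam i j A) /n2.
have -> : \sum_k Gam i j k *: nA k = \sum_k Gam j i k *: nA k.
  apply: eq_bigr => k _; congr (_ *: _).
  by have /rowP/(_ k) := tor j i; rewrite !mxE.
by rewrite /nA; mxlin.
Qed.

Lemma trace_n2 i j : \tr (n2 i j) = hessr i j t.
Proof.
rewrite raddfB /= /nA -!(covend_trace D Gam); congr (_ - _).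
by rewrite raddf_sum; apply: eq_bigr => k _; rewrite /= mxtraceZ -(covend_trace D Gam).
Qed.

(** Apart from the outer direction k, the three indices of the second derivative are totally
    symmetric, so [contract_codazzi] applies and leaves the Hessian of t. *)
Lemma contract_n2 k : \sum_i \sum_j gi i j *: row j (n2 k i) = cov D Gam k (gradr t).
Proof.
rewrite (contract_codazzi (n2_sym k)) => [|i j]; last exact: n2_codazzi.
rewrite -[RHS]mulmx1 -ggi mulmxA cov_grad_lower; congr (_ *m _).
by apply/rowP => l; rewrite !mxE trace_n2.
Qed.

(* The Codazzi equation exchanges the indices of the second derivative of A;
   commuting the derivatives then gives curvature terms, which the Gauss equation
   turns into traces of powers of A. *)
Lemma simons :
  \sum_i \sum_j gi i j * \tr (A *m n2 i j) =
  inner_cov (gradr t) + c * m%:R * \tr (A *m A) - c * t ^+ 2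
  + t * \tr (A *m A *m A) - \tr (A *m A) ^+ 2.
Proof.
have gA := sym_trmx A_sym.
have step i j : \tr (A *m n2 i j) = \sum_k (n2 k i *m A) j k +
    \sum_k ((A *m curvmx D Gam i k - curvmx D Gam i k *m A) *m A) j k.
  rewrite mxtrace_mulC -big_split /=; apply: eq_bigr => k _.
  rewrite -addmxE -mulmxDl -n2_comm.
  have /rowP/(_ k) : row k (n2 i j *m A) = row j (n2 i k *m A).
    by rewrite !rowM n2_codazzi.
  by rewrite !mxE.
under eq_bigr => i _ do under eq_bigr => j _ do rewrite step mulrDr.
under eq_bigr => i _ do rewrite big_split /=.
rewrite big_split /= -!addrA; congr (_ + _).
  under eq_bigr => i _ do under eq_bigr => j _ do rewrite mulr_sumr.
  under eq_bigr => i _ do rewrite exchange_big /=.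
  rewrite exchange_big /=; apply: eq_bigr => k _.
  rewrite -contract_n2 mulmx_suml summxE; apply: eq_bigr => i _.
  rewrite mulmx_suml summxE; apply: eq_bigr => j _.
  by rewrite mulmxZl scalemxE -rowM [row _ _ _ _]mxE.
have curvE i j k : ((A *m curvmx D Gam i k - curvmx D Gam i k *m A) *m A) j k =
   c * ((A *m g) j k * A i k) - c * ((A *m g) j i * A k k)
   + (A *m (A *m g)) j k * (A *m A) i k - (A *m (A *m g)) j i * (A *m A) k k
   - c * (g j k * (A *m A) i k) + c * (g j i * (A *m A) k k)
   - (A *m g) j k * (A *m A *m A) i k + (A *m g) j i * (A *m A *m A) k k.
  rewrite gauss !(mulmxDl, mulmxDr, mulNmx, mulmxN, mulmxZl, mulmxZr).
  rewrite !(addmxE, oppmxE, scalemxE) !mul_outerE.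
  rewrite -[_ *m A *m A]mulmxA -[col i g *m _ *m A *m A]mulmxA.
  rewrite -[col k (A *m g) *m _ *m A *m A]mulmxA -[col i (A *m g) *m _ *m A *m A]mulmxA.
  have o0 (Y Z W : 'M[K]_m) a b p q : (col p Y *m row q Z *m W) a b = Y a p * (Z *m W) q b.
    by rewrite -[col p Y]mul1mx -[1%:M *m _ *m _]mulmxA mul_outerE mul1mx.
  by rewrite !o0 !mul1mx !mulmxA; ring.
under eq_bigr => i _ do under eq_bigr => j _ do under eq_bigr => k _ do rewrite curvE.
have lin9 (f1 f2 f3 f4 f5 f6 f7 f8 : 'I_m -> 'I_m -> 'I_m -> K) :
  \sum_i \sum_j gi i j * \sum_k (c * f1 i j k - c * f2 i j k + f3 i j k - f4 i j k
    - c * f5 i j k + c * f6 i j k - f7 i j k + f8 i j k) =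
  let S f := \sum_i \sum_j gi i j * \sum_k (f i j k) in
  c * S f1 - c * S f2 + S f3 - S f4 - c * S f5 + c * S f6 - S f7 + S f8.
  rewrite /= !mulr_sumr -!(big_split, sumrB) /=; apply: eq_bigr => i _.
  rewrite !mulr_sumr -!(big_split, sumrB) /=; apply: eq_bigr => j _.
  rewrite !mulr_sumr -!(big_split, sumrB) /=.
  by apply: eq_bigr => k _; ring.
(* Of the eight contractions, the two equal to c tr(A^2) cancel, and so do the two equal to
   tr(A^4). *)
rewrite lin9 /= !contract_outer !contract_tensor.
have gAA X : g *m (A^T *m X) = A *m (g *m X) by rewrite mulmxA gA mulmxA.
rewrite !trmx_mul -!mulmxA !(gAA, gA) gig mxtrace1.
rewrite !(mulmxA A) !trace_conj -/t.
ring.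
Qed.

(** Hess tr(A^2) is twice tr(nabla_i A nabla_j A) + tr(A nabla^2_ij A). After contraction [simons]
    gives the second term; the sign comes from Delta = -div grad. *)
Lemma lapl_normsq :
  lapl (\tr (A *m A)) = - 2 * (\sum_i \sum_j gi i j * \tr (nA i *m nA j)
  + inner_cov (gradr t) + c * m%:R * \tr (A *m A) - c * t ^+ 2
  + t * \tr (A *m A *m A) - \tr (A *m A) ^+ 2).
Proof.
have hE i j : hessr i j (\tr (A *m A)) = 2 * (\tr (nA i *m nA j) + \tr (A *m n2 i j)).
  have d1 k : D k (\tr (A *m A)) = 2 * \tr (A *m nA k).
    rewrite (covend_trace D Gam) covendM mxtraceD mxtrace_mulC -/(nA k); ring.
  have trn2 : \tr (A *m n2 i j) =
      \tr (A *m covend D Gam i (nA j)) - \sum_k Gam i j k * \tr (A *m nA k).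
    rewrite /n2 [A *m _]mulmxBr [LHS]raddfB /=; congr (_ - _).
    rewrite mulmx_sumr raddf_sum /=; apply: eq_bigr => k _.
    by rewrite mulmxZr mxtraceZ.
  rewrite /hessr d1 derM (dern D i 2) mul0r add0r (covend_trace D Gam) covendM.
  rewrite mxtraceD -/(nA i) trn2 mulrDr mulrDr mulrBr -addrA; congr (_ + (_ - _)).
  by rewrite mulr_sumr; apply: eq_bigr => k _; rewrite d1; ring.
rewrite lapl_hess.
under eq_bigr => i _ do under eq_bigr => j _ do rewrite hE mulrCA mulrDr.
under eq_bigr => i _ do rewrite -mulr_sumr big_split /=.
rewrite -mulr_sumr big_split /= simons; ring.
Qed.

Hypothesis dc : forall i, D i c = 0.

Definition tanbit : 'rV[K]_m := (-2) *: (gradr t *m A) - t *: gradr t.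

(* Twice the stress-energy tensor: this avoids dividing by 2 in K. *)
Definition stress2 : 'M[K]_m := (- t ^+ 2)%:M + (4 * t) *: A.

Lemma stress2_sym : (stress2 *m g)^T = stress2 *m g.
Proof.
by rewrite /stress2 mulmxDl mul_scalar_mx mulmxZl trmxD !trmxZ gT A_sym.
Qed.

Lemma grad_tr_mul u v : innr (gradr u *m A) v = innr (gradr u) (v *m A).
Proof.
by rewrite /innr trmx_mul -!mulmxA (mulmxA g) sym_trmx // !mulmxA.
Qed.

(** nabla_i(2 S_2) = -2t D_i t I + 4 D_i t A + 4t nabla_i A; the mixed traces are known from
    tr(nabla_i A) = D_i t and 2 tr(A nabla_i A) = D_i |A|^2. *)
Lemma contract_stress2 :
  \sum_i \sum_j gi i j *
    \tr (covend D Gam i stress2 *m covend D Gam j stress2) =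
  (4 * m%:R - 32) * t ^+ 2 * innr (gradr t) (gradr t)
  + 16 * \tr (A *m A) * innr (gradr t) (gradr t)
  + 16 * t ^+ 2 * \sum_i \sum_j gi i j * \tr (nA i *m nA j)
  + 16 * t * innr (gradr t) (gradr (\tr (A *m A))).
Proof.
have dA k : D k (\tr (A *m A)) = 2 * \tr (A *m nA k).
  rewrite (covend_trace D Gam) covendM mxtraceD mxtrace_mulC -/(nA k); ring.
have ceE i : covend D Gam i stress2 = (-2 * t * D i t)%:M + (4 * D i t) *: A
    + (4 * t) *: nA i.
  rewrite /stress2 covendD covend_scalar covendZ -/(nA i) addrA.
  congr (_%:M + _ *: _ + _); first by rewrite raddfN expr2 derM; ring.
  by rewrite derM (dern D i 4); ring.
have trE i j : \tr (covend D Gam i stress2 *m covend D Gam j stress2) =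
   (4 * m%:R * t ^+ 2 - 16 * t ^+ 2 + 16 * \tr (A *m A)) * (D i t * D j t)
   - 16 * t ^+ 2 * (D i t * D j t)
   + 16 * t ^+ 2 * \tr (nA i *m nA j) + 8 * t * (D i t * D j (\tr (A *m A)))
   + 8 * t * (D j t * D i (\tr (A *m A))).
  have trnA k : \tr (nA k) = D k t by rewrite -(covend_trace D Gam).
  rewrite !ceE !dA -!trnA; move: (nA i) (nA j) => X Y.
  rewrite !(mulmxDl, mulmxDr, mul_scalar_mx, mul_mx_scalar, mulmxZl, mulmxZr).
  rewrite !(mxtraceD, mxtraceZ) mxtrace_scalar -/t.
  rewrite (mxtrace_mulC X A) -[_ *+ m]mulr_natr.
  by ring.
under eq_bigr => i _ do under eq_bigr => j _ do rewrite trE.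
(* Before contraction the two mixed terms differ by exchanging i and j, so the coefficient 16 is
   split into equal halves to match them. *)
have -> : 16 * t * innr (gradr t) (gradr (\tr (A *m A))) =
    8 * t * innr (gradr t) (gradr (\tr (A *m A)))
    + 8 * t * innr (gradr (\tr (A *m A))) (gradr t).
  by rewrite (innrC (gradr (\tr _))); ring.
rewrite addrA !innr_grad2 !mulr_sumr -!big_split /=; apply: eq_bigr => i _.
by rewrite !mulr_sumr -!big_split /=; apply: eq_bigr => j _; ring.
Qed.

(** Eight times the claim: the left side is 4 Delta|S_2|^2, the contraction is 4 |nabla S_2|^2, and
    t = mf absorbs the powers of m. Everything is rewritten in the scalars posed at the start of the
    proof, where [ring] decides it. *)
Theorem lapl_stress2 (T := tanbit) (S := stress2)
    (n := innr (gradr t) (gradr t)) (A2 := \tr (A *m A)) :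
  lapl (\tr (S *m S)) =
  - 2 * (\sum_i \sum_j gi i j * \tr (covend D Gam i S *m covend D Gam j S))
  + 8 * (4 * c * t ^+ 4 - 4 * t ^+ 3 * \tr (A *m A *m A)
    - 4 * t ^+ 2 * A2 * (c * m%:R - A2) + (m%:R - 16) * t ^+ 2 * n
    + 4 * A2 * n + 2 * A2 * lapl (t ^+ 2)
    + 4 * t * innr (gradr (\tr ricmx)) (gradr t)
    - 8 * divg (t *: (gradr t *m ricmx))
    - 4 * c * (m%:R - 1) * lapl (t ^+ 2)
    - 10 * t * innr T (gradr t) - 4 * t ^+ 2 * divg T - 2 * innr T T
    + 4 * t * inner_cov T)
  + m%:R * lapl (t ^+ 4).
Proof.
pose a := innr (gradr t *m A) (gradr t).
pose a2 := innr (gradr t *m A) (gradr t *m A).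
pose hA := inner_cov (gradr t).
pose p := innr (gradr t) (gradr A2).
pose l := lapl t.
(* div(A^2 grad t) stays an unknown: it enters through the Ricci term and through <nabla T, A>, and
   the two contributions cancel. Those of [a2] in the Ricci term and in |T|^2 cancel likewise. *)
pose d2 := divg (gradr t *m A *m A).
pose NA := \sum_i \sum_j gi i j * \tr (nA i *m nA j).
have c1 i : D i (-1) = 0 by rewrite raddfN /= der1 oppr0.
have c2 i : D i (-2) = 0 by rewrite raddfN /= dern oppr0.
have cm i : D i (c * (m%:R - 1)) = 0.
  by rewrite derM dc mul0r raddfB /= dern der1 subrr mulr0 addr0.
have d1E : divg (gradr t *m A) = hA + n by rewrite divg_mul.
have gE : innr (gradr t) (gradr t *m A) = a by rewrite innrC.
have g2E : innr (gradr t) (gradr t *m A *m A) = a2.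
  by rewrite -grad_tr_mul.
have lE : divg (gradr t) = - l by rewrite /l /lapl opprK.
have TgE : innr T (gradr t) = - 2 * a - t * n.
  by rewrite /T /tanbit innrDl -scaleNr !innrZl -/a -/n; ring.
have TTE : innr T T = 4 * a2 + 4 * t * a + t ^+ 2 * n.
  rewrite {2}/T /tanbit innrDr -scaleNr !innrZr TgE /T /tanbit innrDl -scaleNr.
  by rewrite !innrZl gE -/a2; ring.
have dTE : divg T = - 2 * (hA + n) - n + t * l.
  rewrite /T /tanbit divgD -[- (t *: _)]scaleN1r.
  rewrite (divgZcst _ c2) (divgZcst _ c1) ?divgZ.
  by rewrite d1E lE -/n; ring.
have iTE : inner_cov T = - 2 * d2 - (a + t * (hA + n)) + 2 * a + t * n.
  (* [divg_mul] read backwards, so that the derivative of T is never expanded inside [inner_cov]. *)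
  have -> : inner_cov T = divg (T *m A) - innr T (gradr t).
    by rewrite divg_mul (innrC (gradr t)) addrK.
  rewrite TgE /T /tanbit mulmxBl !mulmxZl divgD -[- (t *: _)]scaleN1r.
  rewrite (divgZcst _ c2) (divgZcst _ c1) ?divgZ.
  by rewrite -/d2 d1E gE; ring.
have ricE : divg (t *: (gradr t *m ricmx)) =
    c * (m%:R - 1) * (n - t * l) + (2 * t * a + t ^+ 2 * (hA + n)) - (a2 + t * d2).
  have -> : t *: (gradr t *m ricmx) = (c * (m%:R - 1)) *: (t *: gradr t)
      + t *: (t *: (gradr t *m A)) + (-1) *: (t *: (gradr t *m A *m A)).
    by rewrite ricmxE; mxexpand; rewrite mul_mx_scalar; mxlin.
  rewrite !divgD (divgZcst _ cm) (divgZcst _ c1) ?divgZ.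
  by rewrite innrZr lE gE g2E -/n -/d2 d1E; ring.
have l2E : lapl (t ^+ 2) = 2 * t * l - 2 * n.
  by rewrite expr2 laplM -/l -/n; ring.
have g2 : gradr (t ^+ 2) = (2 * t) *: gradr t.
  by rewrite expr2 gradrM -scalerDl; congr (_ *: _); ring.
have l4E : lapl (t ^+ 4) = 4 * t ^+ 3 * l - 12 * t ^+ 2 * n.
  have -> : t ^+ 4 = t ^+ 2 * t ^+ 2 by ring.
  by rewrite laplM l2E g2 innrZl innrZr -/n; ring.
have sE : innr (gradr (\tr ricmx)) (gradr t) = 2 * t * n - p.
  have -> : \tr ricmx = c * (m%:R - 1) * m%:R + (t ^+ 2 + (-1) * A2).
    rewrite ricmxE raddfB raddfD /= mxtraceZ mxtrace_scalar -/t -/A2 -[_ *+ m]mulr_natr.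
    by ring.
  rewrite gradrD gradr0 => [|i]; last first.
    by rewrite derM cm dern; ring.
  rewrite add0r gradrD (gradr_cst _ c1).
  by rewrite innrDl g2 !innrZl -/n (innrC (gradr A2)) -/p; ring.
have NSE := contract_stress2.
have SSE : \tr (S *m S) = (m%:R - 8) * t ^+ 4 + 16 * (t ^+ 2 * A2).
  rewrite /S /stress2 !(mulmxDl, mulmxDr, mul_scalar_mx, mul_mx_scalar, mulmxZl, mulmxZr).
  rewrite !(mxtraceD, mxtraceZ) mxtrace_scalar -/t -/A2 -[_ *+ m]mulr_natr; ring.
have LE : lapl (\tr (S *m S)) = (m%:R - 8) * lapl (t ^+ 4)
    + 16 * (t ^+ 2 * lapl A2 + A2 * lapl (t ^+ 2) - 4 * t * p).
  rewrite SSE laplD (lapl_cst _ (fun i => dern D i 16)) (lapl_cst (u := m%:R - 8)).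
    by rewrite laplM g2 innrZl -/p; ring.
  by move=> i; rewrite raddfB /= !dern subrr.
rewrite LE NSE ricE l4E l2E sE TgE dTE TTE iTE lapl_normsq -/A2 -/n -/p -/NA -/hA.
ring.
Qed.

End CodazziTensor.
End Riemannian.

(** * The Levi-Civita connection from Koszul's formula *)

Section Koszul.
Variables (K : comNzRingType) (m : nat) (D : derivations K m) (hf : K).
Variables (g gi : 'M[K]_m).
Hypotheses (hf2 : hf + hf = 1) (ggi : g *m gi = 1%:M) (gT : g^T = g).

Definition koszul_lower i : 'M[K]_m :=
  \matrix_(j, l) (hf * (D i (g j l) + D j (g i l) - D l (g i j))).

Definition koszul i : 'M[K]_m := koszul_lower i *m gi.

Let gC a b : g a b = g b a. Proof. by rewrite -{1}gT mxE. Qed.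

(** In [koszul_lower i] plus its transpose the two skew derivative terms cancel, and D_i g appears
    twice with coefficient [hf]. *)
Lemma koszul_metric : metric_connection D koszul g.
Proof.
move=> i; have Kg : koszul i *m g = koszul_lower i.
  by rewrite /koszul -mulmxA (gig ggi) mulmx1.
rewrite -{3}gT -trmx_mul Kg; apply/matrixP => j l; rewrite !mxE.
rewrite (gC l j) -mulrDr addrACA [X in hf * (X + _)]addrACA.
by rewrite -[LHS]mul1r -hf2; ring.
Qed.

Lemma koszul_torsion i j : row i (koszul j) = row j (koszul i).
Proof.
rewrite /koszul !rowM; congr (_ *m _); apply/rowP => l; rewrite !mxE.
by rewrite (gC j i); ring.
Qed.

End Koszul.

(** * The ambient connection pulled back along the map *)

Section PullbackConnection.
Variables (K K' : comNzRingType) (m n : nat).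
Variables (D : derivations K m) (D' : derivations K' n).
Variables (pb : {rmorphism K' -> K}) (J : 'M[K]_(m, n)).
Hypothesis chain : forall i k, D i (pb k) = \sum_a J i a * pb (D' a k).
Hypothesis J_closed : forall i j a, D i (J j a) = D j (J i a).
Variables (Gam' : 'I_n -> 'M[K']_n) (H' : 'M[K']_n).

Definition pullback_connection i : 'M[K]_n :=
  \sum_a J i a *: map_mx pb (Gam' a).
Local Notation The := pullback_connection.

Lemma dmx_pullback p q i (X : 'M[K']_(p, q)) :
  dmx D i (map_mx pb X) = \sum_a J i a *: map_mx pb (dmx D' a X).
Proof.
apply/matrixP => k l; rewrite !mxE chain summxE.
by apply: eq_bigr => a _; rewrite !mxE.
Qed.

Lemma pullback_metric : metric_connection D' Gam' H' ->
  metric_connection D The (map_mx pb H').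
Proof.
move=> met i; rewrite dmx_pullback /The mulmx_suml trmx_sum mulmx_sumr -big_split /=.
apply: eq_bigr => a _; rewrite met map_mxD !map_mxM trmxZ mulmxZl mulmxZr -scalerDr.
by rewrite map_trmx.
Qed.

(** The derivative part is symmetric by closedness of [J], the Christoffel part by symmetry of the
    ambient symbols. This is the source of the symmetry of the second fundamental form. *)
Lemma pullback_torsion : (forall a b, row a (Gam' b) = row b (Gam' a)) ->
  forall i j, row i (cov D The j J) = row j (cov D The i J).
Proof.
move=> tor i j; rewrite /cov !rowD !rowM /The; congr (_ + _).
  by apply/rowP => a; rewrite !mxE J_closed.
rewrite !mulmx_sumr; under [RHS]eq_bigr => b _ do
  rewrite mulmxZr mulmx_sum_row scaler_sumr.
under [LHS]eq_bigr => b _ do rewrite mulmxZr mulmx_sum_row scaler_sumr.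
rewrite exchange_big /=; apply: eq_bigr => b _; apply: eq_bigr => a _.
by rewrite !scalerA !mxE mulrC -!map_row tor.
Qed.

(** Leibniz produces terms in D_i (J j a) besides the tensorial ones; they are symmetric in i, j by
    closedness and drop out of the curvature. *)
Lemma pullback_curvature i j : curvmx D The i j =
  \sum_a \sum_b (J i a * J j b) *: map_mx pb (curvmx D' Gam' a b).
Proof.
have dT k l : dmx D k (The l) = \sum_a D k (J l a) *: map_mx pb (Gam' a) +
    \sum_a \sum_b (J k a * J l b) *: map_mx pb (dmx D' a (Gam' b)).
  rewrite /The [dmx _ _ _]raddf_sum /=.
  under eq_bigr => a _ do rewrite -/(dmx D k _) dmxZ dmx_pullback scaler_sumr.
  rewrite big_split /=; congr (_ + _); rewrite exchange_big /=.
  by apply: eq_bigr => a _; apply: eq_bigr => b _; rewrite scalerA mulrC.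
have TT k l : The k *m The l =
    \sum_a \sum_b (J l a * J k b) *: map_mx pb (Gam' b *m Gam' a).
  rewrite /The mulmx_sumr; apply: eq_bigr => a _; rewrite mulmx_suml.
  by apply: eq_bigr => b _; rewrite mulmxZl mulmxZr map_mxM scalerA mulrC.
(* The same product with its summation indices named the other way, so that both quadratic terms of
   the curvature carry the coefficient J i a * J j b. *)
have TT' k l : The k *m The l =
    \sum_a \sum_b (J k a * J l b) *: map_mx pb (Gam' a *m Gam' b).
  rewrite TT exchange_big /=; apply: eq_bigr => a _; apply: eq_bigr => b _.
  by rewrite mulrC.
have dT' k l : dmx D k (The l) = \sum_a D k (J l a) *: map_mx pb (Gam' a) +
    \sum_a \sum_b (J l a * J k b) *: map_mx pb (dmx D' b (Gam' a)).
  rewrite dT exchange_big /=; congr (_ + _).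
  by apply: eq_bigr => a _; apply: eq_bigr => b _; rewrite mulrC.
rewrite /curvmx dT (dT' j i) TT (TT' i j).
under [X in _ - (X + _)]eq_bigr => a _ do rewrite J_closed.
rewrite opprD addrACA subrr add0r -sumrB -big_split -sumrB /=.
apply: eq_bigr => a _; rewrite -sumrB -big_split -sumrB /=.
by apply: eq_bigr => b _; rewrite map_mxB map_mxD map_mxB !scalerDr !scalerN.
Qed.

(** The factor [J] on the left restricts to tangent vectors, whose pairings are the entries of g = J
    H J^T. The result is again a multiple of [J]: the absence of a normal part is why the Codazzi
    equation has no curvature term. *)
Lemma pullback_constant_curvature (c : K') :
  (forall a b, curvmx D' Gam' a b =
     c *: (col b H' *m row a 1%:M - col a H' *m row b 1%:M)) ->
  forall g, J *m map_mx pb H' *m J^T = g ->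
  forall i j, J *m curvmx D The i j =
    pb c *: (col j g *m row i 1%:M - col i g *m row j 1%:M) *m J.
Proof.
move=> cc g gE i j; set Hp := map_mx pb H' in gE *.
have outer k l : \sum_a \sum_b (J k a * J l b) *: (col b Hp *m row a 1%:M) =
    Hp *m (row l J)^T *m row k J.
  have colsum : Hp *m (row l J)^T = \sum_b J l b *: col b Hp.
    apply: trmx_inj; rewrite trmx_mul trmxK trmx_sum mulmx_sum_row.
    by apply: eq_bigr => b _; rewrite mxE trmxZ tr_col.
  rewrite colsum mulmx_suml exchange_big /=; apply: eq_bigr => b _.
  rewrite -[in RHS](mulmx1 (row k J)) [row k J *m _]mulmx_sum_row mulmx_sumr.
  apply: eq_bigr => a _; rewrite mulmxZl mulmxZr scalerA mulrC.
  by rewrite mxE.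
have outerg k l : J *m (Hp *m (row l J)^T *m row k J) =
    col l g *m row k 1%:M *m J.
  rewrite -(mulmxA (col l g)) -rowM mul1mx mulmxA; congr (_ *m _).
  by rewrite -gE mulmxA tr_row colE colE !mulmxA.
rewrite pullback_curvature.
under eq_bigr => a _ do under eq_bigr => b _ do
  rewrite cc map_mxZ map_mxB !map_mxM !map_col !map_row map_mx1 -/Hp
    scalerA mulrC -scalerA scalerBr.
under eq_bigr => a _ do rewrite -scaler_sumr sumrB.
rewrite -scaler_sumr sumrB outer.
under [X in _ - X]eq_bigr => a _ do under eq_bigr => b _ do rewrite mulrC.
rewrite [X in _ - X]exchange_big /= outer mulmxZr mulmxBr !outerg.
by rewrite mulmxZl mulmxBl.
Qed.

End PullbackConnection.

(** * Hypersurfaces: Gauss, Weingarten and Codazzi equations, tension and bitension *)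

Section Hypersurface.
Variables (K : comNzRingType) (m : nat) (D : derivations K m).
Hypothesis two_reg : forall a : K, a + a = 0 -> a = 0.
Variables (g gi : 'M[K]_m) (Gam : 'I_m -> 'M[K]_m).
Hypotheses (ggi : g *m gi = 1%:M) (gT : g^T = g).
Hypothesis met : metric_connection D Gam g.
Hypothesis tor : forall i j, row i (Gam j) = row j (Gam i).
(* The rows of J are the images of the coordinate fields, H is the ambient metric
   and The the ambient connection along the map. *)
Variables (H : 'M[K]_m.+1) (The : 'I_m -> 'M[K]_m.+1).
Variables (J : 'M[K]_(m, m.+1)) (eta : 'rV[K]_m.+1) (c : K).
Hypothesis HT : H^T = H.
Hypothesis metN : metric_connection D The H.
Hypothesis gJ : J *m H *m J^T = g.
Hypotheses (eta1 : eta *m H *m eta^T = 1%:M) (etaJ : eta *m H *m J^T = 0).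
Hypothesis torN : forall i j, row i (cov D The j J) = row j (cov D The i J).
Hypothesis curvN : forall i j, J *m curvmx D The i j =
  c *: (col j g *m row i 1%:M - col i g *m row j 1%:M) *m J.

(** Row j is B(e_i, e_j); [sffn] collects the pairings of these vectors with the normal. *)
Definition sff i : 'M[K]_(m, m.+1) := cov D The i J - Gam i *m J.
Definition sffn : 'M[K]_m := \matrix_(i, j) (sff i *m H *m eta^T) j 0.
Definition shape_mx : 'M[K]_m := sffn *m gi.

Lemma Jeta : J *m H *m eta^T = 0.
Proof.
by apply: trmx_inj; rewrite !trmx_mul trmxK HT mulmxA etaJ trmx0.
Qed.

Lemma two_regmx p q (X : 'M[K]_(p, q)) : X + X = 0 -> X = 0.
Proof.
by move=> /matrixP E; apply/matrixP => i j; rewrite !mxE; apply: two_reg;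
  have := E i j; rewrite !mxE.
Qed.

(** The rows of [P] are m + 1 vectors in dimension m + 1, and [B] inverts their block-diagonal Gram
    matrix. Since [P] is square, a right inverse is also a left inverse, which gives completeness of
    the frame without a rank argument. *)
Lemma frame_decomposition p (V : 'M[K]_(p, m.+1)) :
  V = V *m H *m J^T *m gi *m J + V *m H *m eta^T *m eta.
Proof.
pose P : 'M[K]_(1 + m, m.+1) := col_mx eta J.
pose B : 'M[K]_(1 + m) := block_mx 1%:M 0 0 gi.
have PHP : P *m H *m P^T *m B = 1%:M.
  rewrite /P /B tr_col_mx mul_col_mx mul_col_row eta1 etaJ Jeta gJ mulmx_block.
  by rewrite !(mul1mx, mul0mx, mulmx0, addr0, add0r) ggi -scalar_mx_block.
have : H *m P^T *m B *m P = 1%:M.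
  by apply: mulmx1C; rewrite !mulmxA.
rewrite /P /B tr_col_mx -!mulmxA mul_block_col mul_row_col !mul0mx add0r addr0 mul1mx.
move=> E; rewrite -{1}[V]mulmx1 -E mulmxDr mulmxDr addrC !mulmxA //.
Qed.

Lemma sff_torsion i j : row i (sff j) = row j (sff i).
Proof. by rewrite /sff [LHS]rowD [RHS]rowD !rowN !rowM tor torN. Qed.

(* <B(e_i, e_j), e_k> is symmetric in i, j and antisymmetric in j, k. *)
Lemma sff_tangent i : sff i *m H *m J^T = 0.
Proof.
pose C i := sff i *m H *m J^T.
have sk k : C k + (C k)^T = 0.
  have : dmx D k (J *m H *m J^T) = dmx D k g by rewrite gJ.
  rewrite (cov_inner _ _ _ metN) met => E.
  rewrite /C /sff; move: (cov D The k J) E => cJ E.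
  rewrite !(trmx_mul, trmxD, trmxN, trmxK, mulmxDl, mulmxDr, mulNmx, mulmxN) HT.
  have e1 : Gam k *m J *m H *m J^T = Gam k *m g by rewrite -gJ !mulmxA.
  have e2 : J *m (H *m (J^T *m (Gam k)^T)) = g *m (Gam k)^T by rewrite -gJ !mulmxA.
  by rewrite e1 e2 (mulmxA J H) addrACA E -opprD subrr.
have sw k a b : C k a b = C a k b.
  have : row a (C k) = row k (C a) by rewrite /C !rowM sff_torsion.
  by move/rowP/(_ b); rewrite !mxE.
have an k a b : C k a b = - C k b a.
  by apply/eqP; rewrite -addr_eq0; have /matrixP/(_ a b) := sk k; rewrite !mxE => ->.
apply/matrixP => a b; rewrite [RHS]mxE -/(C i); apply: two_reg.
(* Alternating the antisymmetry three times with the symmetry returns the indices to their places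
   with the opposite sign. *)
rewrite {1}(an i a b) (sw i b a) (an b i a) (sw b a i) (an a b i) (sw a i b).
by rewrite opprK addNr.
Qed.

Lemma sffE i : sff i = col i sffn *m eta.
Proof.
rewrite {1}[sff i]frame_decomposition sff_tangent !mul0mx add0r; congr (_ *m _).
apply/colP => j; rewrite mxE.
have : row j (sff i *m H *m eta^T) = row i (sff j *m H *m eta^T).
  by rewrite !rowM sff_torsion.
by move/rowP/(_ 0); rewrite !mxE => <-.
Qed.

Lemma sffn_sym : sffn^T = sffn.
Proof.
apply/matrixP => i j; rewrite !mxE.
have : row i (sff j *m H *m eta^T) = row j (sff i *m H *m eta^T).
  by rewrite !rowM sff_torsion.
by move/rowP/(_ 0); rewrite !mxE.
Qed.

Lemma shapeg : shape_mx *m g = sffn.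
Proof. by rewrite /shape_mx -mulmxA (gig ggi) mulmx1. Qed.

Lemma shape_sym : (shape_mx *m g)^T = shape_mx *m g.
Proof. by rewrite shapeg sffn_sym. Qed.

Lemma cov_frame i : cov D The i J = Gam i *m J + col i sffn *m eta.
Proof. by rewrite -sffE /sff addrC subrK. Qed.

(** Differentiating <eta, eta> = 1 kills the normal component, by [two_regmx]; differentiating <eta,
    J> = 0 identifies the tangential one with minus the shape operator. *)
Lemma weingarten i : cov D The i eta = - row i shape_mx *m J.
Proof.
rewrite {1}[cov _ _ _ eta]frame_decomposition.
have -> : cov D The i eta *m H *m eta^T = 0.
  have : dmx D i (eta *m H *m eta^T) = 0 by rewrite eta1 dmx1.
  rewrite (cov_inner _ _ _ metN) => E; apply: two_regmx; rewrite -[RHS]E; congr (_ + _).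
  have tr1 (X : 'M[K]_1) : X^T = X by apply/matrixP => a b; rewrite !ord1 mxE.
  by rewrite -[LHS]tr1 !trmx_mul trmxK HT mulmxA.
rewrite mul0mx addr0; congr (_ *m _).
have : dmx D i (eta *m H *m J^T) = 0 by rewrite etaJ dmx0.
rewrite (cov_inner _ _ _ metN) cov_frame trmxD !trmx_mul mulmxDr.
rewrite [eta *m H *m (J^T *m _)]mulmxA etaJ mul0mx add0r.
rewrite [eta *m H *m (eta^T *m _)]mulmxA eta1 mul1mx => /eqP.
rewrite addr_eq0 => /eqP ->; rewrite /shape_mx rowM -mulNmx; congr (- _ *m _).
by rewrite -[row i sffn]trmxK tr_row sffn_sym.
Qed.

Lemma frame_free p (X : 'M[K]_(p, m)) (Y : 'cV[K]_p) :
  X *m J + Y *m eta = 0 -> X = 0 /\ Y = 0.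
Proof.
move=> E; split.
  have := congr1 (fun V => V *m H *m J^T *m gi) E; rewrite !mul0mx !mulmxDl.
  have -> : X *m J *m H *m J^T *m gi = X.
    by rewrite -!mulmxA (mulmxA H) (mulmxA J) (mulmxA J) gJ ggi mulmx1.
  have -> : Y *m eta *m H *m J^T *m gi = 0.
    by rewrite -!mulmxA (mulmxA H) (mulmxA eta) (mulmxA eta) etaJ mul0mx mulmx0.
  by rewrite addr0.
have := congr1 (fun V => V *m H *m eta^T) E; rewrite !mul0mx !mulmxDl.
by rewrite -!mulmxA (mulmxA J) Jeta mulmx0 add0r (mulmxA eta) eta1 mulmx1.
Qed.

Let normal_curv i j : 'cV[K]_m := dmx D i (col j sffn) - Gam i *m col j sffn.

(** [nabla_i, nabla_j] J is computed in two ways: by [curvN], and by expanding twice with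
    [cov_frame] and [weingarten]. The coefficient of [J] is the Gauss equation, that of [eta] the
    Codazzi equation; [normal_curv] is the latter before antisymmetrization. *)
Lemma gauss_codazzi i j :
  (curvmx D Gam i j - (col j sffn *m row i shape_mx - col i sffn *m row j shape_mx)
   - c *: (col j g *m row i 1%:M - col i g *m row j 1%:M)) *m J
  + (normal_curv i j - normal_curv j i) *m eta = 0.
Proof.
have dd k l : cov D The k (cov D The l J) =
    dmx D k (Gam l) *m J + Gam l *m (Gam k *m J + col k sffn *m eta)
    + dmx D k (col l sffn) *m eta - col l sffn *m (row k shape_mx *m J).
  by rewrite (cov_frame l) covD !covM cov_frame weingarten mulNmx mulmxN; mxlin.
have := curvN i j; rewrite -covC !dd => E.
rewrite mulmxBl -E /curvmx /normal_curv; mxexpand; mxlin.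
Qed.

Let t := \tr shape_mx.

Lemma cov_mean_curvature i :
  cov D The i (t *: eta) = D i t *: eta - t *: (row i shape_mx *m J).
Proof. by rewrite covZ weingarten mulNmx scalerN. Qed.

Lemma frame_cov_mean_curvature i j :
  (row i J *m H *m (cov D The j (t *: eta))^T) 0 0 = - (t * (shape_mx *m g) i j).
Proof.
have e1 : row i J *m H *m eta^T = 0 by rewrite -!rowM Jeta row0.
have e2 : (row i J *m H *m (J^T *m (row j shape_mx)^T)) 0 0 = (shape_mx *m g) i j.
  rewrite mulmxA -rowM -rowM gJ mul_row_tr -rowM (sym_trmx gT shape_sym).
  by rewrite mxE.
rewrite cov_mean_curvature trmxD trmxN !trmxZ trmx_mul mulmxDr mulmxN !mulmxZr e1.
by rewrite scaler0 add0r oppmxE scalemxE e2.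
Qed.

Lemma trace_sff : \sum_i \sum_j gi i j *: row j (sff i) = t *: eta.
Proof.
under eq_bigr => i _ do under eq_bigr => j _ do
  rewrite sffE rowM [row j _]mx11_scalar !mxE mul_scalar_mx scalerA.
under eq_bigr => i _ do rewrite -scaler_suml.
rewrite -scaler_suml; congr (_ *: _).
by rewrite /t /shape_mx mxtrace_mulC; apply: eq_bigr => i _; rewrite mxE;
  apply: eq_bigr => j _; rewrite !mxE.
Qed.

Lemma gauss_equation i j : curvmx D Gam i j =
  c *: (col j g *m row i 1%:M - col i g *m row j 1%:M)
  + (col j (shape_mx *m g) *m row i shape_mx - col i (shape_mx *m g) *m row j shape_mx).
Proof.
have [/eqP + _] := frame_free (gauss_codazzi i j).
by rewrite subr_eq0 subr_eq => /eqP ->; rewrite shapeg.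
Qed.

Lemma codazzi_equation i j :
  row j (covend D Gam i shape_mx) = row i (covend D Gam j shape_mx).
Proof.
have [_ /eqP] := frame_free (gauss_codazzi i j); rewrite subr_eq0 => /eqP E.
(* With the index lowered, (nabla_k A) e_l is the normal coefficient minus a term in row l of
   [Gam k], which torsion-freeness makes symmetric in k and l. *)
suff cE k l : row l (covend D Gam k shape_mx) *m g =
    (normal_curv k l)^T - row l (Gam k) *m (shape_mx *m g).
  rewrite -[LHS]mulmx1 -[RHS]mulmx1 -ggi !mulmxA !cE E.
  by rewrite (tor j i).
rewrite -rowM (covend_lower met) shapeg /normal_curv !rowD !rowN !rowM.
rewrite trmxD trmxN trmx_mul tr_col sffn_sym -dmx_tr tr_col sffn_sym dmx_row.
by mxlin.
Qed.

Definition tangent_proj p (V : 'M[K]_(p, m.+1)) : 'M[K]_(p, m) := V *m H *m J^T *m gi.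

Lemma tangent_projD p (V W : 'M[K]_(p, m.+1)) :
  tangent_proj (V + W) = tangent_proj V + tangent_proj W.
Proof. by rewrite /tangent_proj !mulmxDl. Qed.

Lemma tangent_projZ p a (V : 'M[K]_(p, m.+1)) :
  tangent_proj (a *: V) = a *: tangent_proj V.
Proof. by rewrite /tangent_proj !mulmxZl. Qed.

Lemma tangent_projN p (V : 'M[K]_(p, m.+1)) : tangent_proj (- V) = - tangent_proj V.
Proof. by rewrite /tangent_proj !mulNmx. Qed.

Lemma tangent_proj_sum p I (r : seq I) (V : I -> 'M[K]_(p, m.+1)) :
  tangent_proj (\sum_(i <- r) V i) = \sum_(i <- r) tangent_proj (V i).
Proof. by rewrite /tangent_proj !mulmx_suml. Qed.

Lemma tangent_projJ p (X : 'M[K]_(p, m)) : tangent_proj (X *m J) = X.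
Proof.
by rewrite /tangent_proj -!mulmxA (mulmxA H) (mulmxA J) (mulmxA J) gJ ggi mulmx1.
Qed.

Lemma tangent_proj_eta p (Y : 'cV[K]_p) : tangent_proj (Y *m eta) = 0.
Proof.
by rewrite /tangent_proj -!mulmxA (mulmxA H) (mulmxA eta) (mulmxA eta) etaJ
  mul0mx mulmx0.
Qed.

Lemma tangent_proj_eta1 : tangent_proj eta = 0.
Proof. by rewrite -[eta]mul1mx tangent_proj_eta. Qed.

(** When one derivative falls on t and the other on eta, the tangent part is -A(grad t), twice in
    all. When both act on eta it is -t times the contraction of nabla A, which is grad t by
    [contract_nA]. *)
Lemma tangent_bitension :
  tangent_proj (\sum_i \sum_j gi i j *: (cov D The i (cov D The j (t *: eta))
    - \sum_k Gam i j k *: cov D The k (t *: eta))) = tanbit D gi shape_mx.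
Proof.
have E i j : tangent_proj (cov D The i (cov D The j (t *: eta))
    - \sum_k Gam i j k *: cov D The k (t *: eta)) =
    - (D j t *: row i shape_mx) - D i t *: row j shape_mx
    - t *: row j (covend D Gam i shape_mx).
  rewrite tangent_projD tangent_projN cov_mean_curvature covD covN !covZ covM.
  rewrite weingarten cov_frame tangent_proj_sum.
  under eq_bigr => k _ do rewrite cov_mean_curvature tangent_projZ tangent_projD
    tangent_projN !tangent_projZ tangent_projJ tangent_proj_eta1 scaler0 add0r.
  rewrite mulmxDr !mulmxA !tangent_projD tangent_projN !tangent_projD !tangent_projZ.
  rewrite !tangent_projD mulNmx tangent_projN !tangent_projJ tangent_proj_eta.
  rewrite tangent_proj_eta1 /covend dmx_row !rowD rowN (rowM _ shape_mx) (rowM _ (Gam i)).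
  have -> : \sum_k Gam i j k *: - (t *: row k shape_mx) = - (t *: (row j (Gam i) *m shape_mx)).
    rewrite mulmx_sum_row scaler_sumr -sumrN; apply: eq_bigr => k _.
    by rewrite mxE scalerN scalerA mulrC -scalerA.
  by mxlin.
rewrite tangent_proj_sum.
under eq_bigr => i _ do rewrite tangent_proj_sum.
under eq_bigr => i _ do under eq_bigr => j _ do
  rewrite tangent_projZ E !scalerDr !scalerN scalerA [gi i j *: (t *: _)]scalerA
    (mulrC _ t) -(scalerA t).
under eq_bigr => i _ do rewrite !sumrB sumrN -scaler_sumr.
rewrite !sumrB sumrN -scaler_sumr.
rewrite (contract_nA ggi met shape_sym codazzi_equation).
have -> : \sum_i \sum_j gi i j * D j t *: row i shape_mx = gradr D gi t *m shape_mx.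
  rewrite mulmx_sum_row; apply: eq_bigr => i _; rewrite -scaler_suml; congr (_ *: _).
  by rewrite /gradr mxE; apply: eq_bigr => j _; rewrite mxE (giC ggi gT) mulrC.
have -> : \sum_i \sum_j gi i j *: (D i t *: row j shape_mx) = gradr D gi t *m shape_mx.
  rewrite exchange_big mulmx_sum_row; apply: eq_bigr => j _ /=.
  under eq_bigr => i _ do rewrite scalerA.
  rewrite -scaler_suml; congr (_ *: _).
  by rewrite /gradr mxE; apply: eq_bigr => i _; rewrite mxE mulrC.
by rewrite /tanbit -/t; mxlin.
Qed.

End Hypersurface.

(** * Differentiability and smoothness as local notions *)

Section NearEq.
Variables (R : realType) (V W : normedModType R).

Lemma differentiable_near0 (z : V -> W) x :
  (\forall y \near x, z y = 0) -> differentiable z x.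
Proof.
move=> zn; have z0 : z x = 0 by apply: nbhs_singleton zn.
have E : z \o shift x = cst (z x) + (\0 : V -> W) +o_ 0 id.
  apply/eqaddoP => e e0; near=> h.
  rewrite !fctE /= z0 /cst addr0 subr0.
  suff -> : z (h + x) = 0 by rewrite normr0 mulr_ge0 // ltW.
  near: h; move: zn; rewrite (near_shift 0) /= => H.
  by apply: filterS H => h /=; rewrite subr0.
have d0 : 'd z x = (\0 : V -> W) :> (V -> W).
  by apply: (diff_unique (df := \0)) => //; exact: cst_continuous.
apply/diff_locallyP; rewrite d0; split => //; exact: cst_continuous.
Unshelve. all: by end_near. Qed.

(** [g] is [f] plus a function vanishing near x, whose expansion is trivial by
    [differentiable_near0]. *)
Lemma differentiable_near_eq (f g : V -> W) x :
  (\forall y \near x, f y = g y) -> differentiable f x -> differentiable g x.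
Proof.
move=> fg df; have -> : g = f + (g - f).
  by apply/funext => y; rewrite /= !fctE addrC subrK.
apply: differentiableD => //; apply: differentiable_near0.
by apply: filterS fg => y; rewrite !fctE => ->; rewrite subrr.
Qed.

Lemma near_of_open (U : set V) (P : V -> Prop) x :
  open U -> U x -> (forall y, U y -> P y) -> \forall y \near x, P y.
Proof. by move=> Uo Ux UP; apply: filterS (open_nbhs_nbhs (conj Uo Ux)). Qed.

(** Serves as a coinduction principle: smoothness is shown by exhibiting a class of differentiable
    functions that directional derivatives do not leave. *)
Lemma smooth_on_coind (U : set V) (P : (V -> W) -> Prop) :
  (forall h, P h -> forall x, U x -> differentiable h x) ->
  (forall h v, P h -> P ('D_v h)) -> forall h, P h -> smooth_on U h.
Proof.
move=> Pd PD h Ph vs x Ux; apply: Pd Ux.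
by elim: vs => //= v vs; apply: PD.
Qed.

Lemma smooth_on_differentiable (U : set V) (f : V -> W) x :
  smooth_on U f -> U x -> differentiable f x.
Proof. by move=> sf; apply: (sf [::]). Qed.

Lemma smooth_on_derive (U : set V) (f : V -> W) v :
  smooth_on U f -> smooth_on U ('D_v f).
Proof. by move=> sf vs x Ux; have := sf (rcons vs v) x Ux; rewrite foldr_rcons. Qed.

Lemma smooth_onS (U U' : set V) (f : V -> W) :
  U' `<=` U -> smooth_on U f -> smooth_on U' f.
Proof. by move=> sub sf vs x /sub; apply: sf. Qed.

End NearEq.

(** * Symmetry of second derivatives *)

Section Schwarz.
Variables (R : realType) (V : normedModType R).

Lemma derivable_line (f : V -> R) p u (a : R) : derivable f (p + a *: u) u ->
  is_derive a 1 (fun b : R => f (p + b *: u)) ('D_u f (p + a *: u)).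
Proof.
have E : (fun h : R => h^-1 *: (((fun b : R => f (p + b *: u)) \o shift a) (h *: 1)
       - f (p + a *: u))) =
    (fun h : R => h^-1 *: ((f \o shift (p + a *: u)) (h *: u) - f (p + a *: u))).
  apply/funext => h /=; congr (_ *: (f _ - _)).
  by rewrite [h *: 1]mulr1 scalerDl addrCA.
by move=> df; apply: DeriveDef; rewrite /derivable /derive E.
Qed.

(* The mean value theorem in the direction u, then in the direction v. *)
Lemma second_difference (O : set V) (f : V -> R) x u v (s : R) : 0 < s ->
  (forall y, O y -> derivable f y u) -> (forall y, O y -> derivable ('D_u f) y v) ->
  (forall a b, 0 <= a <= s -> 0 <= b <= s -> O (x + a *: u + b *: v)) ->
  exists a b, [/\ 0 <= a <= s, 0 <= b <= s &
    f (x + s *: u + s *: v) - f (x + s *: u) - f (x + s *: v) + f x =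
    s * s * 'D_v ('D_u f) (x + a *: u + b *: v)].
Proof.
move=> s0 df ddf sub.
pose g (a : R) := f (x + s *: v + a *: u) - f (x + a *: u).
have dg (a : R) : 0 <= a <= s ->
    is_derive a 1 g ('D_u f (x + s *: v + a *: u) - 'D_u f (x + a *: u)).
  move=> ha; apply: is_deriveB; apply: derivable_line; apply: df.
    by rewrite addrAC; apply: sub => //; rewrite lexx ltW.
  by rewrite -[X in O X]addr0 -(scale0r v); apply: sub => //; rewrite lexx ltW.
have mem (a : R) : a \in `[0, s] -> 0 <= a <= s by rewrite in_itv.
have [|||a /mem ha] := @MVT_segment R g
    (fun a => 'D_u f (x + s *: v + a *: u) - 'D_u f (x + a *: u)) 0 s.
- exact: ltW.
- by move=> a; rewrite in_itv => /andP[a0 a1]; apply: dg; rewrite !ltW.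
- by apply: derivable_within_continuous => a /mem /dg [].
rewrite subr0 => Eg.
pose k (b : R) := 'D_u f (x + a *: u + b *: v).
have dk (b : R) : 0 <= b <= s ->
    is_derive b 1 k ('D_v ('D_u f) (x + a *: u + b *: v)).
  by move=> hb; apply: derivable_line; apply: ddf; apply: sub.
have [|||b /mem hb] := @MVT_segment R k
    (fun b => 'D_v ('D_u f) (x + a *: u + b *: v)) 0 s.
- exact: ltW.
- by move=> b; rewrite in_itv => /andP[b0 b1]; apply: dk; rewrite !ltW.
- by apply: derivable_within_continuous => b /mem /dk [].
rewrite subr0 => Ek; exists a, b; split => //.
transitivity (g s - g 0).
  by rewrite /g !scale0r !addr0 (addrAC x (s *: v)); ring.
rewrite Eg -mulrA [s * (s * _)]mulrC; congr (_ * _).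
by rewrite mulrC -Ek /k scale0r addr0 addrAC.
Qed.

(** The second difference is symmetric in the two directions, so by [second_difference] the two
    mixed derivatives take a common value at two points of a small ball; a gap between p and q would
    contradict their continuity at x. *)
Lemma schwarz (O : set V) (f : V -> R) x u v : open O -> O x ->
  smooth_on O f -> 'D_u ('D_v f) x = 'D_v ('D_u f) x.
Proof.
have lt2 (w : R) : 0 <= w -> w < 2 * (w + 1) by move=> w0; lra.
move=> Oo Ox sf; apply/eqP/negPn/negP => ne.
set p := 'D_u ('D_v f) x; set q := 'D_v ('D_u f) x.
pose e := `|p - q| / 2.
have e0 : 0 < e by rewrite divr_gt0 // normr_gt0 subr_eq0.
have cont w w' : {for x, continuous ('D_w ('D_w' f))}.
  apply: differentiable_continuous; apply: smooth_on_differentiable Ox.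
  by do 2 apply: smooth_on_derive.
have /cvgrPdist_lt /(_ e e0) cp := cont u v.
have /cvgrPdist_lt /(_ e e0) cq := cont v u.
have near_x : \forall y \near x, [/\ O y, `|p - 'D_u ('D_v f) y| < e
    & `|q - 'D_v ('D_u f) y| < e].
  have On : \forall y \near x, O y by apply: open_nbhs_nbhs.
  apply: filterS (filterI On (filterI cp cq)).
  by move=> y [Oy [hp hq]]; split; [exact: Oy|exact: hp|exact: hq].
have /nbhs_ballP[d /= d0 dn] := near_x.
(* The displacement s(|u| + |v|) must stay below d; the summand 1 keeps the denominator positive,
   and [lt2] gives the strict bound. *)
pose s := d / (2 * (`|u| + `|v| + 1)).
have nn : 0 < `|u| + `|v| + 1 by rewrite ltr_wpDl // addr_ge0.
have s0 : 0 < s by rewrite divr_gt0 // mulr_gt0.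
have bl a b : 0 <= a <= s -> 0 <= b <= s -> ball x d (x + a *: u + b *: v).
  move=> /andP[a0 a1] /andP[b0 b1]; rewrite -ball_normE /= -addrA opprD addNKr.
  rewrite normrN (le_lt_trans (ler_normD _ _)) // !normrZ !ger0_norm //.
  apply: (@le_lt_trans _ _ (s * (`|u| + `|v|))).
    by rewrite mulrDr lerD // ler_wpM2r.
  apply: (@lt_le_trans _ _ (s * (2 * (`|u| + `|v| + 1)))).
    by rewrite ltr_pM2l // lt2 // addr_ge0.
  by rewrite /s divfK // mulf_neq0 // gt_eqF.
have inO y : ball x d y -> O y by move=> /dn[].
have der w w' y : O y -> derivable f y w /\ derivable ('D_w f) y w'.
  move=> Oy; split; apply: diff_derivable; apply: smooth_on_differentiable Oy => //.
  exact: smooth_on_derive.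
have [|||a [b [ha hb E1]]] := @second_difference (ball x d) f x u v s s0.
- by move=> y /inO /(der u u) [].
- by move=> y /inO /(der u v) [].
- exact: bl.
have [|||a' [b' [ha' hb' E2]]] := @second_difference (ball x d) f x v u s s0.
- by move=> y /inO /(der v v) [].
- by move=> y /inO /(der v u) [].
- by move=> a' b' ha' hb'; rewrite addrAC; apply: bl.
have /dn[_ _ cq'] := bl a b ha hb.
have /dn[_ cp' _] := bl b' a' hb' ha'.
have E : 'D_v ('D_u f) (x + a *: u + b *: v) = 'D_u ('D_v f) (x + b' *: u + a' *: v).
  have ss : s * s != 0 by rewrite mulf_neq0 // gt_eqF.
  rewrite (addrAC x (a' *: v)) (addrAC x (s *: v)) in E2.
  apply: (mulfI ss); apply: etrans (esym E1) (etrans _ E2).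
  by congr (_ + _); exact: addrAC.
have : `|p - q| < e + e.
  rewrite E (distrC q) in cq'.
  by apply: le_lt_trans (ltrD cp' cq'); exact: ler_distD.
by rewrite /e -splitr ltxx.
Unshelve. all: by end_near. Qed.

End Schwarz.

(** * Entries of smooth maps, and stability of smoothness under the ring operations and
    composition *)

Section Coordinates.
Variables (R : realType) (V : normedModType R) (p q : nat).
Implicit Types (X : V -> 'M[R]_(p, q)).

Lemma derive_coord X x v i j : differentiable X x ->
  'D_v X x i j = 'D_v (fun y => X y i j) x.
Proof. by move=> /diff_derivable dX; rewrite derive_mx // mxE. Qed.

Lemma differentiable_entry X x i j : differentiable X x ->
  differentiable (fun y => X y i j) x.
Proof.
move=> dX; apply: (differentiable_comp (g := fun N : 'M[R]_(p, q) => N i j)) => //.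
exact: differentiable_coord.
Qed.

(** Taking an entry is known to commute with ['D_v] only at points of differentiability, here on
    [U]; so the invariant class consists of the functions equal on [U] to an entry of a smooth
    map. *)
Lemma smooth_on_coord (U : set V) X i j : open U -> smooth_on U X ->
  smooth_on U (fun y => X y i j).
Proof.
move=> Uo sX.
apply: (@smooth_on_coind _ _ _ U (fun h => exists2 Y : V -> 'M[R]_(p, q),
    smooth_on U Y & forall y, U y -> Y y i j = h y)) => [h [Y sY E] x Ux|h v [Y sY E]|].
- apply: (differentiable_near_eq (f := fun y => Y y i j)).
    exact: near_of_open Ux E.
  exact/differentiable_entry/(smooth_on_differentiable sY).
- exists ('D_v Y); first exact: smooth_on_derive.
  move=> y Uy; rewrite derive_coord; last exact: smooth_on_differentiable sY Uy.
  by apply: near_eq_derive; apply: near_of_open Uy E.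
- by exists X.
Qed.

End Coordinates.

Section PartialDerivatives.
Variables (R : realType) (n : nat).
Local Notation V := 'rV[R]_n.

Lemma derive_dvec_sum (f : V -> R) x v : differentiable f x ->
  'D_v f x = \sum_i v 0 i * 'D_(dvec i) f x.
Proof.
move=> df; rewrite deriveE // {1}[v]row_sum_delta linear_sum.
by apply: eq_bigr => i _; rewrite linearZ /= deriveE.
Qed.

End PartialDerivatives.

Section SmoothGen.
Variables (R : realType) (V : normedModType R) (U : set V).
Hypothesis Uo : open U.

(* The closure of the smooth functions on U under the operations that Leibniz's
   rule, the quotient rule and the chain rule can produce. *)
Inductive smooth_gen : (V -> R) -> Prop :=
| gen_base f : smooth_on U f -> smooth_gen f
| gen_eq f g : (forall x, U x -> f x = g x) -> smooth_gen f -> smooth_gen g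
| gen_add f g : smooth_gen f -> smooth_gen g -> smooth_gen (f + g)
| gen_mul f g : smooth_gen f -> smooth_gen g -> smooth_gen (f * g)
| gen_inv f : (forall x, U x -> f x != 0) -> smooth_gen f ->
    smooth_gen (fun x => (f x)^-1)
| gen_comp k (O' : set 'rV[R]_k) (h : 'rV[R]_k -> R) (F : V -> 'rV[R]_k) :
    smooth_on O' h -> smooth_on U F -> (forall x, U x -> O' (F x)) ->
    smooth_gen (h \o F).

Lemma smooth_gen_differentiable f : smooth_gen f ->
  forall x, U x -> differentiable f x.
Proof.
elim=> {f} [f sf|f g E _ IH|f g _ IHf _ IHg|f g _ IHf _ IHg|f f0 _ IH|k O' h F sh sF OF] x Ux.
- exact: smooth_on_differentiable Ux.
- by apply: differentiable_near_eq (IH x Ux); apply: near_of_open Ux E.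
- by apply: differentiableD; [apply: IHf|apply: IHg].
- by apply: differentiableM; [apply: IHf|apply: IHg].
- by apply: differentiableV; [apply: IH|apply: f0].
- apply: differentiable_comp; first exact: smooth_on_differentiable Ux.
  by apply: smooth_on_differentiable sh _; apply: OF.
Qed.

Lemma smooth_on_cst (r : R) : smooth_on U (cst r : V -> R).
Proof.
apply: (@smooth_on_coind _ _ _ U (fun h => exists s : R, h = cst s)) => [h [s ->] x _|h v [s ->]|].
- exact: differentiable_cst.
- by exists 0; apply/funext => x; rewrite derive_cst.
- by exists r.
Qed.

Lemma smooth_gen_sum (I : Type) (r : seq I) (f : I -> V -> R) :
  (forall i, smooth_gen (f i)) -> smooth_gen (fun x => \sum_(i <- r) f i x).
Proof.
move=> gf; elim: r => [|i r IH].
  apply: (gen_eq (f := cst 0)); first by move=> x _; rewrite big_nil.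
  exact/gen_base/smooth_on_cst.
apply: (gen_eq (f := f i + (fun x => \sum_(i <- r) f i x))).
  by move=> x _; rewrite big_cons.
exact: gen_add.
Qed.

(** The rules of calculus are applied on [U] only, so each case after the first goes through
    [gen_eq]. In the last one the chain rule yields composites of [F] with partial derivatives of
    [h], again of the form [gen_comp]. *)
Lemma smooth_gen_derive f v : smooth_gen f -> smooth_gen ('D_v f).
Proof.
have der := smooth_gen_differentiable.
elim=> {f} [f sf|f g E gf IH|f g gf IHf gg IHg|f g gf IHf gg IHg|f f0 gf IH|k O' h F sh sF OF].
- exact/gen_base/smooth_on_derive.
- apply: (gen_eq _ IH) => x Ux; apply: near_eq_derive; exact: near_of_open Ux E.
- apply: (gen_eq _ (gen_add IHf IHg)) => x Ux.
  by rewrite deriveD //; apply: diff_derivable; exact: der Ux.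
- apply: (gen_eq _ (gen_add (gen_mul gf IHg) (gen_mul gg IHf))) => x Ux.
  by rewrite deriveM //; apply: diff_derivable; exact: der Ux.
- have gi := gen_inv f0 gf.
  have gc := gen_base (smooth_on_cst (-1)).
  apply: (gen_eq _ (gen_mul gc (gen_mul (gen_mul gi gi) IH))) => x Ux.
  rewrite deriveV; [|exact: f0|by apply: diff_derivable; exact: der Ux].
  by rewrite !fctE /= mulN1r scaleNr -invfM -expr2.
- apply: (gen_eq (f := fun x => \sum_i ('D_v F x) 0 i * ('D_(dvec i) h) (F x))) => [x Ux|].
    have dF : differentiable F x by exact: smooth_on_differentiable Ux.
    have dh : differentiable h (F x) by exact: (smooth_on_differentiable sh (OF _ Ux)).
    rewrite -(derive_dvec_sum _ dh) (deriveE _ dh) (deriveE _ dF).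
    by rewrite (deriveE _ (differentiable_comp dF dh)) (diff_comp dF dh).
  apply: smooth_gen_sum => i; apply: gen_mul.
    by apply/gen_base/smooth_on_coord => //; exact: smooth_on_derive.
  by apply: (gen_comp (O' := O') (h := 'D_(dvec i) h)) => //; exact: smooth_on_derive.
Qed.

Lemma smooth_gen_on f : smooth_gen f -> smooth_on U f.
Proof.
apply: smooth_on_coind => [h|h v]; first exact: smooth_gen_differentiable.
exact: smooth_gen_derive.
Qed.

Lemma smooth_on_eq (f g : V -> R) : (forall x, U x -> f x = g x) ->
  smooth_on U f -> smooth_on U g.
Proof. by move=> E sf; apply/smooth_gen_on/(gen_eq E)/gen_base. Qed.

Lemma smooth_onD (f g : V -> R) : smooth_on U f -> smooth_on U g -> smooth_on U (f + g).
Proof. by move=> sf sg; apply/smooth_gen_on/gen_add; apply: gen_base. Qed.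

Lemma smooth_onM (f g : V -> R) : smooth_on U f -> smooth_on U g -> smooth_on U (f * g).
Proof. by move=> sf sg; apply/smooth_gen_on/gen_mul; apply: gen_base. Qed.

Lemma smooth_onV (f : V -> R) : (forall x, U x -> f x != 0) -> smooth_on U f ->
  smooth_on U (fun x => (f x)^-1).
Proof. by move=> f0 sf; apply/smooth_gen_on/gen_inv/gen_base. Qed.

Lemma smooth_on_comp k (O' : set 'rV[R]_k) (h : 'rV[R]_k -> R) (F : V -> 'rV[R]_k) :
  smooth_on O' h -> smooth_on U F -> (forall x, U x -> O' (F x)) ->
  smooth_on U (h \o F).
Proof. by move=> sh sF OF; apply/smooth_gen_on/(gen_comp sh sF OF). Qed.

End SmoothGen.

(** * The ring of smooth functions on an open set and its partial derivatives *)

Record domain (R : realType) (n : nat) := Domain {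
  dom_set :> 'rV[R]_n -> Prop;
  dom_open : open (dom_set : set _);
  dom_nonempty : exists x, dom_set x }.
Arguments dom_open {R n} d.
Arguments dom_nonempty {R n} d.

(* Smooth functions on O are represented by their extension by zero, so that
   Leibniz equality is equality on O; the unit is the indicator of O. *)
Record smfun (R : realType) (n : nat) (O : domain R n) := SmFun {
  smfun_val :> 'rV[R]_n -> R;
  smfun_smooth : smooth_on (dom_set O) smfun_val;
  smfun_out : forall x, ~ O x -> smfun_val x = 0 }.

HB.instance Definition _ (R : realType) (n : nat) (O : domain R n) :=
  gen_eqMixin (smfun O).
HB.instance Definition _ (R : realType) (n : nat) (O : domain R n) :=
  gen_choiceMixin (smfun O).

Section SmoothFunctionRing.
Variables (R : realType) (n : nat) (O : domain R n).
Local Notation V := 'rV[R]_n.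
Let Oo := dom_open O.

Lemma smfun_eq (f g : smfun O) : (forall x, O x -> f x = g x) -> f = g.
Proof.
case: f g => [f sf f0] [g sg g0] /= E.
have fg : f = g.
  apply/funext => x; case: (pselect (O x)) => [|nOx]; first exact: E.
  by rewrite f0 ?g0.
case: _ / fg in sg g0 E *.
by rewrite (Prop_irrelevance sf sg) (Prop_irrelevance f0 g0).
Qed.

Definition smfun_ext (f : V -> R) : V -> R := fun x => if `[< O x >] then f x else 0.

Lemma smfun_extE f x : O x -> smfun_ext f x = f x.
Proof. by move=> Ox; rewrite /smfun_ext asboolT. Qed.

Lemma smfun_ext_smooth f : smooth_on (dom_set O) f -> smooth_on (dom_set O) (smfun_ext f).
Proof. by apply: smooth_on_eq => // x Ox; rewrite smfun_extE. Qed.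

Lemma smfun_ext_out f x : ~ O x -> smfun_ext f x = 0.
Proof. by move=> nO; rewrite /smfun_ext asboolF. Qed.

Definition smfun_of f (sf : smooth_on (dom_set O) f) : smfun O :=
  SmFun (smfun_ext_smooth sf) (@smfun_ext_out f).

Lemma smfun_ofE f (sf : smooth_on (dom_set O) f) x : O x -> smfun_of sf x = f x.
Proof. exact: smfun_extE. Qed.

Arguments smfun_of : simpl never.

Definition smfun_cst r : smfun O := smfun_of (@smooth_on_cst R V (dom_set O) r).
Definition smfun_add (f g : smfun O) : smfun O :=
  smfun_of (smooth_onD Oo (smfun_smooth f) (smfun_smooth g)).
Definition smfun_mul (f g : smfun O) : smfun O :=
  smfun_of (smooth_onM Oo (smfun_smooth f) (smfun_smooth g)).
Definition smfun_opp (f : smfun O) : smfun O := smfun_mul (smfun_cst (-1)) f.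

Arguments smfun_cst : simpl never.

Lemma smfun_addE f g x : O x -> smfun_add f g x = f x + g x.
Proof. by move=> Ox; rewrite smfun_ofE. Qed.

Lemma smfun_mulE f g x : O x -> smfun_mul f g x = f x * g x.
Proof. by move=> Ox; rewrite smfun_ofE. Qed.

Lemma smfun_cstE r x : O x -> smfun_cst r x = r.
Proof. by move=> Ox; rewrite smfun_ofE. Qed.

Let smfunE := (smfun_addE, smfun_mulE, smfun_cstE).

Lemma smfun_addA : associative smfun_add.
Proof. by move=> f g h; apply: smfun_eq => x Ox; rewrite !smfunE // addrA. Qed.

Lemma smfun_addC : commutative smfun_add.
Proof. by move=> f g; apply: smfun_eq => x Ox; rewrite !smfunE // addrC. Qed.

Lemma smfun_add0 : left_id (smfun_cst 0) smfun_add.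
Proof. by move=> f; apply: smfun_eq => x Ox; rewrite !smfunE // add0r. Qed.

Lemma smfun_addN : left_inverse (smfun_cst 0) smfun_opp smfun_add.
Proof. by move=> f; apply: smfun_eq => x Ox; rewrite !smfunE // mulN1r addNr. Qed.

HB.instance Definition _ := GRing.isZmodule.Build (smfun O)
  smfun_addA smfun_addC smfun_add0 smfun_addN.

Lemma smfun_mulA : associative smfun_mul.
Proof. by move=> f g h; apply: smfun_eq => x Ox; rewrite !smfunE // mulrA. Qed.

Lemma smfun_mulC : commutative smfun_mul.
Proof. by move=> f g; apply: smfun_eq => x Ox; rewrite !smfunE // mulrC. Qed.

Lemma smfun_mul1 : left_id (smfun_cst 1) smfun_mul.
Proof. by move=> f; apply: smfun_eq => x Ox; rewrite !smfunE // mul1r. Qed.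

Lemma smfun_mulD : left_distributive smfun_mul smfun_add.
Proof. by move=> f g h; apply: smfun_eq => x Ox; rewrite !smfunE // mulrDl. Qed.

(** Here the domain must have a point: over the empty set the ring would be trivial, which a
    [comNzRingType] may not be. *)
Lemma smfun_1neq0 : smfun_cst 1 != smfun_cst 0.
Proof.
apply/eqP => E; have [x Ox] := dom_nonempty O.
have := congr1 (fun f : smfun O => f x) E; rewrite !smfun_cstE // => /eqP.
by rewrite oner_eq0.
Qed.

HB.instance Definition _ := GRing.Zmodule_isComNzRing.Build (smfun O)
  smfun_mulA smfun_mulC smfun_mul1 smfun_mulD smfun_1neq0.

Definition smfun_eval (p : {x | O x}) (f : smfun O) : R := f (sval p).

Arguments smfun_eval : simpl never.

Lemma smfun_eval_zmod p : zmod_morphism (smfun_eval p).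
Proof.
move=> f g; rewrite /smfun_eval; have Op := svalP p.
by rewrite [in LHS]smfun_addE // smfun_mulE // smfun_cstE // mulN1r.
Qed.

Lemma smfun_eval_monoid p : monoid_morphism (smfun_eval p).
Proof.
by split=> [|f g]; have Op := svalP p; [exact: smfun_cstE|exact: smfun_mulE].
Qed.

HB.instance Definition _ p := GRing.isZmodMorphism.Build (smfun O) R
  (smfun_eval p) (smfun_eval_zmod p).
HB.instance Definition _ p := GRing.isMonoidMorphism.Build (smfun O) R
  (smfun_eval p) (smfun_eval_monoid p).

Lemma smfun_sumE (I : Type) (r : seq I) (f : I -> smfun O) x : O x ->
  (\sum_(i <- r) f i) x = \sum_(i <- r) f i x.
Proof. by move=> Ox; exact: (raddf_sum (smfun_eval (exist _ x Ox))). Qed.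

Lemma eval_eq (f g : smfun O) : (forall p, smfun_eval p f = smfun_eval p g) -> f = g.
Proof. by move=> E; apply: smfun_eq => x Ox; apply: (E (exist _ x Ox)). Qed.

Lemma eval_mx_eq p q (X Y : 'M[smfun O]_(p, q)) :
  (forall z, map_mx (smfun_eval z) X = map_mx (smfun_eval z) Y) -> X = Y.
Proof.
move=> E; apply/matrixP => i j; apply: eval_eq => z.
by have /matrixP/(_ i j) := E z; rewrite !mxE.
Qed.

Lemma eval_cst p r : smfun_eval p (smfun_cst r) = r.
Proof. exact: smfun_cstE (svalP p). Qed.

Definition smfun_der (v : V) (f : smfun O) : smfun O :=
  smfun_of (smooth_on_derive v (smfun_smooth f)).

Arguments smfun_der : simpl never.

Lemma smfun_derE v f x : O x -> smfun_der v f x = 'D_v f x.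
Proof. exact: smfun_ofE. Qed.

Lemma smfun_derivable v (f : smfun O) x : O x -> derivable f x v.
Proof.
move=> Ox; apply: diff_derivable.
exact: smooth_on_differentiable (smfun_smooth f) Ox.
Qed.

Lemma smfun_derD v f g : smfun_der v (f + g) = smfun_der v f + smfun_der v g.
Proof.
apply: smfun_eq => x Ox; rewrite smfun_addE // !smfun_derE //.
rewrite -deriveD; try exact: smfun_derivable.
by apply: near_eq_derive; apply: near_of_open Oo Ox _ => y Oy; rewrite smfun_addE.
Qed.

Lemma smfun_der_zmod v : zmod_morphism (smfun_der v).
Proof.
by move=> f g; apply/eqP; rewrite eq_sym subr_eq -smfun_derD subrK.
Qed.

HB.instance Definition _ v := GRing.isZmodMorphism.Build (smfun O) (smfun O)
  (smfun_der v) (smfun_der_zmod v).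

Lemma smfun_derM v f g :
  smfun_der v (f * g) = smfun_der v f * g + f * smfun_der v g.
Proof.
apply: smfun_eq => x Ox; rewrite smfun_addE // !smfun_mulE // !smfun_derE //.
rewrite addrC [in RHS](mulrC _ (g x)) -deriveM; try exact: smfun_derivable.
by apply: near_eq_derive; apply: near_of_open Oo Ox _ => y Oy; rewrite smfun_mulE.
Qed.

Lemma smfun_der_cst v r : smfun_der v (smfun_cst r) = 0.
Proof.
apply: smfun_eq => x Ox; rewrite smfun_derE // smfun_cstE // -(derive_cst r x v).
by apply: near_eq_derive; apply: near_of_open Oo Ox _ => y Oy; rewrite smfun_cstE.
Qed.

Lemma smfun_derC u v f : smfun_der u (smfun_der v f) = smfun_der v (smfun_der u f).
Proof.
have E w w' x : O x -> smfun_der w (smfun_der w' f) x = 'D_w ('D_w' f) x.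
  move=> Ox; rewrite smfun_derE //; apply: near_eq_derive.
  by apply: near_of_open Oo Ox _ => y Oy; rewrite smfun_derE.
apply: smfun_eq => x Ox; apply: etrans (E u v _ Ox) (etrans _ (esym (E v u _ Ox))).
exact: schwarz Oo Ox (smfun_smooth f).
Qed.

Definition partials : derivations (smfun O) n :=
  @Derivations (smfun O) n (fun i => smfun_der (dvec i))
    (fun i => smfun_derM (dvec i)) (fun i j => smfun_derC (dvec i) (dvec j)).

End SmoothFunctionRing.

Arguments smfun_of {R n O f} sf : simpl never.
Arguments smfun_cst {R n} O r : simpl never.
Arguments smfun_der {R n O} v f : simpl never.
Arguments smfun_eval {R n O} p f : simpl never.
Arguments smfun_eq {R n O f g}.
Arguments eval_eq {R n O}.
Arguments eval_mx_eq {R n O p q}.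
Arguments eval_cst {R n O}.
Arguments smfun_derE {R n O}.

(** * Composition with a smooth map as a ring morphism, and the chain rule *)

Section PullbackFunction.
Variables (R : realType) (m n : nat) (O : domain R m) (O' : domain R n).
Variables (F : 'rV[R]_m -> 'rV[R]_n).
Hypotheses (sF : smooth_on (dom_set O) F) (OF : forall x, O x -> O' (F x)).

Definition smfun_pull (k : smfun O') : smfun O :=
  smfun_of (smooth_on_comp (dom_open O) (smfun_smooth k) sF OF).

Arguments smfun_pull : simpl never.

Lemma smfun_pullE k x : O x -> smfun_pull k x = k (F x).
Proof. exact: smfun_ofE. Qed.

Lemma smfun_pull_zmod : zmod_morphism smfun_pull.
Proof.
move=> f g; apply: smfun_eq => x Ox; rewrite smfun_pullE //.
apply: etrans (smfun_eval_zmod (exist _ (F x) (OF Ox)) f g) _.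
apply: etrans (esym (smfun_eval_zmod (exist _ x Ox) _ _)).
by rewrite /smfun_eval !smfun_pullE.
Qed.

Lemma smfun_pull_monoid : monoid_morphism smfun_pull.
Proof.
split=> [|f g]; apply: smfun_eq => x Ox.
  by rewrite smfun_pullE // smfun_cstE ?smfun_cstE //; exact: OF.
by rewrite smfun_mulE // !smfun_pullE // smfun_mulE //; exact: OF.
Qed.

HB.instance Definition _ := GRing.isZmodMorphism.Build (smfun O') (smfun O)
  smfun_pull smfun_pull_zmod.
HB.instance Definition _ := GRing.isMonoidMorphism.Build (smfun O') (smfun O)
  smfun_pull smfun_pull_monoid.

Definition smfun_pull_rmorphism : {rmorphism smfun O' -> smfun O} := smfun_pull.

Definition frame_mx : 'M[smfun O]_(m, n) := \matrix_(i, a)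
  smfun_of (smooth_on_coord 0 a (dom_open O) (smooth_on_derive (dvec i) sF)).

Lemma frame_mxE i a x : O x -> frame_mx i a x = 'D_(dvec i) F x 0 a.
Proof. by move=> Ox; rewrite mxE smfun_ofE. Qed.

Lemma smfun_pull_chain i k : partials O i (smfun_pull k) =
  \sum_a frame_mx i a * smfun_pull (partials O' a k).
Proof.
apply: smfun_eq => x Ox; rewrite smfun_sumE //.
under eq_bigr => a _ do
  rewrite smfun_mulE // smfun_pullE // frame_mxE // [partials _ _ _ _](smfun_derE _ _ _ (OF Ox)).
have dF : differentiable F x by exact: smooth_on_differentiable Ox.
have dk : differentiable k (F x).
  exact: smooth_on_differentiable (smfun_smooth k) (OF Ox).
rewrite [LHS]smfun_derE // -(derive_dvec_sum _ dk) (deriveE _ dk) (deriveE _ dF).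
have <- : 'D_(dvec i) (k \o F) x = 'd k (F x) ('d F x (dvec i)).
  by rewrite (deriveE _ (differentiable_comp dF dk)) (diff_comp dF dk).
apply: near_eq_derive; apply: near_of_open (dom_open O) Ox _ => y Oy.
by rewrite smfun_pullE.
Qed.

Lemma frame_mx_closed i j a :
  partials O i (frame_mx j a) = partials O j (frame_mx i a).
Proof.
pose Fa := smfun_of (smooth_on_coord 0 a (dom_open O) sF).
have E k : frame_mx k a = partials O k Fa.
  apply: smfun_eq => x Ox; rewrite frame_mxE // smfun_derE // derive_coord; last first.
    exact: smooth_on_differentiable Ox.
  apply: near_eq_derive; apply: near_of_open (dom_open O) Ox _ => y Oy.
  by rewrite smfun_ofE.
by rewrite !E derC.
Qed.

End PullbackFunction.
Arguments smfun_pull {R m n O O' F} sF OF k : simpl never.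

(** * Dictionary between functions in a chart and elements of the ring *)

Section Representation.
Variables (R : realType) (n : nat) (O : domain R n).
Local Notation V := 'rV[R]_n.
Local Notation K := (smfun O).
Local Notation D := (partials O).
Local Notation pt := {x | O x}.

Definition evm (z : pt) p q (X : 'M[K]_(p, q)) : 'M[R]_(p, q) :=
  map_mx (smfun_eval z) X.

(** Agreement is asked on [O] only, since the functions of the statement are not extended by zero;
    [O] being open, it still passes to derivatives. *)
Definition represents (f : V -> R) (k : K) := forall z : pt, f (sval z) = smfun_eval z k.

Definition represents_mx p q (X : V -> 'M[R]_(p, q)) (Y : 'M[K]_(p, q)) :=
  forall z : pt, X (sval z) = evm z Y.

Definition cst_mx p q (X : 'M[R]_(p, q)) : 'M[K]_(p, q) := map_mx (@smfun_cst R n O) X.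

Lemma evmD z p q (X Y : 'M[K]_(p, q)) : evm z (X + Y) = evm z X + evm z Y.
Proof. exact: map_mxD. Qed.

Lemma evmN z p q (X : 'M[K]_(p, q)) : evm z (- X) = - evm z X.
Proof. exact: map_mxN. Qed.

Lemma evmM z p q r (X : 'M[K]_(p, q)) (Y : 'M[K]_(q, r)) :
  evm z (X *m Y) = evm z X *m evm z Y.
Proof. exact: map_mxM. Qed.

Lemma evmZ z p q a (X : 'M[K]_(p, q)) : evm z (a *: X) = smfun_eval z a *: evm z X.
Proof. exact: map_mxZ. Qed.

Lemma evm_sum z p q I (r : seq I) (X : I -> 'M[K]_(p, q)) :
  evm z (\sum_(i <- r) X i) = \sum_(i <- r) evm z (X i).
Proof. exact: (raddf_sum (map_mx (smfun_eval z))). Qed.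

Lemma evm_tr z p q (X : 'M[K]_(p, q)) : evm z X^T = (evm z X)^T.
Proof. by rewrite /evm map_trmx. Qed.

Lemma evm_row z p q i (X : 'M[K]_(p, q)) : evm z (row i X) = row i (evm z X).
Proof. exact: map_row. Qed.

Lemma evmE z p q (X : 'M[K]_(p, q)) i j : evm z X i j = smfun_eval z (X i j).
Proof. exact: mxE. Qed.

Lemma evm1 z p : evm z (1%:M : 'M[K]_p) = 1%:M.
Proof. exact: map_mx1. Qed.

Lemma evm_cst z p q (X : 'M[R]_(p, q)) : evm z (cst_mx X) = X.
Proof. by apply/matrixP => i j; rewrite !mxE eval_cst. Qed.

Lemma represents_cst p q (X : 'M[R]_(p, q)) : represents_mx (cst X) (cst_mx X).
Proof. by move=> z; rewrite evm_cst. Qed.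

Lemma dmx_cst p q i (X : 'M[R]_(p, q)) : dmx D i (cst_mx X) = 0.
Proof. by apply/matrixP => a b; rewrite !mxE; exact: smfun_der_cst. Qed.

Lemma near_represents f k (z : pt) : represents f k ->
  \forall y \near sval z, (k : V -> R) y = f y.
Proof.
move=> fk; apply: near_of_open (dom_open O) (svalP z) _ => y Oy.
by rewrite -[RHS]/(f (sval (exist _ y Oy))) fk.
Qed.

Lemma represents_derivable f k v (z : pt) : represents f k -> derivable f (sval z) v.
Proof.
move=> fk; apply: (near_eq_derivable (near_represents z fk)).
exact: smfun_derivable (svalP z).
Qed.

Lemma represents_derive f k v (z : pt) : represents f k ->
  'D_v f (sval z) = \sum_i v 0 i * smfun_eval z (D i k).
Proof.
move=> fk; rewrite -(near_eq_derive v (near_represents z fk)).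
have dk : differentiable (k : V -> R) (sval z).
  exact: smooth_on_differentiable (smfun_smooth k) (svalP z).
rewrite (derive_dvec_sum v dk); apply: eq_bigr => i _; congr (_ * _).
by rewrite -(smfun_derE _ _ _ (svalP z)).
Qed.

Lemma represents_mx_entry p q X Y i j : represents_mx (p := p) (q := q) X Y ->
  represents (fun y => X y i j) (Y i j).
Proof. by move=> XY z; rewrite XY evmE. Qed.

Lemma represents_mx_derive p q X Y v (z : pt) : represents_mx (p := p) (q := q) X Y ->
  'D_v X (sval z) = \sum_i v 0 i *: evm z (dmx D i Y).
Proof.
move=> XY; rewrite derive_mx; last first.
  apply/derivable_mxP => i j.
  by apply: represents_derivable; exact: represents_mx_entry XY.
apply/matrixP => i j; rewrite mxE.
rewrite (represents_derive _ _ (represents_mx_entry i j XY)) summxE.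
by apply: eq_bigr => k _; rewrite !mxE.
Qed.

Lemma sum_dvec (W : lmodType R) (i : 'I_n) (F : 'I_n -> W) :
  \sum_j (dvec i : V) 0 j *: F j = F i.
Proof.
rewrite (bigD1 i) //= big1 => [|j ji]; rewrite mxE ?eqxx /=.
  by rewrite scale1r addr0.
by rewrite (negbTE ji) scale0r.
Qed.

Lemma row_dvec p (i : 'I_n) (X : 'M[R]_(n, p)) : (dvec i : V) *m X = row i X.
Proof. by rewrite /dvec -rowE. Qed.

Lemma represents_mx_of p q (X : V -> 'M[R]_(p, q)) : smooth_on (dom_set O) X ->
  exists Y, represents_mx X Y.
Proof.
move=> sX; exists (\matrix_(i, j) smfun_of (smooth_on_coord i j (dom_open O) sX)).
by move=> z; apply/matrixP => i j; rewrite !mxE /smfun_eval smfun_ofE //; exact: svalP.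
Qed.

Section Metric.
Variables (G : V -> 'M[R]_n) (g gi : 'M[K]_n).
Hypotheses (Gg : represents_mx G g) (ggi : g *m gi = 1%:M) (gT : g^T = g).
Let hf : K := smfun_cst O 2^-1.
Local Notation Gam := (koszul D hf g gi).

Lemma half_half : hf + hf = 1.
Proof.
apply: eval_eq => z; rewrite rmorphD rmorph1 /= eval_cst.
by rewrite [RHS]splitr div1r.
Qed.

Lemma represents_invmx z : invmx (G (sval z)) = evm z gi.
Proof.
have E : G (sval z) *m evm z gi = 1%:M by rewrite Gg -evmM ggi evm1.
have [Gu _] := mulmx1_unit E.
by rewrite -[RHS](mulKmx Gu) E mulmx1.
Qed.

(** Bilinearity of [christoffel] rests on differentiability of the Gram matrix: the derivatives
    along [u] and [w] expand over partial ones, and both sides become the same double sum. *)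
Lemma christoffelE u w z :
  christoffel G (sval z) u w = \sum_i u 0 i *: (w *m evm z (Gam i)).
Proof.
have repw (a b : V) : represents (fun y => inner (G y) a b)
    ((cst_mx a *m g *m (cst_mx b)^T) 0 0).
  by move=> z'; rewrite /inner Gg -evmE !evmM evm_tr !evm_cst.
have dg (a b : V) i : smfun_eval z (D i ((cst_mx a *m g *m (cst_mx b)^T) 0 0)) =
    (a *m evm z (dmx D i g) *m b^T) 0 0.
  have -> : D i ((cst_mx a *m g *m (cst_mx b)^T) 0 0) =
      dmx D i (cst_mx a *m g *m (cst_mx b)^T) 0 0 by rewrite [RHS]mxE.
  rewrite !dmxM dmx_tr !dmx_cst trmx0 mulmx0 mul0mx add0r addr0.
  by rewrite -evmE !evmM evm_tr !evm_cst.
have drep a b v : 'D_v (fun y => inner (G y) a b) (sval z) =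
    \sum_i v 0 i * (a *m evm z (dmx D i g) *m b^T) 0 0.
  rewrite (represents_derive v z (repw a b)); apply: eq_bigr => i _.
  by congr (_ * _); exact: dg.
have E : 2^-1 *: (\row_l ('D_u (fun y => inner (G y) w (dvec l)) (sval z)
      + 'D_w (fun y => inner (G y) u (dvec l)) (sval z)
      - 'D_(dvec l) (fun y => inner (G y) u w) (sval z))) =
    \sum_i u 0 i *: (w *m evm z (koszul_lower D hf g i)).
  apply/rowP => l; rewrite mxE [X in _ * X]mxE !drep.
  rewrite [X in _ - X](sum_dvec l (fun i => (u *m evm z (dmx D i g) *m w^T) 0 0)).
  have el (X : V) : (X *m (dvec l : V)^T) 0 0 = X 0 l.
    by rewrite trmx_delta -colE mxE.
  under eq_bigr => i _ do rewrite el mxE mulr_sumr.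
  under [X in _ + X - _]eq_bigr => i _ do rewrite el mxE mulr_sumr.
  rewrite [X in _ + X - _]exchange_big /=.
  have -> : (u *m evm z (dmx D l g) *m w^T) 0 0 =
      \sum_i \sum_j u 0 i * (w 0 j * smfun_eval z (D l (g i j))).
    rewrite -mulmxA mxE; apply: eq_bigr => i _; rewrite mxE mulr_sumr.
    by apply: eq_bigr => j _; rewrite !mxE; ring.
  rewrite -big_split -sumrB summxE mulr_sumr /=; apply: eq_bigr => i _.
  rewrite !mxE -big_split -sumrB !mulr_sumr /=; apply: eq_bigr => j _.
  rewrite !mxE rmorphM rmorphB rmorphD /= eval_cst; ring.
rewrite /christoffel E mulmx_suml; apply: eq_bigr => i _.
by rewrite mulmxZl -mulmxA represents_invmx /koszul evmM.
Qed.

Lemma covdE v X Y z : represents_mx X Y ->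
  covd G v X (sval z) = \sum_i v 0 i *: evm z (cov D Gam i Y).
Proof.
move=> XY; rewrite /covd (represents_mx_derive _ _ XY) christoffelE -big_split /=.
by apply: eq_bigr => i _; rewrite XY -scalerDr -evmM -evmD.
Qed.

Lemma represents_covd i X Y : represents_mx X Y ->
  represents_mx (covd G (dvec i) X) (cov D Gam i Y).
Proof. by move=> XY z; rewrite (covdE _ _ XY) sum_dvec. Qed.

Lemma represents_covd_gen v X Y : represents_mx X Y ->
  represents_mx (covd G v X) (\sum_i smfun_cst O (v 0 i) *: cov D Gam i Y).
Proof.
move=> XY z; rewrite (covdE _ _ XY) evm_sum.
by apply: eq_bigr => i _; rewrite evmZ eval_cst.
Qed.

Lemma covd_cst_dvec i j : represents_mx (covd G (dvec i) (cst (dvec j))) (row j (Gam i)).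
Proof.
move=> z; rewrite (covdE _ _ (represents_cst _)) sum_dvec.
by rewrite /cov dmx_cst add0r evmM evm_cst evm_row row_dvec.
Qed.

(** The components of the arguments are constants, so they leave the inner covariant derivative
    undifferentiated, and [covC] applies to each pair of coordinate directions. *)
Lemma curvatureE u v w z : curvature G (sval z) u v w =
  \sum_i \sum_j (u 0 i * v 0 j) *: (w *m evm z (curvmx D Gam i j)).
Proof.
have r1 a := represents_covd_gen a (represents_cst w).
have E a b : covd G a (covd G b (cst w)) (sval z) =
   \sum_i \sum_j (a 0 i * b 0 j) *: evm z (cov D Gam i (cov D Gam j (cst_mx w))).
  rewrite (covdE _ _ (r1 b)); apply: eq_bigr => i _.
  rewrite cov_sum evm_sum scaler_sumr; apply: eq_bigr => j _.
  by rewrite covZ [D i _]smfun_der_cst scale0r add0r evmZ eval_cst scalerA.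
rewrite /curvature !E [X in _ - X]exchange_big /= -sumrB; apply: eq_bigr => i _.
rewrite -sumrB; apply: eq_bigr => j _.
rewrite (mulrC (v 0 j)) -scalerBr; congr (_ *: _).
by rewrite -evmN -evmD covC evmM evm_cst.
Qed.

Lemma curvature_dvec i j k z : curvature G (sval z) (dvec i) (dvec j) (dvec k) =
  row k (evm z (curvmx D Gam i j)).
Proof.
rewrite curvatureE; under eq_bigr => a _ do under eq_bigr => b _ do rewrite -scalerA.
under eq_bigr => a _ do rewrite -scaler_sumr.
by rewrite !sum_dvec row_dvec.
Qed.

End Metric.
End Representation.

(** * Constant sectional curvature determines the curvature tensor *)

Section Polarization.
Variables (R : realFieldType) (V : zmodType) (B : V -> V -> V -> V -> R).
Hypothesis B1 : forall u u' v w z, B (u + u') v w z = B u v w z + B u' v w z.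
Hypothesis B2 : forall u v v' w z, B u (v + v') w z = B u v w z + B u v' w z.
Hypothesis B3 : forall u v w w' z, B u v (w + w') z = B u v w z + B u v w' z.
Hypothesis B4 : forall u v w z z', B u v w (z + z') = B u v w z + B u v w z'.
Hypothesis B12 : forall u v w z, B u v w z = - B v u w z.
Hypothesis B34 : forall u v w z, B u v w z = - B u v z w.
Hypothesis bianchi : forall u v w z, B u v w z + B v w u z + B w u v z = 0.
Hypothesis sectional0 : forall u v, B u v v u = 0.

(** One cyclic identity for each choice of the fixed last argument; once the skew symmetries have
    brought the terms to common representatives, [lra] finds the linear combination. *)
Lemma pair_symmetry u v w z : B u v w z = B w z u v.
Proof.
have := (bianchi u v w z, bianchi v w z u, bianchi w z u v, bianchi z u v w).
rewrite (B34 v w z u) (B12 w z v u) (B34 z w v u) (B12 z w u v) (B12 z v w u).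
rewrite (B12 z u w v) (B34 u z w v) (B12 u w z v) (B34 w u z v) (B12 z u v w).
by rewrite (B34 u v z w) (B34 v z u w) => -[[[]]]; lra.
Qed.

(** [s1] polarizes in the outer pair, [s2] in the inner pair. [B] is then skew in its first three
    arguments, so the Bianchi identity reads 3 B = 0. *)
Lemma polarization u v w z : B u v w z = 0.
Proof.
have s1 a b d : B a b b d = 0.
  have := sectional0 (a + d) b; rewrite B1 !B4 !sectional0.
  rewrite (pair_symmetry d) (B12 b a) (B34 a b d b); lra.
have s2 a b d e : B a b d e = - B a d b e.
  by have := s1 a (b + d) e; rewrite B2 !B3 !s1; lra.
have := bianchi u v w z.
by rewrite (s2 v w) (B12 v u) (B12 w u) (s2 u w); lra.
Qed.

End Polarization.

Section InnerProduct.
Variables (R : realType) (n : nat) (H : 'M[R]_n).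
Implicit Types (u v w : 'rV[R]_n).

Lemma innerDl u u' v : inner H (u + u') v = inner H u v + inner H u' v.
Proof. by rewrite /inner !mulmxDl mxE. Qed.

Lemma innerDr u v v' : inner H u (v + v') = inner H u v + inner H u v'.
Proof. by rewrite /inner trmxD mulmxDr mxE. Qed.

Lemma innerZl k u v : inner H (k *: u) v = k * inner H u v.
Proof. by rewrite /inner -!scalemxAl mxE. Qed.

Lemma innerZr k u v : inner H u (k *: v) = k * inner H u v.
Proof. by rewrite /inner trmxZ mulmxZr mxE. Qed.

Lemma innerNl u v : inner H (- u) v = - inner H u v.
Proof. by rewrite -scaleN1r innerZl mulN1r. Qed.

Lemma inner_sym u v : H^T = H -> inner H u v = inner H v u.
Proof.
move=> HT; rewrite /inner -[in LHS](trmxK (u *m H *m v^T)) mxE.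
by rewrite !trmx_mul trmxK HT mulmxA.
Qed.

Lemma inner_suml I (r : seq I) (X : I -> 'rV[R]_n) v :
  inner H (\sum_(i <- r) X i) v = \sum_(i <- r) inner H (X i) v.
Proof. by rewrite /inner !mulmx_suml summxE. Qed.

Hypothesis HT : H^T = H.
Hypothesis Hpos : forall u, u != 0 -> 0 < inner H u u.

Lemma inner_nondegenerate u : (forall v, inner H u v = 0) -> u = 0.
Proof.
by move=> E; apply/eqP/negPn/negP => /Hpos; rewrite E ltxx.
Qed.

(** The vector <v,v> u - <u,v> v is nonzero by independence, and its squared norm is <v,v> times the
    Gram determinant. *)
Lemma cauchy_schwarz_free u v : row_free (col_mx u v) ->
  0 < inner H u u * inner H v v - inner H u v ^+ 2.
Proof.
move=> fr.
have nz a b : a *: u + b *: v = 0 -> a = 0 /\ b = 0.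
  move=> E; have : row_mx a%:M b%:M *m col_mx u v = 0 *m col_mx u v.
    by rewrite mul_row_col !mul_scalar_mx E mul0mx.
  move/(row_free_inj fr); rewrite -row_mx0 => /eq_row_mx[/matrixP/(_ 0 0) + /matrixP/(_ 0 0)].
  by rewrite !mxE !mulr1n.
have v0 : v != 0.
  apply/eqP => v0; have [|_ /eqP] := nz 0 1; first by rewrite v0 scaler0 scale0r addr0.
  by rewrite oner_eq0.
have vv := Hpos v0.
have w0 : inner H v v *: u + (- inner H u v) *: v != 0.
  by apply/eqP => /nz[/eqP]; rewrite gt_eqF.
have := Hpos w0; rewrite !(innerDl, innerDr, innerZl, innerZr) (inner_sym v u HT).
move=> Ew; rewrite -(pmulr_rgt0 _ vv); apply: lt_le_trans Ew _.
by rewrite le_eqVlt; apply/orP; left; apply/eqP; ring.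
Qed.

Lemma dependentP u v : ~~ row_free (col_mx u v) -> v = 0 \/ exists k, u = k *: v.
Proof.
rewrite -kermx_eq0 => /rowV0Pn[y /sub_kermxP E y0].
pose a := lsubmx y 0 0; pose b := rsubmx y 0 0.
have ab : a *: u + b *: v = 0.
  rewrite -mul_scalar_mx -[b *: v]mul_scalar_mx -[a%:M]mx11_scalar -[b%:M]mx11_scalar.
  by rewrite -mul_row_col hsubmxK.
have [a0|a0] := eqVneq a 0; last first.
  right; exists (- a^-1 * b); apply: (scalerI a0).
  rewrite scalerA mulrA mulrN divff // mulN1r scaleNr; apply/eqP.
  by rewrite -addr_eq0 ab.
left; move: ab; rewrite a0 scale0r add0r => /eqP; rewrite scaler_eq0 => /orP[/eqP b0|/eqP //].
case/eqP: y0; rewrite -[y]hsubmxK [lsubmx y]mx11_scalar [rsubmx y]mx11_scalar.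
by rewrite -/a -/b a0 b0 !raddf0 row_mx0.
Qed.

End InnerProduct.

(** Relabelling the triple sums cyclically gives all three the coefficient a_i b_j d_k, and the
    identity on basis vectors applies termwise. *)
Lemma bianchi_contraction (R : comNzRingType) n (r : 'I_n -> 'I_n -> 'M[R]_n) :
  (forall i j k, row k (r i j) + row i (r j k) + row j (r k i) = 0) ->
  forall a b d : 'rV[R]_n,
  \sum_i \sum_j (a 0 i * b 0 j) *: (d *m r i j)
  + \sum_i \sum_j (b 0 i * d 0 j) *: (a *m r i j)
  + \sum_i \sum_j (d 0 i * a 0 j) *: (b *m r i j) = 0.
Proof.
move=> r0 a b d.
have ex x y (t : 'rV_n) : \sum_i \sum_j (x i * y j) *: (t *m r i j) =
    \sum_i \sum_j \sum_k (x i * y j * t 0 k) *: row k (r i j).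
  apply: eq_bigr => i _; apply: eq_bigr => j _.
  by rewrite mulmx_sum_row scaler_sumr; apply: eq_bigr => k _; rewrite scalerA.
have rot (F : 'I_n -> 'I_n -> 'I_n -> 'rV[R]_n) :
    \sum_i \sum_j \sum_k F i j k = \sum_i \sum_j \sum_k F j k i.
  by rewrite [RHS]exchange_big /=; apply: eq_bigr => i _; rewrite [RHS]exchange_big.
rewrite !ex (rot (fun i j k => (b 0 i * d 0 j * a 0 k) *: row k (r i j))).
rewrite (rot (fun i j k => (d 0 i * a 0 j * b 0 k) *: row k (r i j))).
rewrite (rot (fun i j k => (d 0 j * a 0 k * b 0 i) *: row i (r j k))).
rewrite -!big_split big1 // => i _; rewrite -!big_split big1 // => j _.
rewrite -!big_split big1 // => k _ /=.
have -> : b 0 j * d 0 k * a 0 i = a 0 i * b 0 j * d 0 k by ring.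
have -> : d 0 k * a 0 i * b 0 j = a 0 i * b 0 j * d 0 k by ring.
by rewrite -!scalerDr r0 scaler0.
Qed.

Section ConstantSectional.
Variables (R : realType) (n : nat) (H : 'M[R]_n) (c : R).
Local Notation V := 'rV[R]_n.
Variable Rf : V -> V -> V -> V.
Hypothesis HT : H^T = H.
Hypothesis Hpos : forall u, u != 0 -> 0 < inner H u u.
Hypothesis c1 : forall a a' b d, Rf (a + a') b d = Rf a b d + Rf a' b d.
Hypothesis c2 : forall a b b' d, Rf a (b + b') d = Rf a b d + Rf a b' d.
Hypothesis c3 : forall a b d d', Rf a b (d + d') = Rf a b d + Rf a b d'.
Hypothesis cZ : forall k a b d, Rf (k *: a) b d = k *: Rf a b d.
Hypothesis c12 : forall a b d, Rf a b d = - Rf b a d.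
Hypothesis c34 : forall a b d e, inner H (Rf a b d) e = - inner H (Rf a b e) d.
Hypothesis cB : forall a b d, Rf a b d + Rf b d a + Rf d a b = 0.
Hypothesis sec : forall a b, row_free (col_mx a b) ->
  inner H (Rf a b b) a = c * (inner H a a * inner H b b - inner H a b ^+ 2).

(** [B] is the difference from the model curvature; it has the symmetries of a curvature tensor and
    zero sectional part, so [polarization] applies. *)
Lemma constant_sectional_curvature u v w :
  Rf u v w = c *: (inner H v w *: u - inner H u w *: v).
Proof.
have c20 a d : Rf a 0 d = 0.
  by apply: (addrI (Rf a 0 d)); rewrite -c2 !addr0.
pose B a b d e := inner H (Rf a b d) e
  - c * (inner H b d * inner H a e - inner H a d * inner H b e).
suff B0 e : B u v w e = 0.
  apply/eqP; rewrite -subr_eq0; apply/eqP.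
  apply: (inner_nondegenerate Hpos) => e.
  by rewrite !(innerDl, innerNl, innerZl); exact: B0.
apply: polarization => [a a' b d e'|a b b' d e'|a b d d' e'|a b d e' e''|
  a b d e'|a b d e'|a b d e'|a b].
- by rewrite /B c1 !innerDl; ring.
- by rewrite /B c2 !innerDl; ring.
- by rewrite /B c3 innerDl !innerDr; ring.
- by rewrite /B !innerDr; ring.
- by rewrite /B c12 innerNl; ring.
- by rewrite /B c34; ring.
- have := congr1 (fun X => inner H X e') (cB a b d).
  rewrite !innerDl [inner _ 0 _]/inner !mul0mx mxE /B.
  rewrite (inner_sym d b HT) (inner_sym d a HT) (inner_sym b a HT); lra.
(* [sec] speaks of independent pairs only; for dependent ones the curvature and the model term
   vanish separately. *)
have [fr|/dependentP[->|[k ->]]] := boolP (row_free (col_mx a b)).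
- by rewrite /B sec // (inner_sym b a HT); ring.
- by rewrite /B c20 /inner trmx0 !(mulmx0, mul0mx) !mxE; ring.
rewrite /B cZ.
have -> : Rf b b b = 0.
  by apply/eqP; have /eqP := c12 b b b; rewrite -addr_eq0 -mulr2n -scaler_nat scaler_eq0 pnatr_eq0.
by rewrite scaler0 {1}/inner !mul0mx mxE !innerZl !innerZr; ring.
Qed.

End ConstantSectional.

Section ConstantCurvature.
Variables (R : realType) (n : nat) (O : domain R n).
Local Notation V := 'rV[R]_n.
Local Notation K := (smfun O).
Local Notation D := (partials O).
Variables (h : V -> 'M[R]_n) (H Hi : 'M[K]_n) (c : R).
Hypotheses (hH : represents_mx h H) (HHi : H *m Hi = 1%:M) (HT : H^T = H).
Let hf : K := smfun_cst O 2^-1.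
Local Notation Gam := (koszul D hf H Hi).
Hypothesis hpos : forall z u, O z -> u != 0 -> 0 < inner (h z) u u.
Hypothesis hsec : forall z u v, O z -> row_free (col_mx u v) ->
  sectional_curvature h z u v = c.

Let met : metric_connection D Gam H := koszul_metric D (half_half O) HHi HT.
Let tor : forall i j, row i (Gam j) = row j (Gam i) := koszul_torsion D hf Hi HT.

Lemma constant_curvature_tensor z u v w : O z ->
  curvature h z u v w = c *: (inner (h z) v w *: u - inner (h z) u w *: v).
Proof.
move=> Oz; pose p : {x | O x} := exist _ z Oz.
pose r i j := evm p (curvmx D Gam i j).
have rE a b d : curvature h z a b d = \sum_i \sum_j (a 0 i * b 0 j) *: (d *m r i j).
  exact: (curvatureE hH HHi a b d p).
have hT : (h z)^T = h z by rewrite -[z]/(sval p) hH -evm_tr HT.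
have c1 a a' b d : curvature h z (a + a') b d =
    curvature h z a b d + curvature h z a' b d.
  rewrite !rE -big_split; apply: eq_bigr => i _; rewrite -big_split.
  by apply: eq_bigr => j _; rewrite mxE mulrDl scalerDl.
have c2 a b b' d : curvature h z a (b + b') d =
    curvature h z a b d + curvature h z a b' d.
  rewrite !rE -big_split; apply: eq_bigr => i _; rewrite -big_split.
  by apply: eq_bigr => j _; rewrite mxE mulrDr scalerDl.
have c3 a b d d' : curvature h z a b (d + d') =
    curvature h z a b d + curvature h z a b d'.
  rewrite !rE -big_split; apply: eq_bigr => i _; rewrite -big_split.
  by apply: eq_bigr => j _; rewrite mulmxDl scalerDr.
have cZ k a b d : curvature h z (k *: a) b d = k *: curvature h z a b d.
  rewrite !rE scaler_sumr; apply: eq_bigr => i _; rewrite scaler_sumr.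
  by apply: eq_bigr => j _; rewrite mxE scalerA mulrA.
have c12 a b d : curvature h z a b d = - curvature h z b a d.
  rewrite !rE exchange_big -sumrN; apply: eq_bigr => i _; rewrite -sumrN.
  by apply: eq_bigr => j _; rewrite /r (curvmx_anti _ _ j) evmN mulmxN scalerN mulrC.
have c34 a b d e : inner (h z) (curvature h z a b d) e =
    - inner (h z) (curvature h z a b e) d.
  rewrite !rE !inner_suml -sumrN; apply: eq_bigr => i _.
  rewrite !inner_suml -sumrN; apply: eq_bigr => j _.
  rewrite !innerZl -mulrN; congr (_ * _).
  rewrite inner_sym // /inner trmx_mul.
  have E : r i j *m h z = - (h z *m (r i j)^T).
    by rewrite /r -[z]/(sval p) hH -evmM (curvmx_skew _ _ met) evmN evmM evm_tr.
  by rewrite -[in RHS](mulmxA e) E mulmxN mulNmx oppmxE opprK !mulmxA.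
have cB a b d : curvature h z a b d + curvature h z b d a + curvature h z d a b = 0.
  rewrite !rE; apply: bianchi_contraction => i j k.
  by rewrite /r -!evm_row -!evmD curvmx_bianchi // /evm map_mx0.
apply: (constant_sectional_curvature hT _ c1 c2 c3 cZ c12 c34 cB) => [e|a b fr].
  exact: hpos.
have den := cauchy_schwarz_free hT (fun u => @hpos z u Oz) fr.
have := hsec Oz fr; rewrite /sectional_curvature => /(canRL (divfK _)) -> //.
by rewrite gt_eqF.
Qed.

Lemma constant_curvature_mx i j : curvmx D Gam i j =
  smfun_cst O c *: (col j H *m row i 1%:M - col i H *m row j 1%:M).
Proof.
apply: eval_mx_eq => p; apply/row_matrixP => k.
have := constant_curvature_tensor (dvec i) (dvec j) (dvec k) (svalP p).
rewrite (curvature_dvec hH HHi) => ->.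
have el a b : inner (h (sval p)) (dvec a) (dvec b) = smfun_eval p (H b a).
  rewrite /inner row_dvec trmx_delta -colE !mxE hH evmE.
  by rewrite -[in LHS]HT mxE.
apply/rowP => l; rewrite !el !mxE rmorphM rmorphB /= eval_cst !big_ord1 !mxE.
by rewrite !rmorphM !rmorph_nat !(eq_sym l); ring.
Qed.


End ConstantCurvature.

(** * Intrinsic quantities of the statement as values of ring elements *)

Section RiemannianTransfer.
Variables (R : realType) (n : nat) (O : domain R n).
Local Notation V := 'rV[R]_n.
Local Notation K := (smfun O).
Local Notation D := (partials O).
Variables (G : V -> 'M[R]_n) (g gi : 'M[K]_n).
Hypotheses (Gg : represents_mx G g) (ggi : g *m gi = 1%:M) (gT : g^T = g).
Let hf : K := smfun_cst O 2^-1.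
Local Notation Gam := (koszul D hf g gi).

Lemma metric_traceE (W : lmodType R) z (b : V -> V -> W) :
  metric_trace (G (sval z)) b =
  \sum_i \sum_j smfun_eval z (gi i j) *: b (dvec i) (dvec j).
Proof.
rewrite /metric_trace (represents_invmx Gg ggi).
by apply: eq_bigr => i _; apply: eq_bigr => j _; rewrite evmE.
Qed.

Lemma represents_derive_dvec u k i : represents (O := O) u k ->
  represents ('D_(dvec i) u) (D i k).
Proof. by move=> uk z; rewrite (represents_derive _ _ uk) (sum_dvec (W := R^o)). Qed.

Lemma represents_grad u k : represents u k ->
  represents_mx (grad G u) (gradr D gi k).
Proof.
move=> uk z; rewrite /grad /gradr (represents_invmx Gg ggi) evmM; congr (_ *m _).
by apply/rowP => i; rewrite evmE !mxE (represents_derive_dvec i uk).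
Qed.

Lemma represents_divergence X Y : represents_mx X Y ->
  represents (divergence G X) (divg D Gam Y).
Proof.
move=> XY z; rewrite /divergence /divg rmorph_sum /=; apply: eq_bigr => i _.
by rewrite (represents_covd Gg ggi i XY) evmE.
Qed.

Lemma represents_laplacian u k : represents u k ->
  represents (laplacian G u) (lapl D gi Gam k).
Proof.
move=> uk z; rewrite /laplacian (represents_divergence (represents_grad uk)).
by rewrite /lapl rmorphN.
Qed.

Lemma represents_inner X Y X' Y' : represents_mx X Y -> represents_mx X' Y' ->
  represents (fun y => inner (G y) (X y) (X' y)) (innr g Y Y').
Proof.
by move=> XY XY' z; rewrite /inner XY XY' Gg -evm_tr -!evmM evmE.
Qed.

Lemma represents_ricci : represents_mx (ricci G) (ricmx D gi Gam).
Proof.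
move=> z; apply/row_matrixP => i.
have -> : row i (ricci G (sval z)) =
    metric_trace (G (sval z)) (curvature G (sval z) (dvec i)).
  by apply/rowP => l; rewrite !mxE.
have E : row i (ricmx D gi Gam) =
    \sum_j \sum_k gi j k *: row k (curvmx D Gam i j).
  by apply/rowP => l; rewrite !mxE.
rewrite -evm_row E metric_traceE evm_sum; apply: eq_bigr => j _.
rewrite evm_sum; apply: eq_bigr => k _.
by rewrite evmZ (curvature_dvec Gg ggi) evm_row.
Qed.

Lemma represents_scalar_curvature :
  represents (scalar_curvature G) (\tr (ricmx D gi Gam)).
Proof.
move=> z; rewrite /scalar_curvature represents_ricci rmorph_sum /=.
by apply: eq_bigr => i _; rewrite evmE.
Qed.

Lemma represents_endo_normsq T Y : represents_mx T Y -> (Y *m g)^T = Y *m g ->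
  represents (fun y => endo_normsq (G y) (T y)) (\tr (Y *m Y)).
Proof.
move=> TY Ys z; rewrite /endo_normsq metric_traceE -(contract_inner ggi gT Y Ys).
rewrite rmorph_sum; apply: eq_bigr => i _; rewrite rmorph_sum; apply: eq_bigr => j _.
rewrite rmorphM /=; congr (_ * _); rewrite -evmE !evmM evm_tr TY Gg !row_dvec /inner.
exact: row_bilinear.
Qed.

Lemma covd_endo_dvec T Y i k z : represents_mx T Y ->
  covd_endo G (dvec i) T (dvec k) (sval z) = row k (evm z (covend D Gam i Y)).
Proof.
move=> TY; rewrite /covd_endo (covd_cst_dvec Gg ggi) TY.
have rT : represents_mx (fun y => dvec k *m T y) (row k Y).
  by move=> y; rewrite TY evm_row row_dvec.
rewrite (represents_covd Gg ggi i rT) -evmM -evmN -evmD -evm_row; congr (evm z _).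
by rewrite cov_row -rowM -rowN -rowD.
Qed.

(** The inner trace pairs two covariant derivatives of the tensor; it is the trace of their product
    since these are again self-adjoint by [covend_sym]. *)
Lemma covd_endo_normsqE T Y z : represents_mx T Y -> (Y *m g)^T = Y *m g ->
  covd_endo_normsq G T (sval z) = smfun_eval z
    (\sum_i \sum_j gi i j * \tr (covend D Gam i Y *m covend D Gam j Y)).
Proof.
move=> TY Ys; rewrite /covd_endo_normsq metric_traceE.
have met : metric_connection D Gam g := koszul_metric D (half_half O) ggi gT.
rewrite rmorph_sum; apply: eq_bigr => i _; rewrite rmorph_sum; apply: eq_bigr => j _.
rewrite rmorphM /=; congr (_ * _).
rewrite -(contract_inner ggi gT _ (covend_sym met j Ys)).
rewrite metric_traceE rmorph_sum; apply: eq_bigr => k _.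
rewrite rmorph_sum; apply: eq_bigr => l _.
rewrite rmorphM /=; congr (_ * _).
rewrite -evmE !evmM evm_tr !(covd_endo_dvec _ _ _ TY) /inner Gg.
exact: row_bilinear.
Qed.

Lemma inner_covd_endoE X Y T A z : represents_mx X Y -> represents_mx T A ->
  (A *m g)^T = A *m g ->
  inner_covd_endo G X T (sval z) = smfun_eval z (inner_cov D Gam A Y).
Proof.
move=> XY TA As; rewrite /inner_covd_endo metric_traceE /inner_cov.
rewrite -(contract_lower ggi gT (fun i => cov D Gam i Y) As).
rewrite rmorph_sum; apply: eq_bigr => i _; rewrite rmorph_sum; apply: eq_bigr => j _.
rewrite rmorphM /=; congr (_ * _).
rewrite -evmE !evmM evm_tr TA (represents_covd Gg ggi i XY) row_dvec /inner Gg.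
by rewrite [LHS]mul_row_tr.
Qed.

End RiemannianTransfer.

(* L, NS, ..., iT are the values at a point of the quantities of [lapl_stress2],
   written with t = tr A; here f = t / m and i = 1 / m. *)
Lemma mean_curvature_rescaling (k : numFieldType) (m c L NS t A2 A3 n l2 sg dR l4 Tg dT TT iT : k) :
  m != 0 ->
  L = - 2 * NS + 8 * (4 * c * t ^+ 4 - 4 * t ^+ 3 * A3
    - 4 * t ^+ 2 * A2 * (c * m - A2) + (m - 16) * t ^+ 2 * n
    + 4 * A2 * n + 2 * A2 * l2 + 4 * t * sg - 8 * dR
    - 4 * c * (m - 1) * l2 - 10 * t * Tg - 4 * t ^+ 2 * dT - 2 * TT
    + 4 * t * iT) + m * l4 ->
  let i := m^-1 in let f := i * t in
  2^-1 * (2^-1 * 2^-1 * L) =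
    - (2^-1 * 2^-1 * NS) + 4 * c * m ^+ 4 * f ^+ 4 - 4 * m ^+ 3 * f ^+ 3 * A3
    - 4 * m ^+ 2 * f ^+ 2 * A2 * (c * m - A2)
    + m ^+ 4 * (m - 16) * f ^+ 2 * (i ^+ 2 * n) + 4 * m ^+ 2 * A2 * (i ^+ 2 * n)
    + 2 * m ^+ 2 * A2 * (i ^+ 2 * l2) + 4 * m ^+ 2 * f * (i * sg)
    - 8 * m ^+ 2 * (i ^+ 2 * dR) + m ^+ 5 / 8 * (i ^+ 4 * l4)
    - 4 * c * m ^+ 2 * (m - 1) * (i ^+ 2 * l2) - 10 * m ^+ 2 * f * (i * Tg)
    - 4 * m ^+ 2 * f ^+ 2 * dT - 2 * TT + 4 * m * f * iT.
Proof. by move=> m0 -> /=; field. Qed.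

(** The quantities are variables so that pushing [e] inward stops at them; the result has the shape
    of the hypothesis of [mean_curvature_rescaling]. *)
Lemma stress2_rmorph (K k : comNzRingType) (e : {rmorphism K -> k}) (m : nat)
    (c NS t A2 A3 n l2 sg dR l4 Tg dT TT iT : K) :
  e (- 2 * NS + 8 * (4 * c * t ^+ 4 - 4 * t ^+ 3 * A3
    - 4 * t ^+ 2 * A2 * (c * m%:R - A2) + (m%:R - 16) * t ^+ 2 * n
    + 4 * A2 * n + 2 * A2 * l2 + 4 * t * sg - 8 * dR
    - 4 * c * (m%:R - 1) * l2 - 10 * t * Tg - 4 * t ^+ 2 * dT - 2 * TT
    + 4 * t * iT) + m%:R * l4) =
  - 2 * e NS + 8 * (4 * e c * e t ^+ 4 - 4 * e t ^+ 3 * e A3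
    - 4 * e t ^+ 2 * e A2 * (e c * m%:R - e A2) + (m%:R - 16) * e t ^+ 2 * e n
    + 4 * e A2 * e n + 2 * e A2 * e l2 + 4 * e t * e sg - 8 * e dR
    - 4 * e c * (m%:R - 1) * e l2 - 10 * e t * e Tg - 4 * e t ^+ 2 * e dT - 2 * e TT
    + 4 * e t * e iT) + m%:R * e l4.
Proof. by rewrite !(rmorphD, rmorphN, rmorphM, rmorphXn, rmorph_nat, rmorph1). Qed.

(** * Extrinsic quantities of the map, and the identity in a chart *)

Section MapTransfer.
Variables (R : realType) (m : nat).
Variables (O : domain R m) (O' : domain R m.+1).
Local Notation V := 'rV[R]_m.
Local Notation W := 'rV[R]_m.+1.
Local Notation K := (smfun O).
Local Notation K' := (smfun O').
Local Notation D := (partials O).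
Local Notation D' := (partials O').
Variables (G : V -> 'M[R]_m) (g gi : 'M[K]_m).
Hypotheses (Gg : represents_mx G g) (ggi : g *m gi = 1%:M) (gT : g^T = g).
Variables (h : W -> 'M[R]_m.+1) (H' Hi' : 'M[K']_m.+1).
Hypotheses (hH : represents_mx h H') (HHi : H' *m Hi' = 1%:M) (HT' : H'^T = H').
Variables (F : V -> W) (sF : smooth_on (dom_set O) F) (OF : forall x, O x -> O' (F x)).
Local Notation Gam := (koszul D (smfun_cst O 2^-1) g gi).
Local Notation Gam' := (koszul D' (smfun_cst O' 2^-1) H' Hi').
Local Notation pb := (smfun_pull_rmorphism sF OF).
Local Notation J := (frame_mx sF).
Local Notation H := (map_mx pb H').
Local Notation The := (pullback_connection pb J Gam').
Variables (eta : V -> W) (nu : 'rV[K]_m.+1) (c : R).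
Hypothesis etanu : represents_mx eta nu.
Hypothesis isom : forall x, O x -> forall u v,
  inner (G x) u v = inner (h (F x)) ('D_u F x) ('D_v F x).
Hypothesis eta_unit : forall x, O x -> inner (h (F x)) (eta x) (eta x) = 1.
Hypothesis eta_normal : forall x, O x -> forall u,
  inner (h (F x)) (eta x) ('D_u F x) = 0.
Hypothesis hpos : forall z u, O' z -> u != 0 -> 0 < inner (h z) u u.
Hypothesis hsec : forall z u v, O' z -> row_free (col_mx u v) ->
  sectional_curvature h z u v = c.

Definition image_pt (z : {x | O x}) : {y | O' y} := exist _ (F (sval z)) (OF (svalP z)).

Lemma eval_image z k : smfun_eval (image_pt z) k = smfun_eval z (pb k).
Proof. exact: esym (smfun_pullE sF OF k (svalP z)). Qed.

Lemma evm_image z p q (X : 'M[K']_(p, q)) : evm (image_pt z) X = evm z (map_mx pb X).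
Proof. by apply/matrixP => i j; rewrite !mxE eval_image. Qed.

Lemma represents_metric_along : represents_mx (fun x => h (F x)) H.
Proof. by move=> z; rewrite -[F _]/(sval (image_pt z)) hH evm_image. Qed.

Lemma derive_mapE v z : 'D_v F (sval z) = v *m evm z J.
Proof.
have dF : differentiable F (sval z) by exact: smooth_on_differentiable (svalP z).
rewrite deriveE // {1}[v]row_sum_delta linear_sum mulmx_sum_row.
apply: eq_bigr => i _; rewrite linearZ /= -deriveE //; congr (_ *: _).
by apply/rowP => a; rewrite mxE evmE /smfun_eval (frame_mxE _ _ _ (svalP z)).
Qed.

Lemma represents_frame j : represents_mx ('D_(dvec j) F) (row j J).
Proof. by move=> z; rewrite derive_mapE row_dvec evm_row. Qed.

Lemma covd_alongE v X Y z : represents_mx (O := O) X Y ->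
  covd_along h F v X (sval z) = \sum_i v 0 i *: evm z (cov D The i Y).
Proof.
move=> XY; rewrite /covd_along (represents_mx_derive _ _ XY).
rewrite -[F (sval z)]/(sval (image_pt z)) (christoffelE hH HHi) /=.
rewrite derive_mapE XY.
have -> : \sum_a (v *m evm z J) 0 a *: (evm z Y *m evm (image_pt z) (Gam' a)) =
    \sum_i v 0 i *: evm z (Y *m The i).
  under eq_bigr => a _ do rewrite mxE scaler_suml.
  rewrite exchange_big; apply: eq_bigr => i _ /=.
  rewrite /pullback_connection mulmx_sumr evm_sum scaler_sumr; apply: eq_bigr => a _.
  by rewrite evm_image mulmxZr evmZ -evmM evmE scalerA.
by rewrite -big_split; apply: eq_bigr => i _; rewrite /= -scalerDr -evmD.
Qed.

Lemma represents_covd_along i X Y : represents_mx X Y ->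
  represents_mx (covd_along h F (dvec i) X) (cov D The i Y).
Proof. by move=> XY z; rewrite (covd_alongE _ _ XY) sum_dvec. Qed.

Lemma represents_second_form i j :
  represents_mx (fun x => second_form G h F x (dvec i) (dvec j))
    (row j (sff D Gam The J i)).
Proof.
move=> z; rewrite /second_form (represents_covd_along i (represents_frame j)).
rewrite (covd_cst_dvec Gg ggi) derive_mapE -evmM -evmN -evmD.
by rewrite cov_row -rowM -rowN -rowD.
Qed.

Lemma two_regular (k : K) : k + k = 0 -> k = 0.
Proof.
by move=> k0; rewrite -[k]mul1r -(half_half O) mulrDl -mulrDr k0 mulr0.
Qed.

Lemma map_isometry : J *m H *m J^T = g.
Proof.
apply: eval_mx_eq => z; apply/matrixP => i j.
have := isom (svalP z) (dvec i) (dvec j).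
rewrite !represents_frame (represents_metric_along z) Gg /inner row_dvec !evm_row.
rewrite row_bilinear => E; rewrite -!/(evm z _) !evmM evm_tr -E.
by rewrite trmx_delta -colE !mxE.
Qed.

Lemma map_unit : nu *m H *m nu^T = 1%:M.
Proof.
apply: eval_mx_eq => z; rewrite -!/(evm z _) !evmM evm_tr evm1.
have := eta_unit (svalP z); rewrite etanu (represents_metric_along z) /inner => E.
by apply/matrixP => i j; rewrite !ord1 E mxE eqxx.
Qed.

Lemma map_normal : nu *m H *m J^T = 0.
Proof.
apply: eval_mx_eq => z; rewrite -!/(evm z _) !evmM evm_tr.
apply/matrixP => i j; rewrite !ord1.
have := eta_normal (svalP z) (dvec j).
rewrite etanu (represents_metric_along z) /inner represents_frame evm_row mul_row_tr => ->.
by rewrite !mxE rmorph0.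
Qed.

Lemma metric_along_sym : H^T = H.
Proof. by rewrite map_trmx HT'. Qed.

Lemma levi_civita_metric : metric_connection D Gam g.
Proof. exact (koszul_metric D (half_half O) ggi gT). Qed.

Lemma levi_civita_torsion i j : row i (Gam j) = row j (Gam i).
Proof. exact: (koszul_torsion D _ gi gT i j). Qed.

Lemma along_metric : metric_connection D The H.
Proof.
apply: pullback_metric; last exact (koszul_metric D' (half_half O') HHi HT').
exact: smfun_pull_chain.
Qed.

Lemma along_torsion i j : row i (cov D The j J) = row j (cov D The i J).
Proof.
apply: pullback_torsion => [k l a|a b]; first exact: frame_mx_closed.
exact: (koszul_torsion D' _ Hi' HT' a b).
Qed.

Lemma pull_cst r : pb (smfun_cst O' r) = smfun_cst O r.
Proof. by apply: eval_eq => z; rewrite -eval_image !eval_cst. Qed.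

Lemma along_curvature i j : J *m curvmx D The i j =
  smfun_cst O c *: (col j g *m row i 1%:M - col i g *m row j 1%:M) *m J.
Proof.
rewrite -pull_cst.
exact (pullback_constant_curvature (pb := pb) (smfun_pull_chain sF OF) (frame_mx_closed sF)
  (constant_curvature_mx hH HHi HT' hpos hsec) map_isometry i j).
Qed.

Local Notation A := (shape_mx D gi Gam H The J nu).
Local Notation t := (\tr A).

Lemma represents_shape : represents_mx (shape_operator G h F eta) A.
Proof.
move=> z; rewrite /shape_operator /endo_of_form (represents_invmx Gg ggi).
rewrite /shape_mx evmM; congr (_ *m _); apply/matrixP => i j.
rewrite mxE (represents_second_form i j) (represents_metric_along z) etanu /inner.
rewrite -evm_tr -!evmM !evmE; congr (smfun_eval z _).
by rewrite -!rowM [LHS]mxE [RHS]mxE.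
Qed.

Lemma represents_tension : represents_mx (tension G h F) (t *: nu).
Proof.
move=> z; rewrite /tension (metric_traceE Gg ggi).
rewrite -(trace_sff two_regular ggi levi_civita_metric levi_civita_torsion
  metric_along_sym along_metric map_isometry map_unit map_normal along_torsion).
rewrite evm_sum; apply: eq_bigr => i _; rewrite evm_sum; apply: eq_bigr => j _.
by rewrite evmZ represents_second_form.
Qed.

Let frame_cov := frame_cov_mean_curvature two_regular ggi gT levi_civita_metric
  levi_civita_torsion metric_along_sym along_metric map_isometry map_unit map_normal
  along_torsion.
Let A_sym : (A *m g)^T = A *m g :=
  shape_sym ggi levi_civita_torsion H nu along_torsion.

Lemma represents_tangent_part X Y : represents_mx X Y ->
  represents_mx (tangent_part G h F X) (Y *m H *m J^T *m gi).
Proof.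
move=> XY z; rewrite /tangent_part (represents_invmx Gg ggi) evmM; congr (_ *m _).
apply/rowP => i; rewrite mxE represents_frame (represents_metric_along z) XY /inner.
by rewrite evm_row mul_row_tr -evm_tr -!evmM.
Qed.

(** For tau = t eta one has |tau|^2 = t^2 and <dphi, nabla tau> = -t^2, so the form is (t^2/2 - t^2)
    g + 2t <A ., .>. *)
Lemma represents_stress_energy :
  represents_mx (stress_energy G h F) (smfun_cst O 2^-1 *: stress2 A).
Proof.
move=> z; rewrite /stress_energy /endo_of_form (represents_invmx Gg ggi).
have -> : smfun_cst O 2^-1 *: stress2 A =
    smfun_cst O 2^-1 *: (stress2 A *m g) *m gi.
  by rewrite mulmxZl -mulmxA ggi mulmx1.
rewrite evmM; congr (_ *m _); apply/matrixP => i j.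
have fc k l : inner (h (F (sval z))) ('D_(dvec k) F (sval z))
    (covd_along h F (dvec l) (tension G h F) (sval z)) =
    - (smfun_eval z t * smfun_eval z ((A *m g) k l)).
  rewrite represents_frame (represents_covd_along l represents_tension).
  rewrite (represents_metric_along z) /inner -evm_tr -!evmM evmE.
  by rewrite frame_cov rmorphN rmorphM.
have tt : inner (h (F (sval z))) (tension G h F (sval z)) (tension G h F (sval z)) =
    smfun_eval z t ^+ 2.
  rewrite represents_tension (represents_metric_along z) /inner -evm_tr -!evmM evmE.
  rewrite trmxZ !mulmxZl mulmxZr map_unit scalerA !mxE mulr1n mulr1.
  by rewrite rmorphM expr2.
have gE : inner (G (sval z)) (dvec i) (dvec j) = smfun_eval z (g i j).
  by rewrite Gg /inner row_dvec trmx_delta -colE !mxE.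
have tr : metric_trace (G (sval z)) (fun w u => inner (h (F (sval z)))
    ('D_w F (sval z)) (covd_along h F u (tension G h F) (sval z))) =
    - (smfun_eval z t * smfun_eval z t).
  rewrite (metric_traceE Gg ggi).
  have E := contract_inner ggi gT A (Y := 1%:M).
  rewrite trmx1 !mulmx1 mul1mx gT in E.
  have Et : smfun_eval z t = \sum_k \sum_l
      smfun_eval z (gi k l) * smfun_eval z ((A *m g) k l).
    rewrite -[in LHS](E erefl) rmorph_sum; apply: eq_bigr => k _.
    by rewrite rmorph_sum; apply: eq_bigr => l _; rewrite rmorphM.
  rewrite [X in - (_ * X)]Et mulr_sumr -sumrN; apply: eq_bigr => k _.
  rewrite mulr_sumr -sumrN; apply: eq_bigr => l _.
  by rewrite fc [LHS]mulrN mulrCA.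
rewrite mxE /stress_energy_form (fc i j) (fc j i) tt gE tr evmZ scalemxE eval_cst evmE.
have -> : (A *m g) j i = (A *m g) i j by rewrite -[in LHS]A_sym mxE.
rewrite /stress2 mulmxDl mul_scalar_mx mulmxZl addmxE !scalemxE.
rewrite rmorphD rmorphM rmorphN rmorphXn rmorphM rmorphM rmorph_nat /=.
move: (smfun_eval z t) (smfun_eval z (g i j)) (smfun_eval z ((A *m g) i j)) => T a b.
by field.
Qed.

Lemma represents_rough_laplacian :
  represents_mx (rough_laplacian G h F (tension G h F))
    (- \sum_i \sum_j gi i j *: (cov D The i (cov D The j (t *: nu))
      - \sum_k Gam i j k *: cov D The k (t *: nu))).
Proof.
move=> z; rewrite /rough_laplacian evmN (metric_traceE Gg ggi); congr (- _).
rewrite evm_sum; apply: eq_bigr => i _; rewrite evm_sum; apply: eq_bigr => j _.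
rewrite evmZ; congr (_ *: _).
rewrite (represents_covd_along i (represents_covd_along j represents_tension)).
have -> : covd_along h F (covd G (dvec i) (cst (dvec j)) (sval z)) (tension G h F)
    (sval z) = evm z (\sum_k Gam i j k *: cov D The k (t *: nu)).
  rewrite (covd_alongE _ z represents_tension) evm_sum; apply: eq_bigr => k _.
  by rewrite evmZ (covd_cst_dvec Gg ggi) evm_row mxE evmE.
by rewrite -evmN -evmD.
Qed.

Lemma tension_tangent_part (z : {x | O x}) i :
  inner (h (F (sval z))) (tension G h F (sval z)) ('D_(dvec i) F (sval z)) = 0.
Proof.
rewrite represents_tension represents_frame (represents_metric_along z) /inner.
rewrite evm_row mul_row_tr -evm_tr -!evmM evmE !mulmxZl map_normal scaler0.
by rewrite mxE rmorph0.
Qed.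

(** As tau is normal, R^N(dF u, tau) dF v = -c <dF u, dF v> tau in a space form. The curvature term
    is therefore normal, and the rough Laplacian alone contributes. *)
Lemma represents_tangent_bitension :
  represents_mx (tangent_part G h F (bitension G h F)) (tanbit D gi A).
Proof.
move=> z.
have metT := metric_along_sym.
rewrite -(tangent_bitension two_regular ggi gT levi_civita_metric levi_civita_torsion
  metT along_metric map_isometry map_unit map_normal along_torsion along_curvature).
rewrite /tangent_proj -(represents_tangent_part (X := fun x =>
  - rough_laplacian G h F (tension G h F) x)) => [|z']; last first.
  by rewrite represents_rough_laplacian evmN opprK.
rewrite /tangent_part; congr (_ *m _); apply/rowP => i; rewrite !mxE.
rewrite /bitension innerDl (innerNl _ (metric_trace _ _)).
suff -> : inner (h (F (sval z))) (metric_trace (G (sval z)) (fun u v =>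
    curvature h (F (sval z)) ('D_u F (sval z)) (tension G h F (sval z))
      ('D_v F (sval z)))) ('D_(dvec i) F (sval z)) = 0 by rewrite subr0.
rewrite (metric_traceE Gg ggi) inner_suml big1 // => k _.
rewrite inner_suml big1 // => l _; rewrite innerZl.
rewrite (constant_curvature_tensor hH HHi HT' hpos hsec _ _ _ (OF (svalP z))).
rewrite tension_tangent_part scale0r sub0r scalerN -scaleNr !innerZl.
by rewrite tension_tangent_part !mulr0.
Qed.

Local Notation mi := (smfun_cst O m%:R^-1).
Local Notation f := (mi * t).

Lemma represents_mean_curvature : represents (mean_curvature G h F eta) f.
Proof.
move=> z; rewrite /mean_curvature represents_shape rmorphM /= eval_cst; congr (_ * _).
by rewrite rmorph_sum; apply: eq_bigr => i _; rewrite evmE.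
Qed.

Lemma der_cst r i : D i (smfun_cst O r) = 0.
Proof. exact: smfun_der_cst. Qed.

Lemma represents_exp u k n : represents (O := O) u k ->
  represents (fun y => u y ^+ n) (k ^+ n).
Proof. by move=> uk z; rewrite uk rmorphXn. Qed.

(** [lapl_stress2] evaluated at [z]. Each quantity of the statement is replaced by the value of its
    representative, with the power of 1/m due to its degree in f pulled out, as
    [mean_curvature_rescaling] expects. *)
Theorem stress_energy_identity (z : {x | O x}) (m_gt0 : (0 < m)%N) (x := sval z)
    (AA := shape_operator G h F eta) (ff := mean_curvature G h F eta)
    (S2 := stress_energy G h F) (T := tangent_part G h F (bitension G h F)) :
  2^-1 * laplacian G (fun y => endo_normsq (G y) (S2 y)) x =
    - covd_endo_normsq G S2 x
    + 4 * c * m%:R ^+ 4 * ff x ^+ 4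
    - 4 * m%:R ^+ 3 * ff x ^+ 3 * \tr (AA x *m AA x *m AA x)
    - 4 * m%:R ^+ 2 * ff x ^+ 2 * \tr (AA x *m AA x) * (c * m%:R - \tr (AA x *m AA x))
    + m%:R ^+ 4 * (m%:R - 16) * ff x ^+ 2 * inner (G x) (grad G ff x) (grad G ff x)
    + 4 * m%:R ^+ 2 * \tr (AA x *m AA x) * inner (G x) (grad G ff x) (grad G ff x)
    + 2 * m%:R ^+ 2 * \tr (AA x *m AA x) * laplacian G (fun y => ff y ^+ 2) x
    + 4 * m%:R ^+ 2 * ff x *
        inner (G x) (grad G (scalar_curvature G) x) (grad G ff x)
    - 8 * m%:R ^+ 2 * divergence G (fun y => ff y *: (grad G ff y *m ricci G y)) x
    + m%:R ^+ 5 / 8 * laplacian G (fun y => ff y ^+ 4) x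
    - 4 * c * m%:R ^+ 2 * (m%:R - 1) * laplacian G (fun y => ff y ^+ 2) x
    - 10 * m%:R ^+ 2 * ff x * inner (G x) (T x) (grad G ff x)
    - 4 * m%:R ^+ 2 * ff x ^+ 2 * divergence G T x
    - 2 * inner (G x) (T x) (T x)
    + 4 * m%:R * ff x * inner_covd_endo G T AA x.
Proof.
have fr := represents_mean_curvature.
have gr : gradr D gi f = mi *: gradr D gi t by apply: gradr_cst; exact: der_cst.
have Tr := represents_tangent_bitension.
have Ssym : (smfun_cst O 2^-1 *: stress2 A *m g)^T = smfun_cst O 2^-1 *: stress2 A *m g.
  by rewrite mulmxZl trmxZ (stress2_sym gT A_sym).
have rg := represents_grad Gg ggi fr.
have rs := represents_grad Gg ggi (represents_scalar_curvature Gg ggi).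
have rRic : represents_mx (fun y => ff y *: (grad G ff y *m ricci G y))
    (f *: (gradr D gi f *m ricmx D gi Gam)).
  by move=> z'; rewrite evmZ evmM -rg -(represents_ricci Gg ggi) -fr.
have trE p (X : 'M[K]_p) : \tr (evm z X) = smfun_eval z (\tr X).
  by rewrite rmorph_sum; apply: eq_bigr => i _; rewrite evmE.
have hf0 i : D i (smfun_cst O 2^-1) = 0 by exact: der_cst.
have mi0 i : D i mi = 0 by exact: der_cst.
have l2 := lapl_exp_cst Gam ggi t 2 mi0.
have l4 := lapl_exp_cst Gam ggi t 4 mi0.
have dRic := divg_gradr_cst Gam ggi t (ricmx D gi Gam) mi0.
have LE := lapl_normsq_cst Gam ggi (stress2 A) hf0.
have main := lapl_stress2 ggi gT levi_civita_metric levi_civita_torsion A_sym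
  (codazzi_equation two_regular ggi levi_civita_metric levi_civita_torsion
    metric_along_sym along_metric map_isometry map_unit map_normal along_torsion
    along_curvature)
  (gauss_equation two_regular ggi levi_civita_metric levi_civita_torsion
    metric_along_sym along_metric map_isometry map_unit map_normal along_torsion
    along_curvature)
  (der_cst c).
have := etrans (congr1 (smfun_eval z) main) (stress2_rmorph _ _ _ _ _ _ _ _ _ _ _ _ _ _ _ _).
rewrite /= eval_cst => /(mean_curvature_rescaling _) E.
have m0 : m%:R != 0 :> R by rewrite pnatr_eq0 -lt0n.
have {}E := E m0.
have evM a b : smfun_eval z (a * b) = smfun_eval z a * smfun_eval z b.
  exact: rmorphM.
have evmi k a : smfun_eval z (mi ^+ k * a) = m%:R^-1 ^+ k * smfun_eval z a.
  by rewrite evM rmorphXn /= eval_cst.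
have ig X : innr g X (gradr D gi f) = mi * innr g X (gradr D gi t).
  by rewrite gr (innrZr gT).
have ev1 a : smfun_eval z (mi * a) = m%:R^-1 * smfun_eval z a.
  by rewrite evM eval_cst.
have evhf a : smfun_eval z (smfun_cst O 2^-1 * smfun_cst O 2^-1 * a) =
    2^-1 * 2^-1 * smfun_eval z a.
  by rewrite evM evM eval_cst.
have SE := contract_covend_cst gi Gam (stress2 A) hf0.
have LE' : laplacian G (fun y => endo_normsq (G y) (S2 y)) x =
    2^-1 * 2^-1 * smfun_eval z (lapl D gi Gam (\tr (stress2 A *m stress2 A))).
  rewrite /x (represents_laplacian Gg ggi (represents_endo_normsq Gg ggi gT
    represents_stress_energy Ssym)).
  by rewrite LE evhf.
have NE : covd_endo_normsq G S2 x = 2^-1 * 2^-1 * smfun_eval z (\sum_i \sum_j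
    gi i j * \tr (covend D Gam i (stress2 A) *m covend D Gam j (stress2 A))).
  rewrite /x (covd_endo_normsqE Gg ggi gT z represents_stress_energy Ssym).
  exact: etrans (congr1 (smfun_eval z) SE) (evhf _).
have fE : ff x = m%:R^-1 * smfun_eval z t by exact: etrans (fr z) (ev1 _).
have A2E : \tr (AA x *m AA x) = smfun_eval z (\tr (A *m A)).
  by rewrite /x /AA represents_shape -evmM trE.
have A3E : \tr (AA x *m AA x *m AA x) = smfun_eval z (\tr (A *m A *m A)).
  by rewrite /x /AA represents_shape -evmM -evmM trE.
have nE : inner (G x) (grad G ff x) (grad G ff x) =
    m%:R^-1 ^+ 2 * smfun_eval z (innr g (gradr D gi t) (gradr D gi t)).
  by rewrite (represents_inner Gg rg rg z) gr innrZl (innrZr gT) mulrA -expr2 evmi.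
have l2E : laplacian G (fun y => ff y ^+ 2) x =
    m%:R^-1 ^+ 2 * smfun_eval z (lapl D gi Gam (t ^+ 2)).
  exact: etrans (represents_laplacian Gg ggi (represents_exp 2 fr) z)
    (etrans (congr1 (smfun_eval z) l2) (evmi 2 _)).
have l4E : laplacian G (fun y => ff y ^+ 4) x =
    m%:R^-1 ^+ 4 * smfun_eval z (lapl D gi Gam (t ^+ 4)).
  exact: etrans (represents_laplacian Gg ggi (represents_exp 4 fr) z)
    (etrans (congr1 (smfun_eval z) l4) (evmi 4 _)).
have sE : inner (G x) (grad G (scalar_curvature G) x) (grad G ff x) =
    m%:R^-1 * smfun_eval z (innr g (gradr D gi (\tr (ricmx D gi Gam))) (gradr D gi t)).
  exact: etrans (represents_inner Gg rs rg z) (etrans (congr1 (smfun_eval z) (ig _)) (ev1 _)).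
have dRE : divergence G (fun y => ff y *: (grad G ff y *m ricci G y)) x =
    m%:R^-1 ^+ 2 * smfun_eval z (divg D Gam (t *: (gradr D gi t *m ricmx D gi Gam))).
  exact: etrans (represents_divergence Gg ggi rRic z)
    (etrans (congr1 (smfun_eval z) dRic) (evmi 2 _)).
have TgE : inner (G x) (T x) (grad G ff x) =
    m%:R^-1 * smfun_eval z (innr g (tanbit D gi A) (gradr D gi t)).
  exact: etrans (represents_inner Gg Tr rg z) (etrans (congr1 (smfun_eval z) (ig _)) (ev1 _)).
have dTE : divergence G T x = smfun_eval z (divg D Gam (tanbit D gi A)).
  exact: (represents_divergence Gg ggi Tr z).
have TTE : inner (G x) (T x) (T x) =
    smfun_eval z (innr g (tanbit D gi A) (tanbit D gi A)).
  exact: (represents_inner Gg Tr Tr z).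
have iTE : inner_covd_endo G T AA x =
    smfun_eval z (inner_cov D Gam A (tanbit D gi A)).
  exact: (inner_covd_endoE Gg ggi gT z Tr represents_shape A_sym).
rewrite LE' NE A2E A3E nE l2E l4E sE dRE TgE dTE TTE iTE fE.
exact: E.
Qed.

End MapTransfer.

(** * Smooth inverse of the metric, open chart images, and the final assembly *)

Section InverseGram.
Variables (R : realType) (n : nat) (O : domain R n).

Lemma posdef_unitmx k (H : 'M[R]_k) :
  (forall u : 'rV_k, u != 0 -> 0 < inner H u u) -> H \in unitmx.
Proof.
move=> Hpos; rewrite -row_free_unit -kermx_eq0; apply/negPn/negP => /rowV0Pn[u].
move=> /sub_kermxP uH u0; have := Hpos u u0.
by rewrite /inner uH mul0mx mxE ltxx.
Qed.

(** Cramer's rule: the adjugate has entries in the ring, and the determinant, nonzero at every point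
    of [O], has a smooth reciprocal. *)
Lemma represents_inverse k (G : 'rV[R]_n -> 'M[R]_k) (g : 'M[smfun O]_k) :
  represents_mx G g -> (forall x, O x -> G x \in unitmx) ->
  exists gi, g *m gi = 1%:M.
Proof.
move=> Gg Gu.
have detE (z : {x | O x}) : smfun_eval z (\det g) = \det (G (sval z)).
  by rewrite Gg /evm det_map_mx.
have det0 x : O x -> (\det g : 'rV[R]_n -> R) x != 0.
  move=> Ox; rewrite -[X in X != 0]/(smfun_eval (exist _ x Ox) (\det g)) detE.
  by rewrite -unitfE -[_ \is a _]/(_ \in unitmx) Gu.
pose d := smfun_of (smooth_onV (dom_open O) det0 (smfun_smooth (\det g))).
exists (d *: \adj g); rewrite mulmxZr mul_mx_adj scale_scalar_mx.
congr (_%:M); apply: smfun_eq => x Ox.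
rewrite smfun_mulE // smfun_ofE // mulVf ?det0 //.
by rewrite smfun_cstE.
Qed.

End InverseGram.

(** [chart_param] is continuous on the open image of the chart, and within it the image of [U] is
    the preimage of [U] under that map. *)
Lemma chart_image_open (R : realType) (m : nat) (M : manifold R m) (a : chart M)
    (U : set M) : open U -> U `<=` chart_dom a -> open (chart_coord a @` U).
Proof.
move=> Uo Ua; rewrite openE => _ [p Up <-].
have Ip : chart_im a (chart_coord a p) by exists p => //; exact: Ua.
have im_n : \forall y \near chart_coord a p, chart_im a y.
  by apply: open_nbhs_nbhs; split => //; exact: chart_im_open.
have par_n : \forall y \near chart_coord a p, U (chart_param a y).
  apply: (chart_param_continuous Ip); rewrite chart_coordK; last exact: Ua.
  exact: open_nbhs_nbhs.
apply: filterS (filterI im_n par_n) => y [[q qa <-]] /=.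
by rewrite chart_coordK // => Uq; exists q.
Qed.

Theorem proposition3p1 (R : realType) (m : nat) (m_gt0 : (0 < m)%N) (c : R)
    (M : riemannian_manifold R m) (N : riemannian_manifold R m.+1)
    (hN : constant_curvature N c)
    (phi : M -> N) (hphi : isometric_immersion phi)
    (a : chart M) (b : chart N) (U : set M) (eta : 'rV[R]_m -> 'rV[R]_m.+1)
    (heta : local_unit_normal phi a b U eta)
    (p : M) (Up : U p) :
  let x := chart_coord a p in
  let g := gram a in
  let h := gram b in
  let F := local_map phi a b in
  let A := shape_operator g h F eta in
  let f := mean_curvature g h F eta in
  let s := scalar_curvature g in
  let S2 := stress_energy g h F in
  let T := tangent_part g h F (bitension g h F) in
  let A2 := \tr (A x *m A x) in
  let A3 := \tr (A x *m A x *m A x) in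
  let normsq v := inner (g x) v v in
  2^-1 * laplacian g (fun y => endo_normsq (g y) (S2 y)) x =
    - covd_endo_normsq g S2 x
    + 4 * c * m%:R ^+ 4 * f x ^+ 4
    - 4 * m%:R ^+ 3 * f x ^+ 3 * A3
    - 4 * m%:R ^+ 2 * f x ^+ 2 * A2 * (c * m%:R - A2)
    + m%:R ^+ 4 * (m%:R - 16) * f x ^+ 2 * normsq (grad g f x)
    + 4 * m%:R ^+ 2 * A2 * normsq (grad g f x)
    + 2 * m%:R ^+ 2 * A2 * laplacian g (fun y => f y ^+ 2) x
    + 4 * m%:R ^+ 2 * f x * inner (g x) (grad g s x) (grad g f x)
    - 8 * m%:R ^+ 2 * divergence g (fun y => f y *: (grad g f y *m ricci g y)) x
    + m%:R ^+ 5 / 8 * laplacian g (fun y => f y ^+ 4) x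
    - 4 * c * m%:R ^+ 2 * (m%:R - 1) * laplacian g (fun y => f y ^+ 2) x
    - 10 * m%:R ^+ 2 * f x * inner (g x) (T x) (grad g f x)
    - 4 * m%:R ^+ 2 * f x ^+ 2 * divergence g T x
    - 2 * normsq (T x)
    + 4 * m%:R * f x * inner_covd_endo g T A x.
Proof.
move=> x g h F A f s S2 T A2 A3 normsq.
have [Uo Ua Ub seta neta] := heta; have [[_ sphi] iphi] := hphi.
have sub1 y : (chart_coord a @` U) y -> chart_im a y.
  by move=> [q Uq <-]; exists q => //; exact: Ua.
have sub2 y : (chart_coord a @` U) y -> local_map_dom phi a b y.
  move=> [q Uq <-]; split; first by exists q => //; exact: Ua.
  by rewrite chart_coordK; [apply: Ub; exists q|exact: Ua].
have sub3 y : (chart_coord a @` U) y -> chart_im b (F y).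
  by move=> /sub2[_ db]; exists (phi (chart_param a y)).
have Ox : (chart_coord a @` U) x by exists p.
(* On the side of [M] the domain is the image of [U], where eta is smooth and [phi] lands in the
   chart [b]; on the side of [N] it is the whole image of that chart. *)
pose O : domain R m := @Domain R m (chart_coord a @` U) (chart_image_open Uo Ua)
  (ex_intro _ x Ox).
pose O' : domain R m.+1 := @Domain R m.+1 (chart_im b) (chart_im_open (a := b))
  (ex_intro _ (F x) (sub3 x Ox)).
have sG : smooth_on (dom_set O) g by exact: (smooth_onS sub1 (@gram_smooth _ _ M a)).
have sH : smooth_on (dom_set O') h by exact: (@gram_smooth _ _ N b).
have sF : smooth_on (dom_set O) F by exact: (smooth_onS sub2 (sphi a b)).
have [gk Gg] := represents_mx_of sG.
have [hk Hh] := represents_mx_of sH.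
have [nu etanu] := represents_mx_of (O := O) seta.
have [gi ggi] : exists gi, gk *m gi = 1%:M.
  apply: (represents_inverse Gg) => y /sub1 Iy.
  by apply: posdef_unitmx => u; exact: gram_pos.
have [hi hhi] : exists hi, hk *m hi = 1%:M.
  apply: (represents_inverse Hh) => y Iy.
  by apply: posdef_unitmx => u; exact: gram_pos.
have gT : gk^T = gk.
  apply: eval_mx_eq => z; rewrite -!/(evm z _) evm_tr -Gg.
  by apply: gram_sym; apply: sub1; exact: svalP.
have hT : hk^T = hk.
  apply: eval_mx_eq => z; rewrite -!/(evm z _) evm_tr -Hh.
  by apply: gram_sym; exact: svalP.
apply: (@stress_energy_identity R m O O' g gk gi Gg ggi gT h hk hi Hh hhi hT F sF sub3
  eta nu c etanu _ _ _ _ _ (exist _ x Ox) m_gt0) => [y Oy|y Oy|y Oy|y u|y u v].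
- by move=> u v; apply: iphi; exact: sub2.
- by have [] := neta y Oy.
- by have [] := neta y Oy.
- exact: gram_pos.
- exact: hN.
Qed.
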